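(* Let $\Lambda=\bigoplus_{i=0}^t\Lambda_{(i)}$ be a graded quasi-hereditary algebra with duality, with $\Lambda_{(0)}\cong k^{\times r}$ and $\Lambda$ generated in degree $1$. Let $h\colon\{1,\ldots,r\}\to\mathbb N_{\geq 0}$ be a height function satisfying both: (H1) $[(\Delta_j)_{(l)}\colon S_i]=0$ whenever $h(i)\neq h(j)-l$; (H2) for each $1\leq j\leq r$, the minimal graded tilting coresolution $0\to\Delta_j\to T^{0,j}\to T^{1,j}\to\cdots\to T^{n,j}\to 0$ has the property that for all $0\leq u\leq n$, the indecomposable direct summands of $T^{u,j}$ are of the form $T_i\langle\langle -u\rangle\rangle$ with $h(i)=h(j)-u$. Regrade $\Lambda$ according to the $\Delta$-grading. Then $\Lambda$ is a Koszul algebra with respect to $\Lambda_0\simeq\Delta$.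
   Context: $k$ is a field; $\Lambda$ is a finite dimensional $k$-algebra; modules are left modules. Fix an ordering $S_1,\dots,S_r$ of the simple $\Lambda$-modules, with corresponding primitive orthogonal idempotents $e_1,\dots,e_r\in\Lambda_{(0)}$, $1=e_1+\cdots+e_r$, projective covers $P_i=\Lambda e_i$ and injective envelopes $I_i$. The standard module $\Delta_i$ is the largest quotient of $P_i$ with no composition factors $S_j$, $j>i$; the costandard module $\nabla_i$ is the largest submodule of $I_i$ with no composition factors $S_j$, $j>i$; $\Delta=\bigoplus_{i=1}^r\Delta_i$. $\Lambda$ is quasi-hereditary if $\Lambda$ has a filtration with subfactors standard modules and each $\operatorname{End}_\Lambda(\Delta_i)$ is a division ring. It is a quasi-hereditary algebra with duality if it is equipped with a duality functor $(-)^\circ\colon\mathsf{mod}\,\Lambda\to\mathsf{mod}\,\Lambda$ with $S_i^\circ\simeq S_i$ for all $i$. The characteristic tilting module $\mathfrak T_c=\bigoplus_{i=1}^rT_i$ is the basic tilting-cotilting module having both a filtration by standard modules and a filtration by costandard modules; its indecomposable summands $T_i$ admit morphisms $\Delta_i\hookrightarrow T_i\twoheadrightarrow\nabla_i$ with non-zero composition. A tilting coresolution is a finite coresolution by modules in $\operatorname{add}\mathfrak T_c$. Original grading: $\Lambda=\bigoplus_{i=0}^t\Lambda_{(i)}$ is a grading with $\Lambda_{(0)}\cong k^{\times r}$ and $\Lambda$ generated in degree $1$, with shift $(M\langle\langle l\rangle\rangle)_{(i)}=M_{(i-l)}$. The modules $\Delta_j,\nabla_j,T_j$ have graded lifts,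 normalized with the top $S_j$ of $\Delta_j$ in degree $0$, and such that $\Delta_j\hookrightarrow T_j\twoheadrightarrow\nabla_j$ are of degree $0$; $(-)^\circ$ lifts to a duality on finitely generated graded modules with $S_j\langle\langle l\rangle\rangle^\circ\simeq S_j\langle\langle -l\rangle\rangle$. $[(\Delta_j)_{(l)}\colon S_i]$ is the multiplicity of $S_i$ in the degree $l$ part of $\Delta_j$. $\Delta$-grading: given (H1), $e_i\Lambda_{(1)}e_j\ne0$ implies $|h(i)-h(j)|=1$, and the $\Delta$-grading $\Lambda=\bigoplus_{i\geq0}\Lambda_i$ is defined by assigning to each non-zero space $e_i\Lambda_{(l)}e_j$ the degree $\deg_\Delta(e_i\Lambda_{(l)}e_j)=\frac{l+h(i)-h(j)}{2}\geq 0$. In this grading $\Lambda_0\simeq\Delta$ as graded $\Lambda$-modules (concentrated in degree $0$). Koszulity: for a graded algebra $\Lambda=\bigoplus_{i\geq0}\Lambda_i$ with $\operatorname{gldim}\Lambda_0<\infty$ and a graded $\Lambda$-module $T$ concentrated in degree $0$, $\Lambda$ is Koszul with respect to $T$ if (i) $T$ is a tilting $\Lambda_0$-module, i.e. $T$ is finitely generated (and basic), $\operatorname{pd}_{\Lambda_0}T<\infty$, $\operatorname{Ext}^i_{\Lambda_0}(T,T)=0$ for $i>0$, and there is an exact sequence $0\to\Lambda_0\to T_0\to\cdots\to T_n\to0$ with $T_i\in\operatorname{add}T$; and (ii) $T$ is graded self-orthogonal, i.e. $\operatorname{Ext}^i_{\mathsf{Gr}\,\Lambda}(T,T\langle j\rangle)=0$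 whenever $i\neq j$, where $\mathsf{Gr}\,\Lambda$ is the category of graded modules with degree $0$ morphisms and $(M\langle j\rangle)_i=M_{i-j}$. (The assertion that $\Lambda$ is Koszul with respect to $\Delta$ includes $\operatorname{gldim}\Lambda_0<\infty$.) *)

(* Defs.v *)
From HB Require Import structures.
From mathcomp Require Import all_boot all_order all_algebra all_field.

Set Implicit Arguments.
Unset Strict Implicit.
Unset Printing Implicit Defensive.

Import Order.TTheory GRing.Theory Num.Theory.
Local Open Scope ring_scope.

(** * Homological algebra in concrete categories of modules

   The same notions are needed for all left R-modules, for graded modules with
   degree 0 morphisms, and for the finitely generated objects of both.  In all
   of these, exactness is exactness of the underlying additive maps, so the
   notions are developed once, for a category of R-modules with extra structure
   and structure-preserving linear maps. *)

Definition surj (A B : Type) (f : A -> B) : Prop := forall y, exists x, f x = y.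

Record modcat (R : pzRingType) := Modcat {
  obj :> Type;
  carrier : obj -> lmodType R;
  mor : forall X Y : obj, (carrier X -> carrier Y) -> Prop;
  mor_linear : forall X Y (f : carrier X -> carrier Y), mor f -> linear f;
  mor_id : forall X, @mor X X id;
  mor_comp : forall X Y Z (f : carrier X -> carrier Y)
    (g : carrier Y -> carrier Z), mor f -> mor g -> mor (g \o f) }.

Record hom (R : pzRingType) (C : modcat R) (X Y : C) := Hom {
  hom_fun :> carrier X -> carrier Y;
  hom_mor : mor hom_fun }.

Section Category.

Variables (R : pzRingType) (C : modcat R).

Definition zero_obj (X : C) : Prop := forall x : carrier X, x = 0.

Definition isomorphic (X Y : C) : Prop :=
  exists (f : hom X Y) (g : hom Y X), cancel f g /\ cancel g f.

Definition direct_sum (I : finType) (Y : I -> C) (X : C) : Prop :=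
  exists (inj : forall i, hom (Y i) X) (pr : forall i, hom X (Y i)),
  [/\ forall i y, pr i (inj i y) = y,
      forall i j y, i != j -> pr i (inj j y) = 0
    & forall x, \sum_i inj i (pr i x) = x].

Definition summand (X Y : C) : Prop :=
  exists (i : hom X Y) (p : hom Y X), cancel i p.

Definition add_closure (T X : C) : Prop :=
  exists n (Y : C), direct_sum (fun _ : 'I_n => T) Y /\ summand X Y.

Definition indecomposable (X : C) : Prop :=
  ~ zero_obj X /\
  forall Y : bool -> C, direct_sum Y X -> exists b, zero_obj (Y b).

Definition basic (X : C) : Prop :=
  exists n (Y : 'I_n -> C),
  [/\ forall i, indecomposable (Y i),
      forall i j, isomorphic (Y i) (Y j) -> i = j
    & direct_sum Y X].

Definition simple (X : C) : Prop :=
  ~ zero_obj X /\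
  forall (Y : C) (i : hom Y X), injective i -> zero_obj Y \/ surj i.

(* [S], assumed simple, is isomorphic to a quotient of a subobject of [X];
   for [X] of finite length this is the non-vanishing of [X : S]. *)
Definition composition_factor (S X : C) : Prop :=
  exists (Y : C) (i : hom Y X) (p : hom Y S), injective i /\ surj p.

Definition short_exact (X Y Z : C) (i : hom X Y) (p : hom Y Z) : Prop :=
  [/\ injective i, surj p & forall y, p y = 0 <-> exists x, y = i x].

Inductive filtered (I : Type) (F : I -> C) : C -> Prop :=
| filtered_zero X : zero_obj X -> filtered F X
| filtered_step (a : I) X Y Z (i : hom X Y) (p : hom Y Z) :
    filtered F X -> isomorphic Z (F a) -> short_exact i p -> filtered F Y.

Definition projective (P : C) : Prop :=
  forall (X Y : C) (p : hom X Y) (f : hom P Y),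
    surj p -> exists g : hom P X, forall x, p (g x) = f x.

Definition injective_obj (I : C) : Prop :=
  forall (X Y : C) (i : hom X Y) (f : hom X I),
    injective i -> exists g : hom Y I, forall x, g (i x) = f x.

Definition projective_cover (P M : C) : Prop :=
  projective P /\
  exists p : hom P M, surj p /\
    forall (X : C) (g : hom X P), surj (p \o g) -> surj g.

Definition injective_envelope (M I : C) : Prop :=
  injective_obj I /\
  exists i : hom M I, injective i /\
    forall (X : C) (g : hom I X), injective (g \o i) -> injective g.

(* ... -> P 1 -> P 0 -> M -> 0 *)
Definition resolution (M : C) (P : nat -> C) (eps : hom (P 0%N) M)
    (d : forall n, hom (P n.+1) (P n)) : Prop :=
  [/\ surj eps,
      forall x, eps x = 0 <-> exists y, x = d 0%N y
    & forall n x, d n x = 0 <-> exists y, x = d n.+1 y].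

(* 0 -> M -> Q 0 -> Q 1 -> ... *)
Definition coresolution (M : C) (Q : nat -> C) (eta : hom M (Q 0%N))
    (d : forall n, hom (Q n) (Q n.+1)) : Prop :=
  [/\ injective eta,
      forall x, d 0%N x = 0 <-> exists y, x = eta y
    & forall n x, d n.+1 x = 0 <-> exists y, x = d n y].

(* A (co)resolution of finite length is one which is eventually zero. *)
Definition vanishes_after (n : nat) (X : nat -> C) : Prop :=
  forall m, (n < m)%N -> zero_obj (X m).

Definition pd_le (M : C) (n : nat) : Prop :=
  exists P eps d, [/\ @resolution M P eps d, forall m, projective (P m)
                    & vanishes_after n P].

Definition id_le (M : C) (n : nat) : Prop :=
  exists Q eta d, [/\ @coresolution M Q eta d, forall m, injective_obj (Q m)
                    & vanishes_after n Q].

(* Ext^n(M, N) = 0: the complex Hom(P, N) is exact in degree n for every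
   projective resolution P of M. *)
Definition ext_vanish (n : nat) (M N : C) : Prop :=
  forall (P : nat -> C) (eps : hom (P 0%N) M) (d : forall m, hom (P m.+1) (P m)),
    resolution eps d -> (forall m, projective (P m)) ->
  match n with
  | 0 => forall f : hom (P 0%N) N,
      (forall x, f (d 0%N x) = 0) -> forall x, f x = 0
  | m.+1 => forall f : hom (P m.+1) N,
      (forall x, f (d m.+1 x) = 0) ->
      exists g : hom (P m) N, forall x, f x = g (d m x)
  end.

Definition left_minimal (X Y : C) (f : hom X Y) : Prop :=
  forall g : hom Y Y, (forall x, g (f x) = f x) -> bijective g.

(* Minimality in terms of the differentials: the inclusion of the image of each
   differential, i.e. of each cosyzygy, in the next term is left minimal. *)
Definition minimal_coresolution (M : C) (Q : nat -> C) (eta : hom M (Q 0%N))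
    (d : forall n, hom (Q n) (Q n.+1)) : Prop :=
  [/\ coresolution eta d, left_minimal eta & forall n, left_minimal (d n)].

End Category.

Definition fin_gen (R : pzRingType) (M : lmodType R) : Prop :=
  exists n (g : 'I_n -> M), forall x,
  exists a : 'I_n -> R, x = \sum_i a i *: g i.

Definition fin_cat (R : pzRingType) (C : modcat R) : modcat R :=
  @Modcat R {X : C | fin_gen (carrier X)} (fun X => carrier (sval X))
    (fun X Y f => mor f) (fun X Y f hf => mor_linear hf)
    (fun X => mor_id (sval X)) (fun X Y Z f g hf hg => mor_comp hf hg).

Section ModCat.

Variable R : pzRingType.

Fact Mod_id (M : lmodType R) : linear (@id M).
Proof. by []. Qed.

Fact Mod_comp (M N P : lmodType R) (f : M -> N) (g : N -> P) :
  linear f -> linear g -> linear (g \o f).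
Proof. by move=> lf lg a x y /=; rewrite lf lg. Qed.

Definition Mod : modcat R :=
  @Modcat R (lmodType R) id (fun M N f => linear f) (fun _ _ _ lf => lf)
    Mod_id Mod_comp.

Definition division_End (M : Mod) : Prop :=
  ~ zero_obj M /\
  forall f : hom M M, (exists x, f x != 0) -> bijective f.

End ModCat.

(** * Dualities *)

Section Duality.

Variables (k : fieldType) (L : falgType k) (C : modcat L).

(* A k-linear contravariant equivalence of C with itself.  Morphisms are compared
   pointwise, and composites and linear combinations are given by their values. *)
Record duality := Duality {
  dual_obj :> C -> C;
  dual_hom : forall X Y : C, hom X Y -> hom (dual_obj Y) (dual_obj X);
  dual_hom_id : forall (X : C) (f : hom X X),
    f =1 id -> dual_hom f =1 id;
  dual_hom_comp : forall (X Y Z : C) (f : hom X Y) (g : hom Y Z) (h : hom X Z),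
    h =1 g \o f -> dual_hom h =1 dual_hom f \o dual_hom g;
  dual_hom_linear : forall (X Y : C) (a : k) (f g h : hom X Y),
    (forall x, h x = a%:A *: f x + g x) ->
    forall y, dual_hom h y = a%:A *: dual_hom f y + dual_hom g y;
  dual_hom_faithful : forall (X Y : C) (f g : hom X Y),
    dual_hom f =1 dual_hom g -> f =1 g;
  dual_hom_full : forall (X Y : C) (g : hom (dual_obj Y) (dual_obj X)),
    exists f : hom X Y, dual_hom f =1 g;
  dual_ess_surj : forall Y : C, exists X : C, isomorphic (dual_obj X) Y }.

End Duality.

Section DualTo.

Variables (k : fieldType) (L : falgType k) (C : modcat L).

(* M is finitely generated and D sends it to an object isomorphic to N. *)
Definition dual_to (D : duality (fin_cat C)) (M N : C) : Prop :=
  exists fM : fin_gen (carrier M),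
    isomorphic (sval (D (exist (fun X : C => fin_gen (carrier X)) M fM))) N.

End DualTo.

(** * Tilting modules over a finite dimensional algebra *)

(* D(A) = Hom_k(A, k), with the left A-module structure (a f)(x) = f (x a) *)
Definition dual_regular (k : fieldType) (A : falgType k) : Type := 'Hom(A, k^o).

Section DualRegular.

Variables (k : fieldType) (A : falgType k).

HB.instance Definition _ := GRing.Zmodule.copy (dual_regular A) 'Hom(A, k^o).

Definition dual_regular_scale (a : A) (f : dual_regular A) : dual_regular A :=
  ((f : 'Hom(A, k^o)) \o amulr a)%VF.

Fact dual_regular_scaleA a b f :
  dual_regular_scale a (dual_regular_scale b f) = dual_regular_scale (a * b) f.
Proof. by apply/lfunP=> x; rewrite !comp_lfunE !lfunE /= mulrA. Qed.

Fact dual_regular_scale1 : left_id 1 dual_regular_scale.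
Proof. by move=> f; apply/lfunP=> x; rewrite comp_lfunE lfunE /= mulr1. Qed.

Fact dual_regular_scaleDr : right_distributive dual_regular_scale +%R.
Proof. by move=> a f g; apply/lfunP=> x; rewrite comp_lfunE !add_lfunE !comp_lfunE. Qed.

Fact dual_regular_scaleDl f : {morph dual_regular_scale^~ f : a b / a + b}.
Proof.
move=> a b; apply/lfunP=> x.
by rewrite add_lfunE !comp_lfunE !lfunE /= mulrDr linearD.
Qed.

HB.instance Definition _ :=
  GRing.Zmodule_isLmodule.Build A (dual_regular A) dual_regular_scaleA
    dual_regular_scale1 dual_regular_scaleDr dual_regular_scaleDl.

Definition finite_gldim : Prop :=
  exists n, forall M : Mod A, pd_le M n.

Definition self_orthogonal (T : Mod A) : Prop :=
  forall n, (0 < n)%N -> ext_vanish n T T.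

Definition tilting (T : Mod A) : Prop :=
  [/\ fin_gen (carrier T), basic T, exists n, pd_le T n, self_orthogonal T
    & exists n Q eta d,
      [/\ @coresolution _ (Mod A) (A^o : lmodType A) Q eta d,
          forall m, add_closure T (Q m) & vanishes_after n Q]].

Definition cotilting (T : Mod A) : Prop :=
  [/\ fin_gen (carrier T), basic T, exists n, id_le T n, self_orthogonal T
    & exists n P eps d,
      [/\ @resolution _ (Mod A) (dual_regular A : lmodType A) P eps d,
          forall m, add_closure T (P m) & vanishes_after n P]].

End DualRegular.

(** * Quasi-hereditary algebras *)

Section LeftIdeal.

Variables (k : fieldType) (A : falgType k) (e : A).

(* The left ideal A e, as an A-submodule of the regular module *)
Definition in_left_ideal : {pred A^o} := fun x => x \in limg (amulr e).

Fact in_left_ideal_submod : submod_closed in_left_ideal.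
Proof.
split=> [|a x y]; first exact: mem0v.
move=> /memv_imgP[u _ ->] /memv_imgP[v _ ->].
apply/memv_imgP; exists (a * u + v); first exact: memvf.
by rewrite !lfunE /= mulrDl -mulrA.
Qed.

HB.instance Definition _ :=
  GRing.isSubmodClosed.Build A A^o in_left_ideal in_left_ideal_submod.

Record left_ideal := LeftIdeal {
  left_ideal_val :> A^o;
  left_idealP : left_ideal_val \in in_left_ideal }.

HB.instance Definition _ := [isSub for left_ideal_val].
HB.instance Definition _ := [Choice of left_ideal by <:].
HB.instance Definition _ := [SubChoice_isSubLmodule of left_ideal by <:].

End LeftIdeal.

Section QuasiHereditary.

Variables (k : fieldType) (A : falgType k) (r : nat).

Definition primitive_idempotent (e : A) : Prop :=
  [/\ e * e = e, e != 0
    & forall f g : A, f * f = f -> g * g = g -> f * g = 0 -> g * f = 0 ->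
      e = f + g -> f = 0 \/ g = 0].

Definition ordered_simples (e : 'I_r -> A) (S : 'I_r -> Mod A) : Prop :=
  [/\ [/\ forall i, simple (S i),
          forall i j, isomorphic (S i) (S j) -> i = j
        & forall M : Mod A, simple M -> exists i, isomorphic M (S i)],
      [/\ forall i, primitive_idempotent (e i),
          forall i j, i != j -> e i * e j = 0
        & \sum_i e i = 1]
    & forall i, projective_cover (left_ideal (e i) : Mod A) (S i)].

Definition no_factor_above (S : 'I_r -> Mod A) (i : 'I_r) (M : Mod A) : Prop :=
  forall j : 'I_r, (i < j)%N -> ~ composition_factor (S j) M.

Definition standard (e : 'I_r -> A) (S : 'I_r -> Mod A) (i : 'I_r)
    (D : Mod A) : Prop :=
  no_factor_above S i D /\
  exists p : hom (left_ideal (e i) : Mod A) D, surj p /\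
    forall (M : Mod A) (q : hom (left_ideal (e i) : Mod A) M),
      surj q -> no_factor_above S i M ->
      exists f : hom D M, forall x, f (p x) = q x.

Definition costandard (S : 'I_r -> Mod A) (i : 'I_r) (N : Mod A) : Prop :=
  no_factor_above S i N /\
  exists I : Mod A, injective_envelope (S i) I /\
  exists u : hom N I, injective u /\
    forall (M : Mod A) (v : hom M I),
      injective v -> no_factor_above S i M ->
      exists f : hom M N, forall x, u (f x) = v x.

Definition quasi_hereditary (Delta : 'I_r -> Mod A) : Prop :=
  filtered Delta (A^o : lmodType A) /\ forall i, division_End (Delta i).

Definition characteristic_tilting (Delta Nabla T : 'I_r -> Mod A)
    (Tc : Mod A) : Prop :=
  [/\ forall i, indecomposable (T i), direct_sum T Tc,
      tilting Tc /\ cotilting Tc, filtered Delta Tc & filtered Nabla Tc].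

End QuasiHereditary.

(** * Graded algebras and graded modules *)

(* [gr_top] is only a bound: components up to it may vanish. *)
Record grading (k : fieldType) (L : falgType k) := Grading {
  gr_comp :> nat -> {vspace L};
  gr_top : nat;
  gr_bound : forall i, (gr_top < i)%N -> gr_comp i = 0%VS;
  gr_direct : directv (\sum_(i < gr_top.+1) gr_comp i);
  gr_full : (\sum_(i < gr_top.+1) gr_comp i)%VS = fullv;
  gr_one : 1 \in gr_comp 0;
  gr_mul : forall i j, (gr_comp i * gr_comp j <= gr_comp (i + j))%VS }.

Section DegreeZeroPart.

Variables (k : fieldType) (L : falgType k) (G : grading L).

Fact gr0_is_aspace : is_aspace (G 0).
Proof. by rewrite /is_aspace has_algid1 ?gr_one //= (gr_mul G 0 0). Qed.

Definition gr0_aspace : {aspace L} := ASpace gr0_is_aspace.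

Definition gr0 : falgType k := subvs_of gr0_aspace.

Definition gr0_val (x : gr0) : L := vsval x.

Fact gr0_val_additive : zmod_morphism gr0_val.
Proof. by []. Qed.

Fact gr0_val_monoid : monoid_morphism gr0_val.
Proof.
by split=> //; apply/eqP; rewrite -[X in X == _]/(algid gr0_aspace) algid_eq1 gr_one.
Qed.

HB.instance Definition _ :=
  GRing.isZmodMorphism.Build gr0 L gr0_val gr0_val_additive.
HB.instance Definition _ :=
  GRing.isMonoidMorphism.Build gr0 L gr0_val gr0_val_monoid.

End DegreeZeroPart.

Definition restrict (R S : pzRingType) (f : {rmorphism S -> R})
  (M : lmodType R) : Type := M.

Section Restriction.

Variables (R S : pzRingType) (f : {rmorphism S -> R}) (M : lmodType R).

HB.instance Definition _ := GRing.Zmodule.copy (restrict f M) M.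

Definition restrict_scale (s : S) (x : restrict f M) : restrict f M :=
  f s *: (x : M).

Fact restrict_scaleA s t x :
  restrict_scale s (restrict_scale t x) = restrict_scale (s * t) x.
Proof. by rewrite /restrict_scale scalerA rmorphM. Qed.

Fact restrict_scale1 : left_id 1 restrict_scale.
Proof. by move=> x; rewrite /restrict_scale rmorph1 scale1r. Qed.

Fact restrict_scaleDr : right_distributive restrict_scale +%R.
Proof. by move=> s x y; rewrite /restrict_scale scalerDr. Qed.

Fact restrict_scaleDl x : {morph restrict_scale^~ x : s t / s + t}.
Proof. by move=> s t; rewrite /restrict_scale rmorphD scalerDl. Qed.

HB.instance Definition _ :=
  GRing.Zmodule_isLmodule.Build S (restrict f M) restrict_scaleA
    restrict_scale1 restrict_scaleDr restrict_scaleDl.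

End Restriction.

Section GradedModules.

Variables (k : fieldType) (L : falgType k) (G : grading L).

(* A Z-grading of a module is given by its projections [gm_pr] onto the
   homogeneous components; the degree i component is the image of [gm_pr i]. *)
Record gmod := Gmod {
  gm_mod :> lmodType L;
  gm_pr : int -> gm_mod -> gm_mod;
  gm_prD : forall i x y, gm_pr i (x + y) = gm_pr i x + gm_pr i y;
  gm_pr_orth : forall i j x,
    gm_pr i (gm_pr j x) = if i == j then gm_pr j x else 0;
  gm_pr_sum : forall x, exists2 s : seq int, uniq s & x = \sum_(i <- s) gm_pr i x;
  gm_pr_scale : forall (d : nat) (a : L) (i : int) x, a \in G d ->
    gm_pr (d%:Z + i) (a *: gm_pr i x) = a *: gm_pr i x }.

Definition in_degree (M : gmod) (i : int) (x : M) : Prop := gm_pr i x = x.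

Definition concentrated (M : gmod) (i : int) : Prop :=
  forall x : M, in_degree i x.

Definition graded_mor (M N : gmod) (f : M -> N) : Prop :=
  linear f /\ forall i x, f (gm_pr i x) = gm_pr i (f x).

Fact graded_mor_linear (M N : gmod) (f : M -> N) : graded_mor f -> linear f.
Proof. by case. Qed.

Fact graded_mor_id (M : gmod) : @graded_mor M M id.
Proof. by []. Qed.

Fact graded_mor_comp (M N P : gmod) (f : M -> N) (g : N -> P) :
  graded_mor f -> graded_mor g -> graded_mor (g \o f).
Proof.
by move=> [lf df] [lg dg]; split=> [|i x]; [exact: Mod_comp | rewrite /= df dg].
Qed.

Definition Gr : modcat L :=
  @Modcat L gmod gm_mod graded_mor graded_mor_linear graded_mor_id
    graded_mor_comp.

Section Shift.

Variables (M : gmod) (l : int).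

Definition shift_pr (i : int) (x : M) : M := gm_pr (i - l) x.

Fact shift_prD i x y : shift_pr i (x + y) = shift_pr i x + shift_pr i y.
Proof. exact: gm_prD. Qed.

Fact shift_pr_orth i j x :
  shift_pr i (shift_pr j x) = if i == j then shift_pr j x else 0.
Proof. by rewrite /shift_pr gm_pr_orth (inj_eq (addIr _)). Qed.

Fact shift_pr_sum x :
  exists2 s : seq int, uniq s & x = \sum_(i <- s) shift_pr i x.
Proof.
have [s us {1}->] := gm_pr_sum x; exists [seq i + l | i <- s].
  by rewrite map_inj_uniq //; exact: addIr.
by rewrite big_map; apply: eq_bigr => i _; rewrite /shift_pr addrK.
Qed.

Fact shift_pr_scale (d : nat) (a : L) (i : int) x : a \in G d ->
  shift_pr (d%:Z + i) (a *: shift_pr i x) = a *: shift_pr i x.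
Proof. by move=> Ga; rewrite /shift_pr -addrA gm_pr_scale. Qed.

(* (shift M l)_i = M_(i - l) *)
Definition shift : gmod :=
  Gmod shift_prD shift_pr_orth shift_pr_sum shift_pr_scale.

End Shift.

(* The underlying module and the underlying linear map *)
Definition forget (M : fin_cat Gr) : fin_cat (Mod L) :=
  exist (fun X : Mod L => fin_gen (carrier X)) (gm_mod (sval M)) (svalP M).

Definition forget_hom (M N : fin_cat Gr) (f : hom M N) :
    hom (forget M) (forget N) :=
  @Hom L (fin_cat (Mod L)) (forget M) (forget N) f (graded_mor_linear (hom_mor f)).

Definition duality_lift (D : duality (fin_cat (Mod L)))
    (Dgr : duality (fin_cat Gr)) : Prop :=
  exists (u : forall M, hom (forget (Dgr M)) (D (forget M))),
    (forall M, bijective (u M)) /\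
    forall (M N : fin_cat Gr) (f : hom M N) (y : carrier (Dgr N)),
      u M (dual_hom Dgr f y) = dual_hom D (forget_hom f) (u N y).

Definition degree0_iso_power (r : nat) : Prop :=
  exists f : {rmorphism gr0 G -> {ffun 'I_r -> k}},
    bijective f /\ forall (a : k) x, f (a *: x) = [ffun i => a * f x i].

Definition generated_in_degree1 : Prop := agenv (G 0%N + G 1%N)%VS = fullv.

(* [M_(l) : S] != 0, for M_(l) the degree l part of M as a module over the
   degree 0 part of the algebra *)
Definition degree_factor (M : gmod) (l : int) (S : Mod L) : Prop :=
  exists (X : Mod (gr0 G)) (i : hom X (restrict (@gr0_val _ _ G) M : Mod (gr0 G)))
    (p : hom X (restrict (@gr0_val _ _ G) S : Mod (gr0 G))),
  [/\ injective i, surj p & forall x, @in_degree M l (i x)].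

(* M is the degree 0 part of L, viewed as the quotient of L by its components of
   positive degree. *)
Definition is_degree0_part (M : gmod) : Prop :=
  concentrated M 0 /\
  exists f : hom (L^o : Mod L) (gm_mod M : Mod L),
    (forall d a, (0 < d)%N -> a \in G d -> f a = 0) /\
    forall m, exists! a, a \in G 0%N /\ f a = m.

Definition koszul (T : gmod) : Prop :=
  [/\ finite_gldim (gr0 G), concentrated T 0,
      tilting (restrict (@gr0_val _ _ G) T : Mod (gr0 G))
    & forall (i : nat) (j : int), i%:Z != j ->
        @ext_vanish _ Gr i T (shift T j)].

(* Each S j is placed in degree 0, and this fixes the shifts of the others. *)
Definition normalized_lifts (r : nat) (S Delta Nabla T : 'I_r -> gmod) : Prop :=
  [/\ forall j, concentrated (S j) 0,
      forall j, exists p : hom (Delta j : Gr) (S j : Gr), surj p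
    & forall j, exists (i : hom (Delta j : Gr) (T j : Gr))
                       (p : hom (T j : Gr) (Nabla j : Gr)),
        [/\ injective i, surj p & exists x, p (i x) != 0]].

Section DeltaGrading.

Variables (r : nat) (e : 'I_r -> L) (h : 'I_r -> nat).

(* The sum of the spaces e_i L_(l) e_j with (l + h i - h j) / 2 = d *)
Definition delta_comp (d : nat) : {vspace L} :=
  (\sum_(i < r) \sum_(j < r)
     \sum_(l < (gr_top G).+1 | (l + h i == h j + d.*2)%N)
       <[e i]> * G l * <[e j]>)%VS.

Definition H1 (S Delta : 'I_r -> gmod) : Prop :=
  forall (i j : 'I_r) (l : int), (h i)%:Z != (h j)%:Z - l ->
    ~ degree_factor (Delta j) l (gm_mod (S i)).

(* The minimal graded coresolution of Delta_j by modules in add Tc is unique up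
   to isomorphism, so it is given by one that has the property.  [Q u] is
   T^{u,j}, a graded module whose underlying module lies in add Tc. *)
Definition H2 (Delta T : 'I_r -> gmod) (Tc : Mod L) : Prop :=
  forall j : 'I_r,
  exists n (Q : nat -> Gr) (eta : hom (Delta j : Gr) (Q 0%N))
    (d : forall u, hom (Q u) (Q u.+1)),
  [/\ minimal_coresolution eta d,
      forall u, add_closure Tc (gm_mod (Q u) : Mod L),
      vanishes_after n Q
    & forall u (X : Gr), (u <= n)%N -> indecomposable X -> summand X (Q u) ->
      exists i : 'I_r, (h i)%:Z = (h j)%:Z - u%:Z
        /\ isomorphic X (shift (T i) (- u%:Z) : Gr)].

End DeltaGrading.

End GradedModules.

(* Main.v *)
(* Let B be the degree 0 part of the Delta-grading.  It is a directed algebra, the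
   standard modules are the B e_j, so that they and Lambda are projective over B,
   and costandard modules are coinduced from the simple B-modules.  Therefore maps
   into a module with a costandard filtration extend from the kernel of any B-split
   map of a projective Lambda-module.  Projective resolutions of Lambda_0 are
   B-split, so Ext^n(Lambda_0, T_i) = 0 for n > 0, and dimension shifting along the
   coresolution of (H2) reduces Ext^n(Lambda_0, Delta_j<v>) to degree considerations
   on Hom(Lambda_0, T^{n,j}<v>), i.e. on the maps from Delta_i to the T_m.  The duality
   gives a graded anti-automorphism of Lambda fixing the e_i, with T_m self-dual for
   the duality it induces, and this turns a map from Delta_i to T_m into a map from T_m
   to nabla_i; the degrees of the latter are found by induction on h(m) along (H2). *)

Require Import Defs.
From HB Require Import structures.
From mathcomp Require Import all_boot all_order all_algebra all_field.
From mathcomp Require Import generic_quotient ring_quotient boolp classical_sets.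
From mathcomp Require Import ring zify.
Import Defs.

Set Implicit Arguments.
Unset Strict Implicit.
Unset Printing Implicit Defensive.

Import Order.TTheory GRing.Theory Num.Theory.
Local Open Scope ring_scope.

(** * Submodules, quotients, complements *)

(** Resolutions consist of arbitrary, possibly infinite dimensional graded modules, and the duality
    is only a functor; both facts shape the proof. Modules over B are never formed: projectivity and
    splitting over B are conditions on B-linear maps between Lambda-modules, and a costandard module
    is recognised by a universal functional with values in k. Linear complements come from Zorn's
    lemma. The anti-automorphism is found on a module W whose dual is the regular module: End(W) is
    again Lambda, and comparing its action with that of Lambda reverses products. The result need
    not respect degrees; its associated graded map does. Where the diagonal comes from: the
    generator of Delta_i can be mapped to T_m only in degree h(m) - h(i). In T_m<<-u>> with h(m) =
    h(j) - u this becomes h(j) - h(i) - 2u, the drop of height and the shift contributing u each.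
    The Delta-grading halves degrees, which leaves Hom(Lambda_0, T^{u,j}<v>) = 0 unless u = v. *)

Section LinearFacts.

Variables (R : pzRingType) (M N : lmodType R) (f : M -> N).
Hypothesis lf : linear f.

Lemma linD x y : f (x + y) = f x + f y.
Proof. by have := lf 1 x y; rewrite !scale1r. Qed.

Lemma lin0 : f 0 = 0.
Proof. by apply: (@addrI _ (f 0)); rewrite -linD !addr0. Qed.

Lemma linZ a x : f (a *: x) = a *: f x.
Proof. by have := lf a x 0; rewrite !addr0 lin0 addr0. Qed.

Lemma linN x : f (- x) = - f x.
Proof. by rewrite -scaleN1r linZ scaleN1r. Qed.

Lemma linB x y : f (x - y) = f x - f y.
Proof. by rewrite linD linN. Qed.

Lemma lin_sum (I : Type) (s : seq I) (P : pred I) (F : I -> M) :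
  f (\sum_(i <- s | P i) F i) = \sum_(i <- s | P i) f (F i).
Proof. exact: (big_morph f linD lin0). Qed.

Lemma lin_inj : (forall x, f x = 0 -> x = 0) -> injective f.
Proof. by move=> f0 x y e; apply/subr0_eq/f0; rewrite linB e subrr. Qed.

End LinearFacts.

Lemma dep_choice (I : Type) (T : I -> Type) (P : forall i, T i -> Prop) :
  (forall i, exists x, P i x) -> exists f : forall i, T i, forall i, P i (f i).
Proof. by move=> ex; exists (fun i => sval (cid (ex i))) => i; exact: svalP (cid (ex i)). Qed.

Definition mkhom (R : pzRingType) (M N : lmodType R) (f : M -> N)
  (lf : linear f) : @hom R (Mod R) M N := @Hom R (Mod R) M N f lf.

Section SubQuo.

Variables (R : pzRingType) (M : lmodType R).

Definition is_sub (P : M -> Prop) : Prop :=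
  P 0 /\ forall a x y, P x -> P y -> P (a *: x + y).

Variables (P : M -> Prop) (sP : is_sub P).

(** The closure proof is an argument so that the submodule instance, and with it [sub] and [quo],
    can be inferred from the predicate. *)
Definition in_sub of is_sub P : {pred M} := fun x => `[<P x>].

Fact in_sub_closed : submod_closed (in_sub sP).
Proof.
case: (sP) => P0 PD; split=> [|a x y]; first by apply/asboolP.
by move=> /asboolP Px /asboolP Py; apply/asboolP; apply: PD.
Qed.

HB.instance Definition _ :=
  GRing.isSubmodClosed.Build R M (in_sub sP) in_sub_closed.

Record sub := Sub_ { sub_val :> M; subP : sub_val \in in_sub sP }.

HB.instance Definition _ := [isSub for sub_val].
HB.instance Definition _ := [Choice of sub by <:].
HB.instance Definition _ := [SubChoice_isSubLmodule of sub by <:].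

Definition mksub (x : M) (Px : P x) : sub := Sub_ (introT (asboolP _) Px).

Lemma sub_prop (x : sub) : P (sub_val x).
Proof. exact/asboolP/(subP x). Qed.

Lemma sub_val_lin : linear sub_val.
Proof. by []. Qed.

Lemma sub_val_inj : injective sub_val.
Proof. exact: val_inj. Qed.

Definition quo := Quotient.quot (in_sub sP).
HB.instance Definition _ := GRing.Zmodule.on quo.

Definition quo_pi (x : M) : quo := (\pi_quo x)%qT.

Lemma quo_piD x y : quo_pi (x + y) = quo_pi x + quo_pi y.
Proof. exact: raddfD. Qed.

Lemma quo_pi_eq x y : quo_pi x = quo_pi y <-> P (x - y).
Proof.
rewrite -(asboolE (P _)) -/(in_sub sP (x - y)) -[in_sub _ _]/(x - y \in in_sub sP).
by rewrite Quotient.idealrBE; split=> /eqP.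
Qed.

Lemma quo_surj (q : quo) : exists x, quo_pi x = q.
Proof. by exists (repr q); exact: reprK. Qed.

Definition quo_scale (a : R) (q : quo) : quo := quo_pi (a *: repr q).

Lemma quo_scale_pi a x : quo_scale a (quo_pi x) = quo_pi (a *: x).
Proof.
apply/quo_pi_eq; rewrite -scalerBr -[_ *: _]addr0; apply: sP.2; last exact: sP.1.
by apply/quo_pi_eq; exact: reprK.
Qed.

Fact quo_scaleA a b q : quo_scale a (quo_scale b q) = quo_scale (a * b) q.
Proof. by have [x <-] := quo_surj q; rewrite !quo_scale_pi scalerA. Qed.
Fact quo_scale1 : left_id 1 quo_scale.
Proof. by move=> q; have [x <-] := quo_surj q; rewrite quo_scale_pi scale1r. Qed.
Fact quo_scaleDr : right_distributive quo_scale +%R.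
Proof.
move=> a p q; have [x <-] := quo_surj p; have [y <-] := quo_surj q.
by rewrite -quo_piD !quo_scale_pi scalerDr quo_piD.
Qed.
Fact quo_scaleDl q : {morph quo_scale^~ q : a b / a + b}.
Proof.
by move=> a b; have [x <-] := quo_surj q; rewrite !quo_scale_pi scalerDl quo_piD.
Qed.

HB.instance Definition _ := GRing.Zmodule_isLmodule.Build R quo
  quo_scaleA quo_scale1 quo_scaleDr quo_scaleDl.

Lemma quo_pi_lin : linear quo_pi.
Proof. by move=> a x y; rewrite quo_piD -quo_scale_pi. Qed.

Lemma quo_pi0 x : quo_pi x = 0 <-> P x.
Proof. by rewrite -(lin0 quo_pi_lin) quo_pi_eq subr0. Qed.

End SubQuo.

(** * Complements and sections over the ground field *)

Section Complements.

Variables (k : fieldType) (A : falgType k).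

Lemma kscaleA (M : lmodType A) (c d : k) (x : M) :
  (c * d)%:A *: x = c%:A *: (d%:A *: x).
Proof. by rewrite scalerA -scalerAl mul1r scalerA. Qed.

Lemma kscaleE (M : lmodType A) (c : k) (a : A) (x : M) :
  (c *: a) *: x = c%:A *: (a *: x).
Proof. by rewrite scalerA mulr_algl. Qed.

Lemma kscaleDl (M : lmodType A) (c d : k) (x : M) :
  (c + d)%:A *: x = c%:A *: x + d%:A *: x.
Proof. by rewrite !scalerDl. Qed.

Lemma kscaleC (M : lmodType A) (c : k) (a : A) (x : M) :
  a *: (c%:A *: x) = c%:A *: (a *: x).
Proof. by rewrite !scalerA -scalerAr mulr1 mulr_algl. Qed.

Lemma kscale_eq0 (M : lmodType A) (c : k) (x : M) : x != 0 -> c%:A *: x = 0 -> c = 0.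
Proof.
move=> nx c0; apply/eqP/negPn/negP => nc; case/eqP: nx.
by rewrite -[x]scale1r -[1](scale1r (1 : A)) -(mulVf nc) kscaleA c0 scaler0.
Qed.

Lemma kscale_inj (M : lmodType A) (c d : k) (x : M) :
  x != 0 -> c%:A *: x = d%:A *: x -> c = d.
Proof.
by move=> nx e; apply/subr0_eq/(kscale_eq0 nx); rewrite scalerBl scalerBl e subrr.
Qed.

(** Modules carry no separate k-structure; scalars act through [c%:A]. *)
Definition klin (M N : lmodType A) (f : M -> N) : Prop :=
  forall c x y, f (c%:A *: x + y) = c%:A *: f x + f y.

Definition kfun (M : lmodType A) (b : M -> k) : Prop :=
  forall c x y, b (c%:A *: x + y) = c * b x + b y.

Section KFun.
Variables (M : lmodType A) (b : M -> k).
Hypothesis kb : kfun b.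

Lemma kfunD x y : b (x + y) = b x + b y.
Proof. by have := kb 1 x y; rewrite !scale1r mul1r. Qed.
Lemma kfun0 : b 0 = 0.
Proof. by apply: (@addrI _ (b 0)); rewrite -kfunD !addr0. Qed.
Lemma kfunZ c x : b (c%:A *: x) = c * b x.
Proof. by have := kb c x 0; rewrite !addr0 kfun0 addr0. Qed.
Lemma kfunN x : b (- x) = - b x.
Proof. by apply: (@addrI _ (b x)); rewrite -kfunD !subrr kfun0. Qed.
Lemma kfunB x y : b (x - y) = b x - b y.
Proof. by rewrite kfunD kfunN. Qed.
Lemma kfun_sum (I : Type) (s : seq I) (P : pred I) (F : I -> M) :
  b (\sum_(i <- s | P i) F i) = \sum_(i <- s | P i) b (F i).
Proof. exact: (big_morph b kfunD kfun0). Qed.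
End KFun.

Lemma lin_klin (M N : lmodType A) (f : M -> N) : linear f -> klin f.
Proof. by move=> lf c x y; rewrite lf. Qed.

Lemma klinD (M N : lmodType A) (f : M -> N) : klin f -> {morph f : x y / x + y}.
Proof. by move=> kf x y; have := kf 1 x y; rewrite !scale1r. Qed.

Lemma klin0 (M N : lmodType A) (f : M -> N) : klin f -> f 0 = 0.
Proof. by move=> kf; apply: (@addrI _ (f 0)); rewrite -klinD // !addr0. Qed.

Lemma klinB (M N : lmodType A) (f : M -> N) : klin f -> {morph f : x y / x - y}.
Proof.
move=> kf x y; apply: (@addIr _ (f y)); rewrite -klinD // !subrK //.
Qed.

Variable M : lmodType A.

Definition is_ksub (P : M -> Prop) : Prop :=
  P 0 /\ forall c x y, P x -> P y -> P (c%:A *: x + y).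

(** Zorn's lemma, as no dimension is assumed finite: a subspace maximal among those meeting [P]
    trivially is a complement, since a vector outside the sum could be adjoined to it. *)
Lemma kcompl (P : M -> Prop) : is_ksub P ->
  exists2 Q, is_ksub Q & (forall x, P x -> Q x -> x = 0) /\
    forall x, exists y z, [/\ P y, Q z & x = y + z].
Proof.
case=> P0 PD.
pose Z (Q : set M) := (forall c x y, Q x -> Q y -> Q (c%:A *: x + y)) /\
  forall x, P x -> Q x -> x = 0.
(* [Z] does not require 0 to lie in [Q], because the union of the empty chain has to satisfy [Z]
   too. Maximality excludes the empty set afterwards. *)
have [Q [[QD QP] Qmax]] : exists Q, Z Q /\ forall B, (Q `<` B)%classic -> ~ Z B.
  apply: Zorn_bigcup => F FZ Ftot; split=> [c x y [X FX Xx] [Y FY Yy]|x Px [X FX Xx]].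
    have [XY|YX] := Ftot X Y FX FY.
    - by exists Y => //; apply: (FZ Y FY).1 => //; exact: XY.
    - by exists X => //; apply: (FZ X FX).1 => //; exact: YX.
  exact: (FZ X FX).2.
have Q0 : Q 0.
  have [//|nQ0] := pselect (Q 0).
  have Qn x : ~ Q x by move=> Qx; apply: nQ0; have := QD (-1) x x Qx Qx; rewrite scaleNr scale1r scaleN1r addNr.
  case: (Qmax (fun x => x = 0)); last first.
    by split=> [c x y -> ->|x _ ->] //; rewrite scaler0 addr0.
  by split=> [x /Qn //|/(_ 0 erefl)].
exists Q => //; split=> // x.
have [//|nx] := pselect (exists y z, [/\ P y, Q z & x = y + z]).
pose B : set M := fun z => exists c w, Q w /\ z = c%:A *: x + w.
case: (Qmax B).
  split=> [w Qw|/(_ x) BQ]; first by exists 0, w; rewrite !scale0r add0r.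
  apply: nx; exists 0, x; split=> //; last by rewrite add0r.
  by apply: BQ; exists 1, 0; rewrite !scale1r addr0.
split=> [c _ _ [a [w [Qw ->]]] [b [v [Qv ->]]]|z Pz [c [w [Qw def_z]]]].
  exists (c * a + b), (c%:A *: w + v); split; first exact: QD.
  by rewrite kscaleDl kscaleA scalerDr addrACA.
have [c0|nc0] := eqVneq c 0.
  by move: def_z Pz; rewrite c0 !scale0r add0r => -> Pw; exact: QP.
case: nx; exists (c^-1%:A *: (c%:A *: x + w)), ((- c^-1)%:A *: w); split.
- by rewrite -def_z -[_ *: _]addr0; exact: PD.
- by rewrite -[_ *: _]addr0; exact: QD.
by rewrite scaleNr scaleNr scalerDr addrK -kscaleA mulVf // !scale1r.
Qed.

(** The functional is the coefficient of [x] along a complement of the line spanned by [x]. *)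
Lemma kfun_exists (x : M) : x != 0 -> exists2 b, kfun b & b x = 1.
Proof.
move=> nx; pose P y := exists c : k, y = c%:A *: x.
have sP : is_ksub P.
  split=> [|c _ _ [a ->] [b ->]]; first by exists 0; rewrite !scale0r.
  by exists (c * a + b); rewrite kscaleDl kscaleA.
have inj (c : k) : c%:A *: x = 0 -> c = 0 := kscale_eq0 nx.
have [Q [Q0 QD] [PQ0 PQ]] := kcompl sP.
have ex y : exists c, Q (y - c%:A *: x).
  have [_ [z [[c ->] Qz ->]]] := PQ y; by exists c; rewrite addrC addKr.
have uni y c d : Q (y - c%:A *: x) -> Q (y - d%:A *: x) -> c = d.
  move=> Qc Qd; apply/subr0_eq/inj/PQ0; first by exists (c - d).
  have := QD (-1) _ _ Qc Qd; rewrite !scaleN1r opprB addrA subrK => Q1.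
  by rewrite scalerBl scalerBl.
have [b bP] := choice ex; exists b => [c y z|].
  apply: (uni (c%:A *: y + z)) => //.
  have := QD c _ _ (bP y) (bP z).
  congr Q; rewrite scalerBr addrACA -opprD; congr (_ - _).
  by rewrite kscaleDl kscaleA.
by apply: (uni x) => //; rewrite !scale1r subrr.
Qed.

(** A complement of the kernel is mapped bijectively by [q]. *)
Lemma ksection (N : lmodType A) (q : M -> N) : klin q -> surj q ->
  exists2 s : N -> M, klin s & cancel s q.
Proof.
move=> kq sq; pose P x := q x = 0.
have sP : is_ksub P.
  split=> [|c x y]; rewrite /P; first exact: klin0.
  by rewrite kq => -> ->; rewrite scaler0 addr0.
have [Q [Q0 QD] [PQ0 PQ]] := kcompl sP.
have ex y : exists x, Q x /\ q x = y.
  have [x <-] := sq y; have [u [v [Pu Qv ->]]] := PQ x.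
  by exists v; rewrite klinD // Pu add0r.
have uni x y : Q x -> Q y -> q x = q y -> x = y.
  move=> Qx Qy e; apply/subr0_eq/PQ0; first by rewrite /P klinB // e subrr.
  rewrite -[- y]scaleN1r addrC -(scaleN1r (1 : A)); exact: QD.
have [s sP'] := choice ex; exists s => [c x y|y]; last exact: (sP' y).2.
apply: uni; [exact: (sP' _).1 | by apply: QD; exact: (sP' _).1|].
by rewrite kq !(sP' _).2.
Qed.

End Complements.

(** * Finite dimensional modules *)

Section FiniteDim.

Variables (k : fieldType) (A : falgType k).
Implicit Type M : lmodType A.

Definition kspan M (I : finType) (t : I -> M) : Prop :=
  forall x, exists v : I -> k, x = \sum_i (v i)%:A *: t i.

Definition kfg M (n : nat) : Prop := exists t : 'I_n -> M, kspan t.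

Definition kcoord M m (c : M -> 'rV[k]_m) (d : 'rV[k]_m -> M) : Prop :=
  [/\ cancel c d, cancel d c
    & forall a x y, c (a%:A *: x + y) = a *: c x + c y].

Lemma kspan_kfg M (I : finType) (t : I -> M) : kspan t -> kfg M #|I|.
Proof.
move=> st; exists (fun i => t (enum_val i)) => x; have [v ->] := st x.
by exists (fun i => v (enum_val i)); rewrite (reindex _ (onW_bij _ (enum_val_bij I))).
Qed.

Lemma fin_gen_kfg M : fin_gen M -> exists n, kfg M n.
Proof.
case=> n [g gP]; pose t (p : 'I_n * 'I_(\dim {:A})) := (vbasis {:A})`_p.2 *: g p.1.
exists #|{: 'I_n * 'I_(\dim {:A})}|; apply: (@kspan_kfg _ _ t) => x.
have [a ->] := gP x; exists (fun p => coord (vbasis {:A}) p.2 (a p.1)).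
rewrite -(pair_bigA _ (fun i j => (coord (vbasis {:A}) j (a i))%:A *: t (i, j))) /=.
apply: eq_bigr => i _; rewrite {1}(coord_vbasis (memvf (a i))) scaler_suml.
by apply: eq_bigr => j _; rewrite /t /= scalerA mulr_algl.
Qed.

(** A spanning family of least size is free, because a non-trivial relation lets one member be
    dropped. The bound on [m] is what later makes dimensions drop strictly. *)
Lemma kfg_coord M n : kfg M n ->
  exists m c d, (m <= n)%N /\ @kcoord M m c d.
Proof.
move=> Mn; have ex : exists m, `[<kfg M m>] by exists n; apply/asboolP.
case: (ex_minnP ex) => m /asboolP[t st] minm.
have le_mn : (m <= n)%N by apply: minm; apply/asboolP.
have free (v : 'I_m -> k) : \sum_i (v i)%:A *: t i = 0 -> forall i, v i = 0.
  move=> v0 i0; apply/eqP/negPn/negP => nv.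
  case: m t st minm le_mn v v0 i0 nv => [|m] t st minm le_mn v v0 i0 nv; first by case: i0 nv.
  have: (m.+1 <= m)%N; last by rewrite ltnn.
  apply: minm; apply/asboolP; exists (fun j => t (lift i0 j)) => x.
  have [u ->] := st x.
  exists (fun j => u (lift i0 j) - u i0 / v i0 * v (lift i0 j)).
  rewrite (_ : \sum_i _ = \sum_i (u i - u i0 / v i0 * v i)%:A *: t i); last first.
    under [RHS]eq_bigr => i _ do rewrite scalerBl scalerBl kscaleA.
    by rewrite sumrB -scaler_sumr v0 scaler0 subr0.
  by rewrite (bigD1_ord i0) //= divfK // subrr !scale0r add0r.
pose d (u : 'rV[k]_m) := \sum_i (u 0 i)%:A *: t i.
have dlin a u v : d (a *: u + v) = a%:A *: d u + d v.
  rewrite /d scaler_sumr -big_split; apply: eq_bigr => i _ /=.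
  by rewrite !mxE kscaleDl kscaleA.
have ex_c x : exists u, d u = x.
  have [v ->] := st x; exists (\row_i v i).
  by apply: eq_bigr => i _; rewrite mxE.
have d_inj : injective d.
  move=> u v e; apply/rowP => i; apply/subr0_eq.
  have: d (u - v) = 0.
    by rewrite addrC -scaleN1r dlin scaleNr scaleNr !scale1r e addNr.
  by move/free => /(_ i); rewrite !mxE.
have [c cd] := choice ex_c; exists m, c, d; split=> //; split=> // [u|a x y].
  exact: d_inj.
by apply: d_inj; rewrite dlin !cd.
Qed.

Lemma linear_row_mx m n (g : 'rV[k]_m -> 'rV[k]_n) : linear g ->
  exists E : 'M_(m, n), forall u, g u = u *m E.
Proof.
move=> lg; exists (\matrix_i g (delta_mx 0 i)) => u.
rewrite {1}(row_sum_delta u) (lin_sum lg) mulmx_sum_row.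
by apply: eq_bigr => i _; rewrite (linZ lg) rowK.
Qed.

Section Coord.
Variables (M : lmodType A) (m : nat) (c : M -> 'rV[k]_m) (d : 'rV[k]_m -> M).
Hypothesis cP : kcoord c d.

Lemma kcoordD x y : c (x + y) = c x + c y.
Proof. by case: cP => _ _ kc; have := kc 1 x y; rewrite !scale1r. Qed.

Lemma kcoord0 : c 0 = 0.
Proof. by apply: (@addrI _ (c 0)); rewrite -kcoordD !addr0. Qed.

Lemma kcoordV a u v : d (a *: u + v) = a%:A *: d u + d v.
Proof.
by case: cP => cd dc kc; apply: (can_inj cd); rewrite kc !dc.
Qed.

Lemma kcoordV0 : d 0 = 0.
Proof. by case: cP => cd dc _; rewrite -kcoord0 cd. Qed.

Lemma kcoord_mx (f : M -> M) : klin f -> exists E, forall x, c (f x) = c x *m E.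
Proof.
case: cP => cd dc kc kf; have [|E EP] := @linear_row_mx m m (fun u => c (f (d u))).
  by move=> a u v; rewrite kcoordV kf kc.
by exists E => x; rewrite -EP cd.
Qed.

End Coord.

(** The image and the kernel of an idempotent are complementary submodules. *)
Lemma idempotent_split M (e : M -> M) : @indecomposable A (Mod A) M ->
  linear e -> (forall x, e (e x) = e x) ->
  (forall x, e x = 0) \/ (forall x, e x = x).
Proof.
case=> _ indM le ee.
pose P (b : bool) x := if b then e x = x else e x = 0.
have sP b : is_sub (P b).
  case: b; split=> [|a x y] /=; rewrite ?(lin0 le) // le => -> -> //.
  by rewrite scaler0 addr0.
pose pr b (x : M) := if b then e x else x - e x.
have prP b x : P b (pr b x).
  by case: b => /=; rewrite ?ee // (linB le) ee subrr.
have lpr b : linear (fun x => mksub (sP b) (prP b x)).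
  move=> a x y; apply: val_inj; case: b => /=; rewrite le //.
  by rewrite opprD addrACA scalerBr.
case: (indM (fun b => sub (sP b) : Mod A)).
  exists (fun b => mkhom (@sub_val_lin _ _ _ (sP b))), (fun b => mkhom (lpr b)); split.
  - move=> b y; apply: val_inj; have := sub_prop y.
    by case: b y => y /=; rewrite /P => e0 //; rewrite e0 subr0.
  - move=> [] [] y //= _; apply: val_inj; have := sub_prop y; rewrite /P /= => e0 //.
    by rewrite e0 subrr.
  by move=> x; rewrite big_bool /= addrC subrK.
case=> z; [left | right] => x.
  exact: (congr1 val (z (mksub (sP true) (prP true x)))).
have := congr1 val (z (mksub (sP false) (prP false x))).
by move/subr0_eq.
Qed.

(** Fitting's lemma through polynomials in [f]: an idempotent polynomial in [f] splits off the part
    on which [f] is nilpotent. That part is not everything, as [f] fixes a non-zero vector, so by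
    indecomposability it is zero. *)
Lemma fitting M (f : M -> M) (x0 : M) : fin_gen M -> @indecomposable A (Mod A) M ->
  linear f -> f x0 = x0 -> x0 != 0 -> bijective f.
Proof.
move=> /fin_gen_kfg[n0 /kfg_coord[n [c [d [_ cP]]]]] indM lf fx0 nx0.
have [cd dc kc] := cP; have d0 := kcoordV0 cP.
case: n c d cP cd dc kc d0 => [|n] c d cP cd dc kc d0.
  by case/eqP: nx0; rewrite -[x0]cd [c _]thinmx0.
have [E EP] := kcoord_mx cP (lin_klin lf).
pose act (p : {poly k}) (x : M) := d (c x *m horner_mx E p).
have actM p q x : act (p * q) x = act q (act p x).
  by rewrite /act dc rmorphM /= -mulmxA.
have actD p q x : act (p + q) x = act p x + act q x.
  rewrite /act rmorphD /= mulmxDr; have := kcoordV cP 1 (c x *m horner_mx E p) (c x *m horner_mx E q).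
  by rewrite !scale1r.
have act1 x : act 1 x = x by rewrite /act rmorph1 mulmx1 cd.
have actX x : act 'X x = f x by rewrite /act horner_mx_X -EP cd.
(* The matrix of [f] commutes with that of every element of [A], hence so does every polynomial in
   it. *)
have lact p : linear (act p).
  move=> a x y.
  have kla : klin (fun z : M => a *: z).
    move=> b u v; rewrite scalerDr !scalerA; congr (_ *: _ + _).
    by rewrite -scalerAl mul1r -scalerAr mulr1.
  have [Ea EaP] := kcoord_mx cP kla.
  have cE : comm_mx E Ea.
    apply/row_matrixP => i; rewrite !row_mul.
    have -> : row i E = delta_mx 0 i *m E by rewrite rowE.
    rewrite -row_mul !rowE !mulmxA -[delta_mx 0 i]dc -EP -EaP -EaP -EP.
    by rewrite (linZ lf).
  rewrite /act (kcoordD cP) EaP mulmxDl -mulmxA.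
  have -> : Ea *m horner_mx E p = horner_mx E p *m Ea.
    exact/esym/(comm_horner_mx p cE).
  have := kcoordV cP 1 (c x *m horner_mx E p *m Ea) (c y *m horner_mx E p).
  rewrite !scale1r mulmxA => ->; congr (_ + _).
  by apply: (can_inj cd); rewrite EaP !dc.
(* The factor X makes 0 a root, so that m > 0 below; [p] still annihilates [f]. With p = q X^m and
   q(0) non-zero, Bezout gives u X^m + v q = 1, and u X^m acts as an idempotent. *)
pose p := 'X * char_poly E.
have p0 : p != 0 by rewrite mulf_neq0 ?polyX_eq0 // monic_neq0 // char_poly_monic.
have [m [q nq defp]] := multiplicity_XsubC p 0.
have {defp}defp : p = q * 'X^m by rewrite {1}defp subr0.
have m0 : (0 < m)%N.
  case: m defp => // ; rewrite expr0 mulr1 => defp.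
  by move: nq; rewrite p0 /= -defp /p rootM rootX eqxx.
have actp x : act p x = 0.
  by rewrite actM /act Cayley_Hamilton mulmx0.
have cop : coprimep 'X^m q.
  rewrite coprimep_expl // coprimep_sym -['X]subr0 coprimep_XsubC.
  by move: nq; rewrite p0.
have [[u v] /= uv1] := Bezout_eq1_coprimepP _ _ cop.
have eE x : act (u * 'X^m) x + act (v * q) x = x by rewrite -actD uv1 act1.
have kill x : act (v * q) (act (u * 'X^m) x) = 0.
  have e : u * 'X^m * (v * q) = p * (u * v) by rewrite defp; ring.
  by rewrite -actM e actM actp (lin0 (lact _)).
have ee x : act (u * 'X^m) (act (u * 'X^m) x) = act (u * 'X^m) x.
  by have := eE (act (u * 'X^m) x); rewrite kill addr0.
have [e0|e1] := idempotent_split indM (lact _) ee.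
  have fx i : act ('X^i) x0 = x0.
    by elim: i => [|i IH]; rewrite ?act1 // exprS actM actX fx0.
  have := eE x0; rewrite e0 add0r => vq.
  case/eqP: nx0; rewrite -(fx m) -vq -actM -mulrA -defp mulrC actM actp.
  exact: lin0.
case: m m0 e1 {defp cop uv1 eE kill ee} => // m _ e1.
(* The idempotent u X^(m+1) acts as the identity, so u X^m inverts X. *)
exists (act (u * 'X^m)) => x.
  by rewrite -actX -actM -[RHS]e1 exprS; congr (act _ _); ring.
by rewrite -actX -actM -[RHS]e1 exprSr mulrA.
Qed.

(** The projections onto the two parts have product 0, so their ranks add up to at most the
    dimension of [X], and the second rank is positive. *)
Lemma summand_kfg (X Y0 Y1 : lmodType A) (i0 : Y0 -> X) (p0 : X -> Y0)
    (i1 : Y1 -> X) (p1 : X -> Y1) n :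
  linear i0 -> linear p0 -> linear i1 -> linear p1 -> cancel i0 p0 ->
  cancel i1 p1 -> (forall y, p1 (i0 y) = 0) -> (exists y : Y1, y != 0) ->
  kfg X n -> exists2 m, (m < n)%N & kfg Y0 m.
Proof.
move=> li0 lp0 li1 lp1 K0 K1 p10 [y ny] /kfg_coord[N [c [d [leN cP]]]].
have [cd dc kc] := cP.
have [E EP] := kcoord_mx cP (lin_klin (Mod_comp lp0 li0)).
have [F FP] := kcoord_mx cP (lin_klin (Mod_comp lp1 li1)).
have EF : E *m F = 0.
  apply/row_matrixP => i; rewrite row_mul row0 rowE.
  by rewrite -[delta_mx 0 i]dc -EP -FP /= p10 (lin0 li1) (kcoord0 cP).
have nF : (0 < \rank F)%N.
  rewrite lt0n mxrank_eq0; apply/eqP => F0; case/eqP: ny.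
  have := FP (i1 y); rewrite F0 mulmx0 /= K1 => c0.
  by rewrite -[y]K1 -[i1 y]cd c0 (kcoordV0 cP) lin0.
exists (\rank E).
  apply: leq_trans leN; apply: leq_trans (mulmx0_rank_max EF).
  by rewrite -addn1 leq_add2l.
exists (fun i => p0 (d (row i (row_base E)))) => z.
have : (c (i0 z) <= row_base E)%MS.
  by rewrite eq_row_base -[z]K0 EP submxMl.
case/submxP => v vE; exists (fun i => v 0 i).
rewrite -{1}[z]K0 -[i0 z]cd vE mulmx_sum_row.
have dD : {morph d : u w / u + w} by move=> u w; have := kcoordV cP 1 u w; rewrite !scale1r.
rewrite (big_morph d dD (kcoordV0 cP)) (lin_sum lp0); apply: eq_bigr => i _.
by rewrite -(linZ lp0) -[_ *: _ in LHS]addr0 (kcoordV cP) (kcoordV0 cP) addr0.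
Qed.

End FiniteDim.

Section InjSurj.

Variable k : fieldType.

Lemma inj_row_free m n (E : 'M[k]_(m, n)) :
  (forall u : 'rV_m, u *m E = 0 -> u = 0) -> row_free E.
Proof.
move=> inj; rewrite -kermx_eq0; apply/eqP/row_matrixP => i; rewrite row0.
by apply: inj; apply/eqP; rewrite -row_mul mulmx_ker row0.
Qed.

Lemma klin_inj_surj (A : falgType k) (M : lmodType A) (f : M -> M) :
  fin_gen M -> klin f -> injective f -> surj f.
Proof.
move=> /fin_gen_kfg[n0 /kfg_coord[n [c [d [_ cP]]]]] kf inj y.
have [cd dc kc] := cP; have [E EP] := kcoord_mx cP kf.
have : row_full E.
  rewrite /row_full -/(row_free E); apply: inj_row_free => u uE.
  have: f (d u) = f 0 by apply: (can_inj cd); rewrite EP dc uE klin0 // (kcoord0 cP).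
  by move/inj/(congr1 c); rewrite dc (kcoord0 cP).
case/row_fullP=> F FE; exists (d (c y *m F)).
by apply: (can_inj cd); rewrite EP dc -mulmxA FE mulmx1.
Qed.

End InjSurj.

(** * Free modules and duals *)

Section FiniteSums.

Variables (I : choiceType) (V : zmodType).
Implicit Type h : I -> V.

Definition fsupp h : Prop := exists s : seq I, forall i, i \notin s -> h i = 0.

(** Sum of a finitely supported family over an infinite index type: some list containing the support
    is chosen, and [fsumE] shows the choice to be immaterial. *)
Definition fsum h : V :=
  \sum_(i <- undup (xget [::] (fun s : seq I => forall i, i \notin s -> h i = 0))) h i.

Lemma fsumE h (s : seq I) : uniq s -> (forall i, i \notin s -> h i = 0) ->
  fsum h = \sum_(i <- s) h i.
Proof.
move=> us sP; rewrite /fsum.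
set t := xget _ _.
have tP : forall i, i \notin t -> h i = 0.
  by have := @xgetPex _ [::] (fun s : seq I => forall i, i \notin s -> h i = 0) (ex_intro _ s sP).
rewrite (bigID (fun i => h i != 0)) /= [X in _ + X]big1 ?addr0; last first.
  by move=> i /negPn/eqP.
rewrite [RHS](bigID (fun i => h i != 0)) /= [X in _ = _ + X]big1 ?addr0; last first.
  by move=> i /negPn/eqP.
rewrite -big_filter -[RHS]big_filter; apply: perm_big; apply: uniq_perm.
- by rewrite filter_uniq ?undup_uniq.
- by rewrite filter_uniq.
move=> i; rewrite !mem_filter mem_undup; case: eqP => //= nh.
have [it|/tP //] := boolP (i \in t).
by have [is_|/sP //] := boolP (i \in s).
Qed.

Lemma fsum_eq h g : h =1 g -> fsum h = fsum g.
Proof. by move=> /funext ->. Qed.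

Lemma fsum0 : fsum (fun=> 0) = 0.
Proof. by rewrite (@fsumE _ [::]) ?big_nil. Qed.

Lemma fsum1 h i : (forall j, j != i -> h j = 0) -> fsum h = h i.
Proof.
move=> hi; rewrite (@fsumE _ [:: i]) ?big_seq1 // => j.
by rewrite inE; exact: hi.
Qed.

Lemma fsuppD h g : fsupp h -> fsupp g -> fsupp (fun i => h i + g i).
Proof.
move=> [s sP] [t tP]; exists (s ++ t) => i; rewrite mem_cat negb_or.
by case/andP=> /sP -> /tP ->; rewrite addr0.
Qed.

Lemma fsumD h g : fsupp h -> fsupp g ->
  fsum (fun i => h i + g i) = fsum h + fsum g.
Proof.
move=> [s sP] [t tP]; pose u := undup (s ++ t).
have hu i : i \notin u -> h i = 0 /\ g i = 0.
  by rewrite mem_undup mem_cat negb_or => /andP[/sP -> /tP ->].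
rewrite !(@fsumE _ u) ?undup_uniq ?big_split // => i /hu[hi gi].
all: by rewrite ?hi ?gi ?addr0.
Qed.

End FiniteSums.

Lemma fsupp_map (I : choiceType) (V W : zmodType) (f : I -> V -> W) (h : I -> V) :
  (forall i, f i 0 = 0) -> fsupp h -> fsupp (fun i => f i (h i)).
Proof. by move=> f0 [s sP]; exists s => i /sP ->. Qed.

Lemma fsum_map (I : choiceType) (V W : zmodType) (f : V -> W) (h : I -> V) :
  f 0 = 0 -> {morph f : x y / x + y} -> fsupp h ->
  f (fsum h) = fsum (fun i => f (h i)).
Proof.
move=> f0 fD [s sP].
have sP' i : i \notin undup s -> h i = 0 by rewrite mem_undup; exact: sP.
rewrite (fsumE (undup_uniq s) sP') (big_morph f fD f0).
by rewrite (@fsumE _ _ _ (undup s)) ?undup_uniq // => i /sP' ->.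
Qed.

Section FreeModule.

Variables (k : fieldType) (A : falgType k) (K : choiceType).

Record freemod := Free { free_fun :> K -> A; free_fsupp : fsupp free_fun }.

HB.instance Definition _ := gen_eqMixin freemod.
HB.instance Definition _ := gen_choiceMixin freemod.

Lemma free_eq (f g : freemod) : f =1 g -> f = g.
Proof.
by case: f g => [f sf] [g sg] /= /funext e; subst g; congr Free; exact: Prop_irrelevance.
Qed.

Fact free0_fsupp : fsupp (fun _ : K => 0 : A).
Proof. by exists [::]. Qed.
Definition free0 := Free free0_fsupp.
Definition freeN (f : freemod) :=
  Free (fsupp_map (f := fun _ z => - z) (fun _ => oppr0 _) (free_fsupp f)).
Definition freeD (f g : freemod) := Free (fsuppD (free_fsupp f) (free_fsupp g)).
Definition freeZ (a : A) (f : freemod) :=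
  Free (fsupp_map (f := fun _ z => a * z) (fun _ => mulr0 a) (free_fsupp f)).

Fact free_addA : associative freeD.
Proof. by move=> f g h; apply: free_eq => x; rewrite /= addrA. Qed.
Fact free_addC : commutative freeD.
Proof. by move=> f g; apply: free_eq => x; rewrite /= addrC. Qed.
Fact free_add0 : left_id free0 freeD.
Proof. by move=> f; apply: free_eq => x; rewrite /= add0r. Qed.
Fact free_addN : left_inverse free0 freeN freeD.
Proof. by move=> f; apply: free_eq => x; rewrite /= addNr. Qed.

HB.instance Definition _ :=
  GRing.isZmodule.Build freemod free_addA free_addC free_add0 free_addN.

Fact freeZA a b f : freeZ a (freeZ b f) = freeZ (a * b) f.
Proof. by apply: free_eq => x; rewrite /= mulrA. Qed.
Fact freeZ1 : left_id 1 freeZ.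
Proof. by move=> f; apply: free_eq => x; rewrite /= mul1r. Qed.
Fact freeZDr : right_distributive freeZ +%R.
Proof. by move=> a f g; apply: free_eq => x; rewrite /= mulrDr. Qed.
Fact freeZDl f : {morph freeZ^~ f : a b / a + b}.
Proof. by move=> a b; apply: free_eq => x; rewrite /= mulrDl. Qed.

HB.instance Definition _ :=
  GRing.Zmodule_isLmodule.Build A freemod freeZA freeZ1 freeZDr freeZDl.

Fact free_gen_fsupp (x : K) : fsupp (fun y => (y == x)%:R : A).
Proof. by exists [:: x] => y; rewrite inE => /negPf ->. Qed.
Definition free_gen x := Free (free_gen_fsupp x).

Lemma free_fsumE (I : choiceType) (h : I -> freemod) y : fsupp h ->
  (fsum h : freemod) y = fsum (fun i => h i y).
Proof. by move=> sh; rewrite (@fsum_map _ _ _ (fun f : freemod => f y)). Qed.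

Lemma free_genE (f : freemod) : f = fsum (fun x => f x *: free_gen x).
Proof.
have sf : fsupp (fun x => f x *: free_gen x).
  by apply: (fsupp_map (f := fun x z => z *: free_gen x)) (free_fsupp f) => x; rewrite scale0r.
apply: free_eq => y; rewrite free_fsumE // (@fsum1 _ _ _ y) => [|x nx].
  by rewrite /= eqxx mulr1.
by rewrite /= eq_sym (negPf nx) mulr0.
Qed.

(** A map is prescribed on each coordinate as a function of the coefficient, not by the image of a
    generator: for a map that is merely B-linear the coefficient cannot be pulled out. *)
Definition free_map (M : lmodType A) (v : K -> A -> M) (f : freemod) : M :=
  fsum (fun x => v x (f x)).

Lemma free_map_gen (M : lmodType A) (v : K -> A -> M) x :
  (forall x, v x 0 = 0) -> free_map v (free_gen x) = v x 1.
Proof.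
move=> v0; rewrite /free_map (@fsum1 _ _ _ x) /= ?eqxx // => y /negPf ->.
exact: v0.
Qed.

Lemma free_mapZD (M : lmodType A) (v : K -> A -> M) (a : A) f g :
  (forall x b c, v x (a * b + c) = a *: v x b + v x c) -> (forall x, v x 0 = 0) ->
  free_map v (a *: f + g) = a *: free_map v f + free_map v g.
Proof.
move=> vl v0; have sv (h : freemod) : fsupp (fun x => v x (h x)).
  exact: fsupp_map v0 (free_fsupp h).
rewrite /free_map.
have -> : a *: fsum (fun x => v x (f x)) = fsum (fun x => a *: v x (f x)).
  by apply: (@fsum_map _ _ _ (fun z : M => a *: z)); rewrite ?scaler0 //; exact: scalerDr.
rewrite -fsumD //; first by apply: fsum_eq => x; exact: vl.
by apply: (fsupp_map (f := fun _ z => a *: z)) => // x; exact: scaler0.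
Qed.

End FreeModule.

(** * Duals twisted by an anti-endomorphism *)

Section Dual.

Variables (k : fieldType) (A : falgType k).

Definition anti (tau : A -> A) : Prop :=
  [/\ forall (c : k) a b, tau (c *: a + b) = c *: tau a + tau b, tau 1 = 1
    & forall a b, tau (a * b) = tau b * tau a].

Variables (tau : A -> A) (tauP : anti tau).

Lemma antiD a b : tau (a + b) = tau a + tau b.
Proof. by case: tauP => tl _ _; have := tl 1 a b; rewrite !scale1r. Qed.
Lemma anti0 : tau 0 = 0.
Proof. by apply: (@addrI _ (tau 0)); rewrite -antiD !addr0. Qed.
Lemma antiZ c a : tau (c *: a) = c *: tau a.
Proof. by case: tauP => tl _ _; have := tl c a 0; rewrite anti0 !addr0. Qed.
Lemma antiB a b : tau (a - b) = tau a - tau b.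
Proof. by rewrite antiD -[- b]scaleN1r antiZ scaleN1r. Qed.
Lemma anti_sum (I : Type) (s : seq I) (P : pred I) (F : I -> A) :
  tau (\sum_(i <- s | P i) F i) = \sum_(i <- s | P i) tau (F i).
Proof. exact: (big_morph tau antiD anti0). Qed.
Lemma anti1 : tau 1 = 1. Proof. by case: tauP. Qed.
Lemma antiM a b : tau (a * b) = tau b * tau a. Proof. by case: tauP. Qed.
Lemma antiC c : tau c%:A = c%:A.
Proof. by rewrite antiZ anti1. Qed.

Variable M : lmodType A.

(* Hom_k(M, k), made a left module through the anti-automorphism [tau] *)
Record kdual (t : anti tau) := Dual { dual_fun :> M -> k; dualP : kfun dual_fun }.
Notation D := (kdual tauP).

HB.instance Definition _ := gen_eqMixin D.
HB.instance Definition _ := gen_choiceMixin D.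

Lemma dual_eq (f g : D) : f =1 g -> f = g.
Proof.
by case: f g => [f sf] [g sg] /= /funext e; subst g; congr Dual; exact: Prop_irrelevance.
Qed.

Fact dual0P : kfun (fun _ : M => 0 : k).
Proof. by move=> c x y; rewrite mulr0 addr0. Qed.
Fact dualNP (f : D) : kfun (fun x => - f x).
Proof. by move=> c x y; rewrite (dualP f) opprD mulrN. Qed.
Fact dualDP (f g : D) : kfun (fun x => f x + g x).
Proof. by move=> c x y; rewrite (dualP f) (dualP g) mulrDr addrACA. Qed.
Fact dualZP (a : A) (f : D) : kfun (fun x => f (tau a *: x)).
Proof.
move=> c x y; rewrite scalerDr scalerA -scalerAr mulr1 -mulr_algl -scalerA.
exact: (dualP f).
Qed.

Definition dual0 : D := Dual tauP dual0P.
Definition dualN (f : D) : D := Dual tauP (dualNP f).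
Definition dualD (f g : D) : D := Dual tauP (dualDP f g).
Definition dualZ (a : A) (f : D) : D := Dual tauP (dualZP a f).

Fact dual_addA : associative dualD.
Proof. by move=> f g h; apply: dual_eq => x; rewrite /= addrA. Qed.
Fact dual_addC : commutative dualD.
Proof. by move=> f g; apply: dual_eq => x; rewrite /= addrC. Qed.
Fact dual_add0 : left_id dual0 dualD.
Proof. by move=> f; apply: dual_eq => x; rewrite /= add0r. Qed.
Fact dual_addN : left_inverse dual0 dualN dualD.
Proof. by move=> f; apply: dual_eq => x; rewrite /= addNr. Qed.

HB.instance Definition _ :=
  GRing.isZmodule.Build D dual_addA dual_addC dual_add0 dual_addN.

Fact dualZA a b f : dualZ a (dualZ b f) = dualZ (a * b) f.
Proof. by apply: dual_eq => x; rewrite /= scalerA -antiM. Qed.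
Fact dualZ1 : left_id 1 dualZ.
Proof. by move=> f; apply: dual_eq => x; rewrite /= anti1 scale1r. Qed.
Fact dualZDr : right_distributive dualZ +%R.
Proof. by move=> a f g; apply: dual_eq => x. Qed.
Fact dualZDl f : {morph dualZ^~ f : a b / a + b}.
Proof. by move=> a b; apply: dual_eq => x; rewrite /= antiD scalerDl (kfunD (dualP f)). Qed.

HB.instance Definition _ :=
  GRing.Zmodule_isLmodule.Build A D dualZA dualZ1 dualZDr dualZDl.

Lemma dualE a (f : D) x : (a *: f) x = f (tau a *: x).
Proof. by []. Qed.

End Dual.

Section DualMap.

Variables (k : fieldType) (A : falgType k) (tau : A -> A) (tauP : anti tau).
Variables (M N : lmodType A) (f : M -> N).
Hypothesis lf : linear f.

Fact dual_map_fun (b : kdual N tauP) : kfun (fun x => b (f x)).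
Proof. by move=> c x y; rewrite (lin_klin lf) (dualP b). Qed.

Definition dual_map (b : kdual N tauP) : kdual M tauP := Dual tauP (dual_map_fun b).

Lemma dual_map_lin : linear dual_map.
Proof. by move=> a x y; apply: dual_eq => z /=; rewrite (linZ lf). Qed.

Lemma dual_map_inj : surj f -> injective dual_map.
Proof.
move=> sf b c e; apply: dual_eq => y; have [x <-] := sf y.
exact: (congr1 (fun d : kdual M tauP => d x) e).
Qed.

End DualMap.

Section DualExact.

Variables (k : fieldType) (A : falgType k) (tau : A -> A) (tauP : anti tau).
Variables (X Y Z : lmodType A) (i : X -> Y) (p : Y -> Z).
Hypotheses (li : linear i) (lp : linear p) (ii : injective i) (sp : surj p).
Hypothesis ip : forall y, p y = 0 <-> exists x, y = i x.

(** A k-linear section of [p] yields a k-linear retraction [r] of [i], and composition with [r]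
    extends functionals. *)
Lemma dual_map_surj : surj (dual_map (tauP := tauP) li).
Proof.
have [s ks sK] := ksection (lin_klin lp) sp.
have ex y : exists x, i x = y - s (p y).
  have [|x xE] := (ip (y - s (p y))).1; first by rewrite (linB lp) sK subrr.
  by exists x.
have [r rP] := choice ex.
move=> b; have kb : kfun (fun y => b (r y)).
  move=> c y z; rewrite -(dualP b); congr (b _); apply: ii.
  rewrite (lin_klin li) !rP (linD lp) (linZ lp) ks opprD addrACA scalerBr //.
exists (Dual tauP kb); apply: dual_eq => x /=; congr (b _); apply: ii.
have p0 : p (i x) = 0 by apply/ip; exists x.
by rewrite rP p0 (klin0 ks) subr0.
Qed.

Lemma dual_map_exact (b : kdual Y tauP) :
  dual_map li b = 0 <-> exists c : kdual Z tauP, b = dual_map lp c.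
Proof.
split=> [b0|[c ->]]; last first.
  apply: dual_eq => x /=; have -> : p (i x) = 0 by apply/ip; exists x.
  exact: (kfun0 (dualP c)).
have {}b0 x : b (i x) = 0 by exact: (congr1 (fun d : kdual X tauP => d x) b0).
have [s ks sK] := ksection (lin_klin lp) sp.
have kb : kfun (fun z => b (s z)) by move=> c x y; rewrite ks (dualP b).
exists (Dual tauP kb); apply: dual_eq => y /=; apply/eqP.
rewrite -subr_eq0 -(kfunB (dualP b)); apply/eqP.
have [|x ->] := (ip (y - s (p y))).1; last exact: b0.
by rewrite (linB lp) sK subrr.
Qed.

End DualExact.

(** * Relative projectivity over a subalgebra *)

Section Relative.

Variables (k : fieldType) (L : falgType k) (B : {vspace L}).
Hypothesis B1 : 1 \in B.

Definition blin (M N : lmodType L) (f : M -> N) : Prop :=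
  forall b x y, b \in B -> f (b *: x + y) = b *: f x + f y.

(** Projectivity over [B], tested only against L-linear maps of L-modules so that no B-module has to
    be built. Asking that [f] take values in the image of [q], instead of surjectivity of [q], saves
    passing to that image. *)
Definition bproj (M : lmodType L) : Prop :=
  forall (X Y : lmodType L) (q : X -> Y) (f : M -> Y), linear q -> blin f ->
  (forall m, exists x, f m = q x) -> exists2 g : M -> X, blin g & forall m, q (g m) = f m.

Definition lproj (M : lmodType L) : Prop :=
  forall (X Y : lmodType L) (q : X -> Y) (f : M -> Y), linear q -> linear f ->
  (forall m, exists x, f m = q x) -> exists2 g : M -> X, linear g & forall m, q (g m) = f m.

(** The map [s] is a section over the image of [f] only; x - s (f x) is then a B-linear projection
    onto the kernel. *)
Definition bsplit (M N : lmodType L) (f : M -> N) : Prop :=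
  exists2 s : N -> M, blin s & forall x, f (s (f x)) = f x.

Section BLin.
Variables (M N : lmodType L) (f : M -> N).
Hypothesis bf : blin f.

Lemma blinD x y : f (x + y) = f x + f y.
Proof. by have := bf x y B1; rewrite !scale1r. Qed.
Lemma blin0 : f 0 = 0.
Proof. by apply: (@addrI _ (f 0)); rewrite -blinD !addr0. Qed.
Lemma blinZ b x : b \in B -> f (b *: x) = b *: f x.
Proof. by move=> Bb; have := bf x 0 Bb; rewrite !addr0 blin0 addr0. Qed.
Lemma blin_sum (I : Type) (s : seq I) (P : pred I) (F : I -> M) :
  f (\sum_(i <- s | P i) F i) = \sum_(i <- s | P i) f (F i).
Proof. exact: (big_morph f blinD blin0). Qed.
End BLin.

Lemma lin_blin (M N : lmodType L) (f : M -> N) : linear f -> blin f.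
Proof. by move=> lf b x y _; rewrite lf. Qed.

Lemma blin_id (M : lmodType L) : blin (@id M).
Proof. by []. Qed.

Lemma blin_comp (M N K : lmodType L) (f : M -> N) (g : N -> K) :
  blin f -> blin g -> blin (g \o f).
Proof. by move=> bf bg b x y Bb; rewrite /= bf // bg. Qed.

Lemma blin_sub (M N : lmodType L) (f g : M -> N) :
  blin f -> blin g -> blin (fun x => f x - g x).
Proof.
by move=> bf bg b x y Bb; rewrite bf // bg // scalerBr opprD addrACA.
Qed.

Lemma blin_add (M N : lmodType L) (f g : M -> N) :
  blin f -> blin g -> blin (fun x => f x + g x).
Proof.
by move=> bf bg b x y Bb; rewrite bf // bg // scalerDr addrACA.
Qed.

Lemma bproj_retract (M N : lmodType L) (i : M -> N) (p : N -> M) :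
  blin i -> blin p -> cancel i p -> bproj N -> bproj M.
Proof.
move=> bi bp ip pN X Y q f lq bf fq.
have [||g bg gq] := pN X Y q (f \o p) lq; first exact: blin_comp.
  by move=> n; exact: fq.
by exists (g \o i); [exact: blin_comp | move=> m; rewrite /= gq /= ip].
Qed.

Lemma lproj_retract (M N : lmodType L) (i : M -> N) (p : N -> M) :
  linear i -> linear p -> cancel i p -> lproj N -> lproj M.
Proof.
move=> li lp ip pN X Y q f lq lf fq.
have [||g lg gq] := pN X Y q (f \o p) lq; first exact: Mod_comp.
  by move=> n; exact: fq.
by exists (g \o i); [exact: Mod_comp | move=> m; rewrite /= gq /= ip].
Qed.

Lemma bproj_zero (M : lmodType L) : (forall x : M, x = 0) -> bproj M.
Proof.
move=> M0 X Y q f lq bf _; exists (fun=> 0) => [b x y _|m].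
  by rewrite scaler0 addr0.
by rewrite (lin0 lq) [m]M0 (blin0 bf).
Qed.

(** A B-linear section of [p] makes [Y] the direct sum of [X] and [Z] over [B], and the lifts on the
    two parts are added. *)
Lemma bproj_ext (X Y Z : lmodType L) (i : X -> Y) (p : Y -> Z) :
  linear i -> linear p -> injective i -> surj p ->
  (forall y, p y = 0 <-> exists x, y = i x) -> bproj X -> bproj Z -> bproj Y.
Proof.
move=> li lp ii sp ip pX pZ U V q f lq bf fq.
have [||s bs sK] := pZ Y Z p id lp; first exact: blin_id.
  by move=> z; have [y <-] := sp z; exists y.
have ex y : exists x, i x = y - s (p y).
  have [|x xE] := (ip (y - s (p y))).1; first by rewrite (linB lp) sK subrr.
  by exists x.
have [r rP] := choice ex.
have br : blin r.
  move=> b x y Bb; apply: ii; rewrite li !rP lp bs //.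
  by rewrite scalerBr opprD addrACA.
have [||g bg gq] := pX U V q (f \o i) lq.
- exact: blin_comp (lin_blin li) bf.
- by move=> x; exact: fq.
have [||g' bg' gq'] := pZ U V q (f \o s) lq.
- exact: blin_comp.
- by move=> x; exact: fq.
exists (fun y => g (r y) + g' (p y)).
  apply: blin_add; first exact: blin_comp br bg.
  exact: blin_comp (lin_blin lp) bg'.
by move=> y; rewrite (linD lq) gq gq' /= rP -(blinD bf) subrK.
Qed.

Lemma lproj_free (K : choiceType) : lproj (freemod L K).
Proof.
move=> X Y q f lq lf fq.
have [v vq] := choice (fun x => fq (free_gen L x)).
have v0 x : 0 *: v x = 0 by rewrite scale0r.
exists (free_map (fun x a => a *: v x)).
  by move=> a g h; apply: free_mapZD => // x b c; rewrite scalerDl scalerA.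
move=> g; rewrite {2}(free_genE g) /free_map.
rewrite (fsum_map (lin0 lq) (linD lq)); last exact: (fsupp_map (f := fun x a => a *: v x)) (free_fsupp g).
rewrite (fsum_map (lin0 lf) (linD lf)); last first.
  by apply: (fsupp_map (f := fun x a => a *: free_gen L x)) (free_fsupp g) => x; rewrite scale0r.
by apply: fsum_eq => x; rewrite (linZ lq) (linZ lf) vq.
Qed.

Lemma bproj_free (K : choiceType) : bproj L^o -> bproj (freemod L K).
Proof.
move=> pL X Y q f lq bf fq.
have ex x : exists v : L^o -> X, blin v /\ forall a, q (v a) = f (a *: free_gen L x).
  have [||v bv vq] := pL X Y q (fun a => f (a *: free_gen L x)) lq.
  - by move=> b a c Bb; rewrite scalerDl -scalerA bf.
  - by move=> a; exact: fq.
  by exists v.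
have [v vP] := choice ex.
have v0 x : v x 0 = 0 by rewrite (blin0 (vP x).1).
exists (free_map v) => [b g h Bb|g].
  by apply: free_mapZD => // x c d; exact: (vP x).1.
rewrite {2}(free_genE g) /free_map.
rewrite (fsum_map (lin0 lq) (linD lq)); last exact: fsupp_map v0 (free_fsupp g).
rewrite (fsum_map (blin0 bf) (blinD bf)); last first.
  by apply: (fsupp_map (f := fun x a => a *: free_gen L x)) (free_fsupp g) => x; rewrite scale0r.
by apply: fsum_eq => x; exact: (vP x).2.
Qed.

Definition free_cover (M : lmodType L) : freemod L M -> M := free_map (fun x a => a *: x).

Lemma free_cover_lin (M : lmodType L) : linear (@free_cover M).
Proof.
move=> a g h; apply: free_mapZD => [x b c|x]; rewrite ?scale0r //.
by rewrite scalerDl scalerA.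
Qed.

Lemma free_cover_surj (M : lmodType L) : surj (@free_cover M).
Proof.
by move=> x; exists (free_gen L x); rewrite /free_cover free_map_gen ?scale1r // => y; rewrite scale0r.
Qed.

Lemma bproj_bsplit (M N : lmodType L) (f : M -> N) :
  linear f -> surj f -> bproj N -> bsplit f.
Proof.
move=> lf sf pN; have [||s bs sK] := pN M N f id lf; first exact: blin_id.
  by move=> z; have [y <-] := sf z; exists y.
by exists s.
Qed.

(** A section [t] of one map gives the projection x - t (q x) onto its kernel, which is the image of
    the next differential. Lifting that projection through the differential gives the next
    section. *)
Lemma resolution_bsplit (M : lmodType L) (P : nat -> lmodType L) (eps : P 0%N -> M)
    (d : forall n, P n.+1 -> P n) :
  linear eps -> (forall n, linear (d n)) -> surj eps ->
  (forall x, eps x = 0 <-> exists y, x = d 0%N y) ->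
  (forall n x, d n x = 0 <-> exists y, x = d n.+1 y) ->
  bproj M -> (forall n, bproj (P n)) -> bsplit eps /\ forall n, bsplit (d n).
Proof.
move=> le ld se e0 ed pM pP; have [s bs sK] := bproj_bsplit le se pM.
split; first by exists s.
have step (N : lmodType L) n (q : P n -> N) (t : N -> P n) : linear q -> blin t ->
    (forall x, q x = 0 <-> exists y, x = d n y) -> (forall x, q (t (q x)) = q x) ->
    bsplit (d n).
  move=> lq bt qd tK.
  have [||g bg gq] := pP n _ _ (d n) (fun x => x - t (q x)) (ld n).
  - by apply: blin_sub; [exact: blin_id | exact: blin_comp (lin_blin lq) bt].
  - by move=> x; apply/qd; rewrite (linB lq) tK subrr.
  exists g => // x; rewrite gq; have -> : q (d n x) = 0 by apply/qd; exists x.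
  by rewrite (blin0 bt) subr0.
elim=> [|n [t bt tK]]; first exact: (step _ _ eps s).
exact: (step _ _ (d n) t).
Qed.

(** The same argument run from the right: the splitting starts beyond [N], where everything is zero,
    and descends. *)
Lemma coresolution_bsplit (M : lmodType L) (Q : nat -> lmodType L) (eta : M -> Q 0%N)
    (d : forall n, Q n -> Q n.+1) N :
  linear eta -> (forall n, linear (d n)) -> injective eta ->
  (forall x, d 0%N x = 0 <-> exists y, x = eta y) ->
  (forall n x, d n.+1 x = 0 <-> exists y, x = d n y) ->
  (forall n, (N < n)%N -> forall x : Q n, x = 0) ->
  (forall n, bproj (Q n)) ->
  (exists2 r : Q 0%N -> M, blin r & cancel eta r) /\ forall n, bsplit (d n).
Proof.
move=> le ld ie e0 ed Q0 pQ.
have sp n : bsplit (d n).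
  have [m] := ubnP (N.+1 - n); elim: m n => // m IH n lt_m.
  have [ltNn|leNn] := ltnP N n.
    exists (fun=> 0) => [b x y _|x]; first by rewrite scaler0 addr0.
    by rewrite [x](Q0 n).
  have [|t bt tK] := IH n.+1; first by rewrite subSS; move: lt_m; rewrite subSn.
  have [||g bg gq] := pQ n.+1 _ _ (d n) (fun x => x - t (d n.+1 x)) (ld n).
  - by apply: blin_sub; [exact: blin_id | exact: blin_comp (lin_blin (ld _)) bt].
  - by move=> x; apply/ed; rewrite (linB (ld _)) tK subrr.
  exists g => // x; rewrite gq; have -> : d n.+1 (d n x) = 0 by apply/ed; exists x.
  by rewrite (blin0 bt) subr0.
split=> //; have [t bt tK] := sp 0%N.
have ex x : exists y, eta y = x - t (d 0%N x).
  have [|y yE] := (e0 (x - t (d 0%N x))).1; first by rewrite (linB (ld _)) tK subrr.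
  by exists y.
have [r rP] := choice ex; exists r.
  move=> b x y Bb; apply: ie; rewrite le !rP (ld 0%N) bt //.
  by rewrite scalerBr opprD addrACA.
move=> x; apply: ie; rewrite rP; have -> : d 0%N (eta x) = 0 by apply/e0; exists x.
by rewrite (blin0 bt) subr0.
Qed.

(** For projective [F] and surjective [phi] this says Ext^1(U, N) = 0. The map to be extended is
    total but constrained only on the kernel, so that the kernel need not be made a module. *)
Definition extends (F U : lmodType L) (phi : F -> U) (N : lmodType L) : Prop :=
  forall f : F -> N,
  (forall a x y, phi x = 0 -> phi y = 0 -> f (a *: x + y) = a *: f x + f y) ->
  exists2 g : F -> N, linear g & forall x, phi x = 0 -> g x = f x.

Section Extends.
Variables (F U : lmodType L) (phi : F -> U).
Hypotheses (lphi : linear phi) (pF : lproj F).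

Lemma extends_retract (M N : lmodType L) (i : M -> N) (p : N -> M) :
  linear i -> linear p -> cancel i p -> extends phi N -> extends phi M.
Proof.
move=> li lp ip eN f fP; have [|g lg gP] := eN (i \o f).
  by move=> a x y x0 y0; rewrite /= fP // li.
by exists (p \o g) => [|x x0]; [exact: Mod_comp | rewrite /= gP //= ip].
Qed.

(** Extend after projecting to [Z], and lift the result to [Y] since [F] is projective; on the
    kernel the error lies in [X], where it extends again. *)
Lemma extends_ext (X Y Z : lmodType L) (i : X -> Y) (p : Y -> Z) :
  linear i -> linear p -> injective i -> surj p ->
  (forall y, p y = 0 <-> exists x, y = i x) ->
  extends phi X -> extends phi Z -> extends phi Y.
Proof.
move=> li lp ii sp ip eX eZ f fP.
have [|g lg gP] := eZ (p \o f).
  by move=> a x y x0 y0; rewrite /= fP // lp.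
have [|h lh hP] := pF lp lg; first by move=> x; have [y yE] := sp (g x); exists y.
have ex x : exists u, phi x = 0 -> i u = f x - h x.
  have [x0|nx] := pselect (phi x = 0); last by exists 0.
  have [|u uE] := (ip (f x - h x)).1; first by rewrite (linB lp) hP gP //= subrr.
  by exists u.
have [r rP] := choice ex.
have [|g' lg' gP'] := eX r.
  move=> a x y x0 y0; apply: ii; rewrite li !rP // ?lphi ?x0 ?y0 ?scaler0 ?addr0 //.
  by rewrite fP // lh scalerBr opprD addrACA.
exists (fun x => i (g' x) + h x) => [a x y|x x0].
  by rewrite lg' lh li scalerDr addrACA.
by rewrite gP' // rP // subrK.
Qed.

Lemma extends_zero (N : lmodType L) : (forall x : N, x = 0) -> extends phi N.
Proof.
move=> N0 f _; exists (fun=> 0) => [a x y|x _]; first by rewrite scaler0 addr0.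
by rewrite [f x]N0.
Qed.

(** A lift of [f \o phi] to [Y] maps the kernel of [phi] into [X]; subtracting an extension of that
    restriction lets the lift descend to [U]. *)
Lemma extends_lift (X Y Z : lmodType L) (i : X -> Y) (p : Y -> Z) (f : U -> Z) :
  linear i -> linear p -> injective i -> surj p ->
  (forall y, p y = 0 <-> exists x, y = i x) ->
  surj phi -> extends phi X -> linear f -> exists2 g : U -> Y, linear g & forall x, p (g x) = f x.
Proof.
move=> li lp ii sp ip sphi eX lf.
have [|h lh hP] := pF lp (Mod_comp lphi lf).
  by move=> x; have [y yE] := sp (f (phi x)); exists y.
have ex x : exists u, phi x = 0 -> i u = h x.
  have [x0|nx] := pselect (phi x = 0); last by exists 0.
  have [|u uE] := (ip (h x)).1; first by rewrite hP /= x0 (lin0 lf).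
  by exists u.
have [r rP] := choice ex.
have [|g' lg' gP'] := eX r.
  move=> a x y x0 y0; apply: ii; rewrite li !rP //; first exact: lh.
  by rewrite lphi x0 y0 scaler0 addr0.
pose g0 x := h x - i (g' x).
have lg0 : linear g0.
  by move=> a x y; rewrite /g0 lh lg' li scalerBr opprD addrACA.
have g00 x : phi x = 0 -> g0 x = 0 by move=> x0; rewrite /g0 gP' // rP // subrr.
have [c cP] := choice sphi.
have gE x : g0 (c (phi x)) = g0 x.
  by apply/subr0_eq; rewrite -(linB lg0) g00 // (linB lphi) cP subrr.
exists (g0 \o c) => [a x y|x] /=.
  by rewrite -lg0 -[RHS]gE lphi !cP.
have ip0 u : p (i u) = 0 by apply/ip; exists u.
by rewrite /g0 (linB lp) hP /= cP ip0 subr0.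
Qed.

End Extends.

Lemma bproj_filtered (I : Type) (Fa : I -> lmodType L) (N : lmodType L) :
  (forall a, bproj (Fa a)) -> filtered (C := Mod L) Fa N -> bproj N.
Proof.
move=> eF; elim=> [X X0|a X Y Z i p _ eX [f [g [fK gK]]] [ii sp ip]].
  exact: bproj_zero.
apply: (bproj_ext (hom_mor i) (hom_mor p)) => //.
exact: bproj_retract (lin_blin (hom_mor f)) (lin_blin (hom_mor g)) fK (eF a).
Qed.

End Relative.

(** * Gradings *)

Section Grading.

Variables (k : fieldType) (L : falgType k) (G : grading L).

(** Zero beyond [gr_top], so that every natural number is a legitimate degree. *)
Definition gcomp (d : nat) (a : L) : L :=
  if insub d is Some o then
    sumv_pi_for (erefl (\sum_(i < (gr_top G).+1) G i)%VS) (o : 'I_(gr_top G).+1) a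
  else 0.

Lemma gcompE (d : 'I_(gr_top G).+1) a :
  gcomp d a = sumv_pi_for (erefl (\sum_(i < (gr_top G).+1) G i)%VS) d a.
Proof. by rewrite /gcomp valK. Qed.

Lemma gcomp_mem d a : gcomp d a \in G d.
Proof.
rewrite /gcomp; case: insubP => [o _ <-|_]; last exact: mem0v.
exact: memv_sum_pi.
Qed.

Lemma gcomp_linear d c a b : gcomp d (c *: a + b) = c *: gcomp d a + gcomp d b.
Proof.
rewrite /gcomp; case: insubP => [o _ _|_]; first by rewrite linearP.
by rewrite scaler0 addr0.
Qed.

Lemma gcompD d a b : gcomp d (a + b) = gcomp d a + gcomp d b.
Proof. by have := gcomp_linear d 1 a b; rewrite !scale1r. Qed.
Lemma gcomp0 d : gcomp d 0 = 0.
Proof. by apply: (@addrI _ (gcomp d 0)); rewrite -gcompD !addr0. Qed.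
Lemma gcompZ d c a : gcomp d (c *: a) = c *: gcomp d a.
Proof. by have := gcomp_linear d c a 0; rewrite gcomp0 !addr0. Qed.
Lemma gcomp_bigsum d (I : Type) (s : seq I) (P : pred I) (F : I -> L) :
  gcomp d (\sum_(i <- s | P i) F i) = \sum_(i <- s | P i) gcomp d (F i).
Proof. exact: (big_morph (gcomp d) (gcompD d) (gcomp0 d)). Qed.

Lemma gcomp_sum a : a = \sum_(d < (gr_top G).+1) gcomp d a.
Proof.
under eq_bigr do rewrite gcompE.
by rewrite sumv_pi_sum // gr_full memvf.
Qed.

Lemma gr_mem_top d a : (gr_top G < d)%N -> a \in G d -> a = 0.
Proof. by move=> lt_d; rewrite gr_bound // memv0 => /eqP. Qed.

Lemma gcomp_id d e a : a \in G e -> gcomp d a = if d == e then a else 0.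
Proof.
move=> Ga; have [le_e|lt_e] := leqP e (gr_top G); last first.
  by rewrite (gr_mem_top lt_e Ga) gcomp0; case: eqP.
have [le_d|lt_d] := leqP d (gr_top G); last first.
  rewrite (gr_mem_top lt_d (gcomp_mem d a)) ifN //.
  by apply: contraTneq lt_d => ->; rewrite -leqNgt.
pose u (i : 'I_(gr_top G).+1) := if i == e :> nat then a else 0.
have /(directv_sum_independent (gr_direct G)) dir : true by [].
have uG (i : 'I_(gr_top G).+1) : true -> u i - gcomp i a \in G i.
  move=> _; rewrite memvB ?gcomp_mem // /u; case: eqP => [->|_] //; exact: mem0v.
have sum0 : \sum_(i < (gr_top G).+1) (u i - gcomp i a) = 0.
  rewrite sumrB -gcomp_sum /u -big_mkcond /=.
  by rewrite (big_pred1 (Ordinal (le_e : (e < (gr_top G).+1)%N))) ?subrr // => i.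
have := directv_sum_independent (gr_direct G) _ uG sum0 (Ordinal (le_d : (d < (gr_top G).+1)%N)) isT.
by rewrite /u /= => /subr0_eq <-.
Qed.

Lemma gr_mem_eq d a : (a \in G d) = (gcomp d a == a).
Proof.
by apply/idP/eqP => [/gcomp_id->|<-]; rewrite ?eqxx ?gcomp_mem.
Qed.

Lemma grM d e a b : a \in G d -> b \in G e -> a * b \in G (d + e)%N.
Proof. by move=> Ga Gb; apply: (subvP (gr_mul G d e)); exact: memv_mul. Qed.

Lemma gcompMl d n a b : a \in G d ->
  gcomp n (a * b) = if (d <= n)%N then a * gcomp (n - d) b else 0.
Proof.
move=> Ga; rewrite {1}(gcomp_sum b) mulr_sumr gcomp_bigsum.
under eq_bigr => i _ do rewrite (gcomp_id _ (grM Ga (gcomp_mem i b))).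
have [le_d|lt_d] := leqP d n; last first.
  apply: big1 => i _; rewrite ifN // neq_ltn.
  by rewrite (leq_trans lt_d) ?leq_addr.
have [le_n|lt_n] := leqP (n - d) (gr_top G).
  rewrite (bigD1 (Ordinal (le_n : (n - d < (gr_top G).+1)%N))) //=.
  rewrite subnKC // eqxx big1 ?addr0 // => i ni; rewrite ifN //.
  apply: contra ni => /eqP e; apply/eqP/val_inj => /=; by rewrite e addKn.
rewrite (gr_mem_top lt_n (gcomp_mem _ b)) mulr0 big1 // => i _; rewrite ifN //.
apply: contraTneq lt_n => ->; by rewrite addKn -leqNgt -ltnS.
Qed.

Lemma gcompMr d n a b : b \in G d ->
  gcomp n (a * b) = if (d <= n)%N then gcomp (n - d) a * b else 0.
Proof.
move=> Gb; rewrite {1}(gcomp_sum a) mulr_suml gcomp_bigsum.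
under eq_bigr => i _ do rewrite (gcomp_id _ (grM (gcomp_mem i a) Gb)).
have [le_d|lt_d] := leqP d n; last first.
  apply: big1 => i _; rewrite ifN // neq_ltn.
  by rewrite (leq_trans lt_d) ?leq_addl.
have [le_n|lt_n] := leqP (n - d) (gr_top G).
  rewrite (bigD1 (Ordinal (le_n : (n - d < (gr_top G).+1)%N))) //=.
  rewrite subnK // eqxx big1 ?addr0 // => i ni; rewrite ifN //.
  apply: contra ni => /eqP e; apply/eqP/val_inj => /=; by rewrite e addnK.
rewrite (gr_mem_top lt_n (gcomp_mem _ a)) mul0r big1 // => i _; rewrite ifN //.
apply: contraTneq lt_n => ->; by rewrite addnK -leqNgt -ltnS.
Qed.

Lemma gcompM0 a b : gcomp 0 (a * b) = gcomp 0 a * gcomp 0 b.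
Proof.
rewrite {1}(gcomp_sum a) mulr_suml gcomp_bigsum big_ord_recl /=.
rewrite (gcompMl _ _ (gcomp_mem 0 a)) /= big1 ?addr0 // => i _.
by rewrite (gcompMl _ _ (gcomp_mem _ a)).
Qed.

Lemma gcomp1 : gcomp 0 1 = 1.
Proof. by rewrite (gcomp_id _ (gr_one G)). Qed.

Section GradedModule.
Variable M : gmod G.
Implicit Types (x y : M) (i j : int).

Lemma gpr0 i : gm_pr i (0 : M) = 0.
Proof. by apply: (@addrI _ (gm_pr i 0)); rewrite -gm_prD !addr0. Qed.
Lemma gprN i x : gm_pr i (- x) = - gm_pr i x.
Proof. by apply: (@addrI _ (gm_pr i x)); rewrite -gm_prD !subrr gpr0. Qed.
Lemma gprB i x y : gm_pr i (x - y) = gm_pr i x - gm_pr i y.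
Proof. by rewrite gm_prD gprN. Qed.
Lemma gpr_sum i (I : Type) (s : seq I) (P : pred I) (F : I -> M) :
  gm_pr i (\sum_(j <- s | P j) F j) = \sum_(j <- s | P j) gm_pr i (F j).
Proof. exact: (big_morph _ (@gm_prD _ _ _ _ i) (gpr0 i)). Qed.

Lemma gpr_idem i x : gm_pr i (gm_pr i x) = gm_pr i x.
Proof. by rewrite gm_pr_orth eqxx. Qed.

Lemma gpr_fsupp x : fsupp (fun i => gm_pr i x).
Proof.
have [s us xE] := gm_pr_sum x; exists s => i ni; rewrite xE gpr_sum.
rewrite big_seq big1 // => j js; rewrite gm_pr_orth ifN //.
by apply: contraNneq ni => ->.
Qed.

Lemma gpr_fsum x : x = fsum (fun i => gm_pr i x).
Proof.
have [s us xE] := gm_pr_sum x; rewrite {1}xE (fsumE us) // => i ni.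
rewrite xE gpr_sum big_seq big1 // => j js; rewrite gm_pr_orth ifN //.
by apply: contraNneq ni => ->.
Qed.

Lemma gm_ind (P : M -> Prop) : P 0 -> (forall x y, P x -> P y -> P (x + y)) ->
  (forall i x, gm_pr i x = x -> P x) -> forall x, P x.
Proof.
move=> P0 PD Ph x; have [s us ->] := gm_pr_sum x.
by apply: big_ind => // i _; apply: (Ph i); exact: gpr_idem.
Qed.

Lemma gprZ d a i x : a \in G d -> gm_pr (d%:Z + i) (a *: x) = a *: gm_pr i x.
Proof.
move=> Ga; have h j y : gm_pr (d%:Z + i) (a *: gm_pr j y) = if i == j then a *: gm_pr i y else 0.
  rewrite -(gm_pr_scale _ _ Ga) gm_pr_orth (inj_eq (addrI _)).
  by case: eqP => // ->; rewrite gm_pr_scale.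
have [s us xE] := gm_pr_sum x; rewrite {1}xE scaler_sumr gpr_sum.
under eq_bigr do rewrite h.
have [is_|ni] := boolP (i \in s).
  by rewrite (bigD1_seq i) //= eqxx big1 ?addr0 // => j /negPf; rewrite eq_sym => ->.
rewrite big_seq big1 => [|j js]; last by rewrite ifN //; apply: contraNneq ni => ->.
suff -> : gm_pr i x = 0 by rewrite scaler0.
rewrite xE gpr_sum big_seq big1 // => j js; rewrite gm_pr_orth ifN //.
by apply: contraNneq ni => ->.
Qed.

Lemma gprZ0 a i x : a \in G 0%N -> gm_pr i (a *: x) = a *: gm_pr i x.
Proof. by move=> Ga; rewrite -(gprZ _ _ Ga) add0r. Qed.

Lemma gprZk (c : k) i x : gm_pr i (c%:A *: x) = c%:A *: gm_pr i x.
Proof. by apply: gprZ0; rewrite memvZ ?gr_one. Qed.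

Lemma gpr_other i j x : gm_pr i x = x -> j != i -> gm_pr j x = 0.
Proof. by move=> <- nij; rewrite gm_pr_orth (negPf nij). Qed.

Lemma in_degreeZ d a i x : a \in G d -> gm_pr i x = x ->
  gm_pr (d%:Z + i) (a *: x) = a *: x.
Proof. by move=> Ga e; rewrite gprZ // e. Qed.

Lemma gm_eq (V : zmodType) (f g : M -> V) : {morph f : x y / x + y} ->
  {morph g : x y / x + y} -> (forall i x, gm_pr i x = x -> f x = g x) -> f =1 g.
Proof.
move=> fD gD e; apply: gm_ind => [|x y ex ey|i x xi]; last exact: (e i).
  by apply: (e 0); exact: gpr0.
by rewrite fD gD ex ey.
Qed.

Lemma gm_linear (N : lmodType L) (f : M -> N) : {morph f : x y / x + y} ->
  (forall d a i x, a \in G d -> gm_pr i x = x -> f (a *: x) = a *: f x) -> linear f.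
Proof.
move=> fD fZ a x y; rewrite fD; congr (_ + _).
rewrite (gcomp_sum a) !scaler_suml.
have f0 : f 0 = 0 by apply: (@addrI _ (f 0)); rewrite -fD !addr0.
rewrite (big_morph f fD f0); apply: eq_bigr => d _.
apply: (@gm_eq _ (fun z => f (_ *: z)) (fun z => _ *: f z)) => [u v|u v|i u ui].
- by rewrite scalerDr fD.
- by rewrite fD scalerDr.
exact: fZ (gcomp_mem _ _) ui.
Qed.

End GradedModule.

Lemma fin_gen_bounded (M : gmod G) : fin_gen M ->
  exists2 s : seq int, uniq s & forall (x : M) i, i \notin s -> gm_pr i x = 0.
Proof.
move=> /fin_gen_kfg[n [t st]].
have [u uP] := choice (fun i => gpr_fsupp (t i)).
exists (undup (flatten [seq u i | i <- enum 'I_n])) => [|x i ni]; first exact: undup_uniq.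
have [v ->] := st x; rewrite gpr_sum big1 // => j _; rewrite gprZk uP ?scaler0 //.
apply: contra ni; rewrite mem_undup => iu; apply/flattenP; exists (u j) => //.
by apply: map_f; rewrite mem_enum.
Qed.

Lemma graded_part (M N : gmod G) (g : M -> N) : linear g ->
  exists2 g0 : M -> N, graded_mor g0 & forall i x, g0 (gm_pr i x) = gm_pr i (g (gm_pr i x)).
Proof.
move=> lg; pose h x i := gm_pr i (g (gm_pr i x)).
have sh x : fsupp (h x).
  apply: (fsupp_map (f := fun i z => gm_pr i (g z))) (gpr_fsupp x) => i.
  by rewrite (lin0 lg) gpr0.
pose g0 x := fsum (h x).
have g0D : {morph g0 : x y / x + y}.
  move=> x y; rewrite /g0 -fsumD //; apply: fsum_eq => i.
  by rewrite /h gm_prD (linD lg) gm_prD.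
have g0i i x : gm_pr i x = x -> g0 x = gm_pr i (g x).
  move=> e; rewrite /g0 (@fsum1 _ _ _ i) /h ?e // => j nj.
  by rewrite (gpr_other e nj) (lin0 lg) gpr0.
exists g0 => [|i x]; last by rewrite (g0i i) ?gpr_idem.
split=> [|i x]; first apply: gm_linear => // d a i x Ga xi.
  by rewrite (g0i _ _ (in_degreeZ Ga xi)) (g0i _ _ xi) (linZ lg) gprZ.
apply: (@gm_eq _ _ (fun x => g0 (gm_pr i x)) (fun x => gm_pr i (g0 x))) => {x}[x y|x y|j x xj].
- by rewrite gm_prD g0D.
- by rewrite g0D gm_prD.
rewrite (g0i i) ?gpr_idem // (g0i _ _ xj) gm_pr_orth -xj gm_pr_orth.
by case: eqP => [->|]; rewrite ?gpr_idem // (lin0 lg) gpr0.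
Qed.

(** The degree 0 part of an ungraded solution of a lifting or extension problem with graded data is
    again a solution. Existence of maps can thus be proved without gradings and transferred. *)
Lemma graded_part_comp (M N : gmod G) (g : M -> N) : linear g ->
  exists g0 : M -> N, [/\ graded_mor g0,
    forall (X : gmod G) (f : X -> M) (u : X -> N), graded_mor f -> graded_mor u ->
      (forall x, g (f x) = u x) -> forall x, g0 (f x) = u x
  & forall (Z : gmod G) (d : N -> Z) (u : M -> Z), graded_mor d -> graded_mor u ->
      (forall x, d (g x) = u x) -> forall x, d (g0 x) = u x].
Proof.
move=> lg; have [g0 gg0 g0E] := graded_part lg; exists g0; split=> //.
  move=> X f u [lf df] [lu du] e.
  apply: gm_eq => [x y|x y|i x xi]; rewrite ?(linD lf) ?(linD gg0.1) ?(linD lu) //.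
  by rewrite -xi df g0E -df xi e -du xi.
move=> Z d u [ld dd] [lu du] e.
apply: gm_eq => [x y|x y|i x xi]; rewrite ?(linD gg0.1) ?(linD ld) ?(linD lu) //.
by rewrite -xi g0E dd e -du gpr_idem.
Qed.

Definition gpr_alg (i : int) (a : L) : L := if i is Posz d then gcomp d a else 0.

Lemma gpr_algD i a b : gpr_alg i (a + b) = gpr_alg i a + gpr_alg i b.
Proof. by case: i => d /=; rewrite ?gcompD ?addr0. Qed.

Lemma gpr_alg0 i : gpr_alg i 0 = 0.
Proof. by case: i => d //=; exact: gcomp0. Qed.

Lemma gpr_algZ (M : gmod G) i e a (y : M) : gm_pr e y = y ->
  gm_pr i (a *: y) = gpr_alg (i - e) a *: y.
Proof.
move=> ye; rewrite {1}(gcomp_sum a) scaler_suml gpr_sum.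
have h (d : nat) : gm_pr i (gcomp d a *: y) = if i - e == d%:Z then gcomp d a *: y else 0.
  have yd := in_degreeZ (gcomp_mem d a) ye.
  have -> : (i - e == d%:Z) = (i == d%:Z + e) by rewrite subr_eq.
  by have [->|ni] := eqVneq i (d%:Z + e); [rewrite yd | rewrite (gpr_other yd ni)].
under eq_bigr do rewrite h.
case: (i - e) => n /=; last by rewrite scale0r big1.
rewrite [in RHS](gcomp_sum a) gcomp_bigsum scaler_suml; apply: eq_bigr => d _.
rewrite (gcomp_id _ (gcomp_mem _ _)) eqz_nat.
by case: eqP => _; rewrite ?scale0r.
Qed.

Section FreeGraded.
Variables (K : choiceType) (deg : K -> int).

Definition free_pr (i : int) (f : freemod L K) : freemod L K :=
  Free (fsupp_map (f := fun x => gpr_alg (i - deg x)) (fun x => gpr_alg0 _) (free_fsupp f)).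

Fact free_prD i f g : free_pr i (f + g) = free_pr i f + free_pr i g.
Proof. by apply: free_eq => x /=; exact: gpr_algD. Qed.

Fact free_pr_orth i j f :
  free_pr i (free_pr j f) = if i == j then free_pr j f else 0.
Proof.
apply: free_eq => x; have [->|nij] := eqVneq i j => /=.
  by case: (j - deg x) => d //=; rewrite (gcomp_id _ (gcomp_mem _ _)) eqxx.
have: i - deg x != j - deg x by rewrite (inj_eq (addIr _)).
case: (i - deg x) (j - deg x) => d [] e //= nde; rewrite ?gcomp0 //.
by rewrite (gcomp_id _ (gcomp_mem _ _)) ifN.
Qed.

Fact free_pr_sum f : exists2 s : seq int, uniq s & f = \sum_(i <- s) free_pr i f.
Proof.
have [s sP] := free_fsupp f.
pose t := undup [seq d%:Z + deg x | x <- s, d <- iota 0 (gr_top G).+1].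
exists t; first exact: undup_uniq.
apply: free_eq => x; pose h i := gpr_alg (i - deg x) (f x).
have h0 i : (forall d, (d < (gr_top G).+1)%N -> i != d%:Z + deg x) -> h i = 0.
  rewrite /h => ni; case e: (i - deg x) => [d|d] //=.
  apply: (@gr_mem_top d) (gcomp_mem _ _); rewrite ltnNge; apply/negP => /ni/eqP; apply.
  by rewrite -e subrK.
have -> : (\sum_(i <- t) free_pr i f) x = \sum_(i <- t) h i.
  by rewrite (big_morph (fun g : freemod L K => g x) (id1 := 0) (op1 := +%R)).
rewrite -fsumE ?undup_uniq // => [|i ni]; last first.
  have [xs|/sP fx] := boolP (x \in s); last by rewrite /h fx gpr_alg0.
  apply: h0 => d ltd; apply: contraNneq ni => ->; rewrite mem_undup.
  by apply/allpairsP; exists (x, d); rewrite mem_iota.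
rewrite (@fsumE _ _ _ [seq d%:Z + deg x | d <- iota 0 (gr_top G).+1]).
- rewrite big_map {1}(gcomp_sum (f x)) -(big_mkord predT (fun d => gcomp d (f x))).
  by rewrite /index_iota subn0; apply: eq_bigr => d _; rewrite /h addrK.
- by rewrite map_inj_uniq ?iota_uniq // => d e /addIr[].
move=> i ni; apply: h0 => d ltd; apply: contraNneq ni => ->.
by apply/mapP; exists d; rewrite ?mem_iota.
Qed.

Fact free_pr_scale d a i f : a \in G d ->
  free_pr (d%:Z + i) (a *: free_pr i f) = a *: free_pr i f.
Proof.
move=> Ga; apply: free_eq => x /=; rewrite -addrA.
case: (i - deg x) => e /=; rewrite ?mulr0 ?gpr_alg0 //.
by rewrite (gcompMl _ _ Ga) leq_addr addKn (gcomp_id _ (gcomp_mem _ _)) eqxx.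
Qed.

Definition free_gmod : gmod G :=
  @Gmod k L G (freemod L K) free_pr free_prD free_pr_orth free_pr_sum free_pr_scale.

End FreeGraded.

(** A graded free module with a generator of degree i for each pair (x, i), sent to the degree i
    part of x, maps onto [P]; projectivity in [Gr] splits this map. *)
Lemma projective_lproj (P : Gr G) : projective P ->
  exists K (i : gm_mod P -> freemod L K) (p : freemod L K -> gm_mod P),
    [/\ linear i, linear p & cancel i p].
Proof.
move=> hP; pose K := (gm_mod P * int)%type.
pose v (x : K) (a : L) := a *: gm_pr x.2 x.1.
have v0 x : v x 0 = 0 by exact: scale0r.
pose F := free_gmod (K := K) snd.
have lp : linear (free_map v).
  by move=> a f g; apply: free_mapZD => // x b c; rewrite /v scalerDl scalerA.
have gp : @graded_mor _ _ _ F P (free_map v).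
  split=> // i f; rewrite /free_map.
  rewrite (fsum_map (gpr0 P i) (@gm_prD _ _ _ P i)); last exact: fsupp_map v0 (free_fsupp f).
  by apply: fsum_eq => x; rewrite /v /= (gpr_algZ _ _ (gpr_idem _ _)).
have sp : surj (free_map v).
  apply: (@gm_ind P) => [|x y [f <-] [g <-]|i x xi].
  - by exists 0; rewrite (lin0 lp).
  - by exists (f + g); rewrite (linD lp).
  by exists (free_gen L (x, i)); rewrite free_map_gen // /v /= xi scale1r.
have [s sK] := hP F P (@Hom _ (Gr G) F P (free_map v) gp) (@Hom _ (Gr G) P P id (mor_id P)) sp.
by exists K, s, (free_map v); split=> //; exact: (hom_mor s).1.
Qed.

End Grading.

(** * Idempotents and simple modules *)

Section Basics.

Variables (k : fieldType) (L : falgType k) (r : nat) (G : grading L).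
Variables (e : 'I_r -> L) (S : 'I_r -> gmod G).
Hypotheses (HG0 : degree0_iso_power G r) (He : forall i, e i \in G 0%N).
Hypothesis HS : ordered_simples e (fun i => gm_mod (S i)).
Hypothesis HSc : forall j, concentrated (S j) 0.

Lemma e_mul i j : e i * e j = if i == j then e i else 0.
Proof.
case: HS => _ [pe oe _] _; case: eqP => [<-|/eqP nij]; last exact: oe.
by case: (pe i).
Qed.

Lemma e_idem i : e i * e i = e i.
Proof. by rewrite e_mul eqxx. Qed.

Lemma e_neq0 i : e i != 0.
Proof. by case: HS => _ [pe _ _] _; case: (pe i). Qed.

Lemma e_sum : \sum_i e i = 1.
Proof. by case: HS => _ [_ _]. Qed.

(** Under the isomorphism the [e i] become [r] orthogonal non-zero idempotent functions on [r]
    points. Their supports are disjoint and non-empty, hence single points, so the [e i] are the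
    indicator functions up to order. *)
Lemma gr0_span a : a \in G 0%N -> exists c : 'I_r -> k, a = \sum_i c i *: e i.
Proof.
move=> Ga; have [f [[g fK gK] fZ]] := HG0.
have finj : injective f := can_inj fK.
pose E i : gr0 G := vsproj _ (e i).
have EK i : gr0_val (E i) = e i by rewrite /gr0_val vsprojK.
have vinj : injective (@gr0_val _ _ G) by exact: subvs_inj.
have EM i j : E i * E j = if i == j then E i else 0.
  by apply: vinj; rewrite rmorphM /= !EK e_mul; case: eqP; rewrite ?EK ?rmorph0.
pose phi i x := f (E i) x.
have phiM i j x : phi i x * phi j x = if i == j then phi i x else 0.
  have : (f (E i) * f (E j)) x = (if i == j then f (E i) else 0) x.
    by rewrite -rmorphM EM; case: eqP; rewrite ?rmorph0.
  by rewrite ffunE => ->; case: eqP => // _; rewrite ffunE.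
have ex i : exists x, phi i x = 1.
  have [x nx] : exists x, phi i x != 0.
    have : f (E i) != 0.
      rewrite -(rmorph0 f) (inj_eq finj); apply: contraNneq (e_neq0 i) => Ei.
      by rewrite -EK Ei rmorph0.
    apply: contraNP => n; apply/eqP/ffunP => x; rewrite ffunE.
    by apply/eqP/negPn/negP => nx; apply: n; exists x.
  exists x; apply: (mulfI nx); rewrite mulr1.
  by rewrite phiM eqxx.
have [t tP] := choice ex.
have tinj : injective t.
  move=> i j tij; apply/eqP/negPn/negP => nij.
  have := phiM i j (t i); rewrite (negPf nij) tP tij tP mulr1 => /eqP.
  by rewrite oner_eq0.
have [u uK tK] := injF_bij tinj.
pose F := f (vsproj _ a).
exists (fun i => F (t i)).
have aK : a = gr0_val (vsproj (gr0_aspace G) a) by rewrite /gr0_val vsprojK.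
rewrite aK; have -> : \sum_i F (t i) *: e i = gr0_val (\sum_i F (t i) *: E i).
  rewrite rmorph_sum; apply: eq_bigr => i _.
  exact: (congr1 (fun z => F (t i) *: z) (esym (EK i))).
congr gr0_val; apply: finj; apply/ffunP => x; rewrite rmorph_sum sum_ffunE.
have ph : f (E (u x)) x = 1 by have := tP (u x); rewrite tK.
rewrite (bigD1 (u x)) //= fZ ffunE tK ph mulr1.
rewrite big1 ?addr0 // => i ni; rewrite fZ ffunE.
have := phiM i (u x) x; rewrite (negPf ni) /phi ph mulr1 => ->.
by rewrite mulr0.
Qed.

Lemma chi_exists (i : 'I_r) (a : L) : exists c : k, e i * gcomp G 0 a = c *: e i.
Proof.
have [c ->] := gr0_span (gcomp_mem G 0 a); exists (c i).
rewrite mulr_sumr (bigD1 i) //= -scalerAr e_idem big1 ?addr0 // => j nij.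
by rewrite -scalerAr e_mul eq_sym (negPf nij) scaler0.
Qed.

(** The character by which the algebra acts on the simple module S_i. *)
Definition chi (i : 'I_r) (a : L) : k := sval (cid (chi_exists i a)).

Lemma chiE i a : e i * gcomp G 0 a = chi i a *: e i.
Proof. exact: svalP (cid (chi_exists i a)). Qed.

Lemma gcomp0_chi a : gcomp G 0 a = \sum_i chi i a *: e i.
Proof.
by rewrite -[LHS]mul1r -e_sum mulr_suml; apply: eq_bigr => i _; exact: chiE.
Qed.

Lemma e_scale_inj i (c d : k) : c *: e i = d *: e i -> c = d.
Proof.
move/eqP; rewrite -subr_eq0 -scalerBl scaler_eq0 (negPf (e_neq0 i)) orbF subr_eq0.
by move/eqP.
Qed.

Lemma chi_linear i c a b : chi i (c *: a + b) = c * chi i a + chi i b.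
Proof.
apply: (@e_scale_inj i); rewrite -chiE gcomp_linear mulrDr -scalerAr !chiE.
by rewrite scalerDl scalerA.
Qed.

Lemma chiD i a b : chi i (a + b) = chi i a + chi i b.
Proof. by have := chi_linear i 1 a b; rewrite scale1r mul1r. Qed.
Lemma chi0 i : chi i 0 = 0.
Proof. by apply: (@addrI _ (chi i 0)); rewrite -chiD !addr0. Qed.
Lemma chiZ i c a : chi i (c *: a) = c * chi i a.
Proof. by have := chi_linear i c a 0; rewrite chi0 !addr0. Qed.
Lemma chiB i a b : chi i (a - b) = chi i a - chi i b.
Proof. by rewrite chiD -[- b]scaleN1r chiZ mulN1r. Qed.
Lemma chi_mul i a b : chi i (a * b) = chi i a * chi i b.
Proof.
apply: (@e_scale_inj i); rewrite -chiE gcompM0 mulrA chiE -scalerAl chiE.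
by rewrite scalerA.
Qed.

Lemma chi_e i j : chi i (e j) = (i == j)%:R.
Proof.
apply: (@e_scale_inj i); rewrite -chiE (gcomp_id _ (He j)) /= e_mul.
by case: eqP => _; rewrite ?scale1r ?scale0r.
Qed.

Lemma chi1 i : chi i 1 = 1.
Proof. by apply: (@e_scale_inj i); rewrite -chiE gcomp1 mulr1 scale1r. Qed.

Lemma chi_pos i d a : (0 < d)%N -> a \in G d -> chi i a = 0.
Proof.
move=> d0 Ga; apply: (@e_scale_inj i); rewrite -chiE (gcomp_id _ Ga) ifN ?mulr0 ?scale0r //.
by case: d d0 {Ga}.
Qed.

Lemma chi_all0 a : (forall i, chi i a = 0) -> gcomp G 0 a = 0.
Proof. by move=> a0; rewrite gcomp0_chi big1 // => i _; rewrite a0 scale0r. Qed.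

(* Multiplication by [n] raises degrees. *)
Lemma rad_nilp n : gcomp G 0 n = 0 -> n ^+ (gr_top G).+1 = 0.
Proof.
move=> n0; have h m d : (d < m)%N -> gcomp G d (n ^+ m) = 0.
  elim: m d => // m IH d ltd; rewrite exprS {1}(gcomp_sum G n) mulr_suml gcomp_bigsum.
  apply: big1 => i _; rewrite (gcompMl _ _ (gcomp_mem G i n)).
  case: ifP => // le_i; have [i0|i0] := posnP i; first by rewrite i0 n0 mul0r.
  rewrite IH ?mulr0 // ltn_subLR //; apply: leq_trans ltd _.
  by rewrite -add1n leq_add2r.
by rewrite (gcomp_sum G (_ ^+ _)) big1 // => d _; exact: h.
Qed.

Lemma rad_nakayama (M : lmodType L) n (z : M) : gcomp G 0 n = 0 -> z = n *: z -> z = 0.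
Proof.
move=> n0 zE; have h m : z = n ^+ m *: z.
  by elim: m => [|m IH]; rewrite ?scale1r // exprSr -scalerA -zE.
by rewrite (h (gr_top G).+1) rad_nilp // scale0r.
Qed.

Lemma in_li i a : a * e i \in in_left_ideal (e i).
Proof. by apply/memv_imgP; exists a; rewrite ?memvf // lfunE. Qed.

Definition mkli i a : left_ideal (e i) := LeftIdeal (in_li i a).

Lemma mkli_val i (x : left_ideal (e i)) : mkli i (left_ideal_val x) = x.
Proof.
apply: val_inj => /=; have /memv_imgP[u _ ->] := left_idealP x.
by rewrite lfunE /= -mulrA e_idem.
Qed.

Lemma mkliZ i a b : mkli i (a * b) = a *: mkli i b.
Proof. by apply: val_inj; rewrite /= -mulrA. Qed.

(** Since S_i sits in degree 0, elements of positive degree annihilate it; the generator is the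
    image of [e i] under the projective cover. *)
Lemma simple_gen_exists i : exists s : S i, [/\ s != 0, forall x, exists a, x = a *: s
  & forall a, a *: s = (chi i a)%:A *: s].
Proof.
case: HS => [[simS _ _] _ pc]; have [_ [p [sp _]]] := pc i.
have lp := hom_mor p; set s : S i := p (mkli i 1).
have gen (x : S i) : exists a, x = a *: s.
  have [y <-] := sp x; exists (left_ideal_val y).
  by rewrite -[y in LHS]mkli_val -[left_ideal_val y in LHS]mulr1 mkliZ (linZ lp).
have es j : e j *: s = if j == i then s else 0.
  rewrite -(linZ lp) -mkliZ mulr1; case: eqP => [->|/eqP nij].
    by congr (p _); apply: val_inj; rewrite /= e_idem mul1r.
  rewrite -(lin0 lp); congr (p _); apply: val_inj.
  by rewrite /= e_mul (negPf nij).
have ps d a : (0 < d)%N -> a \in G d -> a *: s = 0.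
  move=> d0 Ga; have s0 : gm_pr 0 s = s := HSc s.
  have := in_degreeZ Ga s0; rewrite addr0 => e1.
  have e2 : gm_pr 0 (a *: s) = a *: s := HSc _.
  rewrite -e1 -[in LHS]e2 gm_pr_orth ifN //.
  by case: d d0 {Ga e1}.
exists s; split=> //.
  apply/eqP => s0; case: (simS i) => + _; apply=> x; have [a ->] := gen x.
  by rewrite s0 scaler0.
move=> a; rewrite {1}(gcomp_sum G a) big_ord_recl scalerDl scaler_suml.
rewrite [X in _ + X]big1 ?addr0 => [|d _]; last exact: ps (gcomp_mem _ _ _).
rewrite gcomp0_chi scaler_suml (bigD1 i) //= big1 ?addr0.
  by rewrite kscaleE es eqxx.
by move=> j nij; rewrite kscaleE es (negPf nij) scaler0.
Qed.

Definition sgen i : S i := sval (cid (simple_gen_exists i)).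

Lemma sgen_neq0 i : sgen i != 0.
Proof. by case: (svalP (cid (simple_gen_exists i))). Qed.
Lemma sgenZ i a : a *: sgen i = (chi i a)%:A *: sgen i.
Proof. by case: (svalP (cid (simple_gen_exists i))) => _ _; apply. Qed.
Lemma sgenP i x : exists a, x = a *: sgen i.
Proof. by case: (svalP (cid (simple_gen_exists i))) => _ + _; apply. Qed.

Lemma ksgen_inj i (c : k) : c%:A *: sgen i = 0 -> c = 0.
Proof.
exact: kscale_eq0 (sgen_neq0 i).
Qed.

Lemma simple_map i (M : lmodType L) (x : M) : (forall a, a *: x = (chi i a)%:A *: x) ->
  exists2 f : S i -> M, linear f & f (sgen i) = x.
Proof.
move=> xP; have [c cP] := choice (@sgenP i); exists (fun y => c y *: x).
  move=> a y z; rewrite scalerA -scalerDl xP [in RHS]xP; congr (_%:A *: _).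
  apply/subr0_eq/(@ksgen_inj i); rewrite scalerBl scalerBl -!sgenZ -cP.
  by rewrite scalerDl -scalerA -!cP subrr.
rewrite xP (_ : chi i _ = 1) ?scale1r ?scale1r //.
apply/subr0_eq/(@ksgen_inj i); rewrite scalerBl scalerBl -!sgenZ -cP.
by rewrite scale1r scale1r subrr.
Qed.

(** The idempotent [e m] detects the factor S_m: if z = e_m x is non-zero, then L z maps onto S_m by
    sending a z to chi_m(a) times the generator. *)
Lemma no_factor_aboveP i (M : lmodType L) :
  no_factor_above (fun i => gm_mod (S i)) i M <->
  forall (m : 'I_r), (i < m)%N -> forall x : M, e m *: x = 0.
Proof.
split=> [nf m im x|eM m im [Y [f [p [fi sp]]]]]; last first.
  have [y py] := sp (sgen m); have lf := hom_mor f; have lp := hom_mor p.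
  have : e m *: y = 0 by apply: fi; rewrite (lin0 lf) (linZ lf) eM.
  move/(congr1 p); rewrite (linZ lp) (lin0 lp) py sgenZ chi_e eqxx.
  by rewrite !scale1r => /eqP; rewrite (negPf (sgen_neq0 m)).
apply/eqP/negPn/negP => nz; apply: (nf m im).
set z := e m *: x in nz.
pose P (y : M) := exists a, y = a *: z.
have sP : is_sub P.
  split=> [|a _ _ [b ->] [c ->]]; first by exists 0; rewrite scale0r.
  by exists (a * b + c); rewrite scalerDl scalerA.
have ann a : a *: z = 0 -> chi m a = 0.
  move=> az; apply/eqP/negPn/negP => nc; case/eqP: nz.
  (* If a z = 0 with chi_m(a) non-zero, this [n] has no part in degree 0 and still fixes z, contrary
     to its nilpotency. *)
  pose n := e m - (chi m a)^-1 *: (e m * a * e m).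
  have em x' : e m *: (e m *: x') = e m *: x' :> M by rewrite scalerA e_idem.
  apply: (@rad_nakayama _ n).
    apply: chi_all0 => i'; rewrite chiB chiZ !chi_mul chi_e.
    by case: eqP => [->|_]; rewrite ?mul1r ?mulr1 ?mulVf ?subrr // !mul0r mulr0 subrr.
  by rewrite /n scalerBl kscaleE -!scalerA /z em -/z az !scaler0 subr0.
have [c cP] := choice (fun y : sub sP => sub_prop y).
have lg : linear (fun y => c y *: sgen m).
  move=> a y y'; rewrite scalerA -scalerDl; apply/subr0_eq.
  rewrite -scalerBl sgenZ ann ?scale0r ?scale0r //.
  by rewrite scalerBl scalerDl -scalerA -!cP subrr.
exists (sub sP : Mod L), (mkhom (@sub_val_lin _ _ _ sP)), (mkhom lg); split.
  exact: sub_val_inj.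
move=> y; have [a ->] := sgenP y.
have Pa : P (a *: z) by exists a.
exists (mksub sP Pa) => /=; apply/subr0_eq; rewrite -scalerBl sgenZ ann ?scale0r ?scale0r //.
by rewrite scalerBl -cP subrr.
Qed.

End Basics.

(** * A graded anti-automorphism from the duality *)

Lemma prodv_ind (k : fieldType) (L : falgType k) (U V : {vspace L}) (P : L -> Prop) :
  P 0 -> (forall x y, P x -> P y -> P (x + y)) ->
  (forall u v, u \in U -> v \in V -> P (u * v)) -> forall a, a \in (U * V)%VS -> P a.
Proof.
move=> P0 PD PM a; rewrite unlock => /coord_span ->.
apply: big_ind => // i _.
have lti : (i < size [seq (u * v)%R | u <- vbasis U, v <- vbasis V])%N.
  by rewrite size_allpairs !size_tuple.

have /allpairsP[[u v] /= [uU vV ->]] := mem_nth 0 lti.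
by rewrite scalerAl; apply: PM; rewrite ?memvZ ?vbasis_mem.
Qed.

Section GradedAnti.

Variables (k : fieldType) (L : falgType k) (r : nat) (G : grading L).
Variables (e : 'I_r -> L) (S : 'I_r -> gmod G).
Hypotheses (HG0 : degree0_iso_power G r) (He : forall i, e i \in G 0%N).
Hypothesis HG1 : generated_in_degree1 G.
Hypothesis HS : ordered_simples e (fun i => gm_mod (S i)).

Local Notation chi := (chi HG0 He HS).

(** L_0 + L_1 L contains 1 and is stable under left multiplication by L_0 + L_1, so it is
    everything; then components of degree d + 1 are compared. *)
Lemma gr_step d a : a \in G d.+1 -> a \in (G 1%N * G d)%VS.
Proof.
move=> Ga; pose Z := (G 0%N + G 1%N * fullv)%VS.
have: a \in Z.
  have /subvP : (agenv (G 0%N + G 1%N) <= Z)%VS; last by apply; rewrite HG1 memvf.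
  apply: agenv_sub_modl.
    apply/subvP => x /vlineP[c ->]; apply: memvZ.
    by rewrite -[1]addr0 memv_add ?gr_one ?mem0v.
  rewrite prodvDl subv_add; apply/andP; split; last first.
    by apply: subv_trans (addvSr _ _); apply: prodvSr; exact: subvf.
  rewrite prodvDr; apply: addvS; first exact: (gr_mul G 0 0).
  by rewrite prodvA; apply: prodvSl; exact: (gr_mul G 0 1).
case/memv_addP=> a0 Ga0 [b Gb def_a].
have := Ga; rewrite gr_mem_eq => /eqP <-; rewrite def_a gcompD (gcomp_id _ Ga0) /= add0r.
apply: (@prodv_ind _ _ _ _ (fun b => gcomp G d.+1 b \in (G 1%N * G d)%VS)) Gb.
- by rewrite gcomp0 mem0v.
- by move=> x y; rewrite gcompD; exact: memvD.
by move=> u v Gu _; rewrite (gcompMl _ _ Gu) /= subn1 memv_mul ?gcomp_mem.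
Qed.

(** Filtration by lowest degree. Unlike the grading, it is respected by every anti-endomorphism that
    preserves the characters. *)
Definition gr_above (d : nat) (a : L) : Prop :=
  forall n, (n < d)%N -> gcomp G n a = 0.

Lemma gr_aboveD d a b : gr_above d a -> gr_above d b -> gr_above d (a + b).
Proof. by move=> ha hb n ltn; rewrite gcompD ha // hb // addr0. Qed.

Lemma gr_above0 d : gr_above d 0.
Proof. by move=> n _; exact: gcomp0. Qed.

Lemma gr_above_mem d n a : (d <= n)%N -> a \in G n -> gr_above d a.
Proof.
move=> le_d Ga m ltm; rewrite (gcomp_id _ Ga) ifN // neq_ltn.
by rewrite (leq_trans ltm le_d).
Qed.

Lemma gr_aboveM d n a b : gr_above d a -> gr_above n b ->
  gr_above (d + n) (a * b) /\ gcomp G (d + n) (a * b) = gcomp G d a * gcomp G n b.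
Proof.
move=> ha hb; have h m : (m <= d + n)%N ->
    gcomp G m (a * b) = if m == (d + n)%N then gcomp G d a * gcomp G n b else 0.
  move=> le_m; rewrite {1}(gcomp_sum G a) mulr_suml gcomp_bigsum.
  have z (i : nat) : i != d -> gcomp G m (gcomp G i a * b) = 0.
    move=> nid; have [lti|ltd|ei] := ltngtP i d; last by rewrite ei eqxx in nid.
      by rewrite ha // mul0r gcomp0.
    rewrite (gcompMl _ _ (gcomp_mem G i a)); case: ifP => // le_i.
    by rewrite hb ?mulr0 // ltn_subLR // (leq_ltn_trans le_m) // ltn_add2r.
  have [le_d|lt_d] := leqP d (gr_top G); last first.
    rewrite big1 => [|i _]; last by apply: z; rewrite neq_ltn (leq_trans (ltn_ord i)).
    by rewrite (gr_mem_top lt_d (gcomp_mem G d a)) mul0r if_same.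
  rewrite (bigD1 (Ordinal (le_d : (d < (gr_top G).+1)%N))) //= big1 ?addr0 => [|i ni]; last first.
    by apply: z; apply: contra ni => /eqP ei; apply/eqP/val_inj.
  rewrite (gcompMl _ _ (gcomp_mem G d a)); case: eqP => [->|/eqP nm].
    by rewrite leq_addr addKn.
  by case: ifP => // le_d'; rewrite hb ?mulr0 // ltn_subLR // ltn_neqAle nm.
split=> [m ltm|]; last by rewrite (h _ (leqnn _)) eqxx.
by rewrite (h m (ltnW ltm)) (ltn_eqF ltm).
Qed.

(** Preservation of all characters puts the image of L_1 in degrees at least 1; as L is generated in
    degree 1, the other degrees follow by multiplication. *)
Lemma anti_above phi d a : anti phi -> (forall i b, chi i (phi b) = chi i b) ->
  gr_above d a -> gr_above d (phi a).
Proof.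
move=> aphi cphi; have hom n b : b \in G n -> gr_above n (phi b).
  elim: n b => [|n IH] b Gb; first by [].
  apply: (@prodv_ind _ _ _ _ (fun b => gr_above n.+1 (phi b))) (gr_step Gb).
  - by rewrite (anti0 aphi); exact: gr_above0.
  - by move=> x y; rewrite (antiD aphi); exact: gr_aboveD.
  move=> u v Gu Gv; rewrite (antiM aphi) -addn1; apply: (gr_aboveM (IH _ Gv) _).1.
  move=> m; rewrite ltnS leqn0 => /eqP ->; apply: (chi_all0 (HG0 := HG0) (He := He) (HS := HS)) => i.
  by rewrite cphi (chi_pos HG0 He HS i _ Gu).
move=> ha n ltn; rewrite (gcomp_sum G a) (anti_sum aphi) gcomp_bigsum big1 // => i _.
have [lti|le_i] := ltnP i d; first by rewrite ha // (anti0 aphi) gcomp0.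
by apply: hom (gcomp_mem G i a) _ (leq_trans ltn le_i).
Qed.

(** The associated graded map of [phi] for the filtration [gr_above]. *)
Definition gr_part (phi : L -> L) (a : L) : L :=
  \sum_(d < (gr_top G).+1) gcomp G d (phi (gcomp G d a)).

Lemma gr_part_hom phi d a : anti phi -> a \in G d -> gr_part phi a = gcomp G d (phi a).
Proof.
move=> aphi Ga; have [le_d|lt_d] := leqP d (gr_top G); last first.
  have a0 := gr_mem_top lt_d Ga; rewrite a0 (anti0 aphi) gcomp0 /gr_part big1 // => i _.
  by rewrite gcomp0 (anti0 aphi) gcomp0.
rewrite /gr_part (bigD1 (Ordinal (le_d : (d < (gr_top G).+1)%N))) //= (gcomp_id _ Ga) eqxx.
rewrite big1 ?addr0 // => i ni; have nid : (i : nat) != d.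
  by apply: contra ni => /eqP ei; apply/eqP/val_inj.
by rewrite (gcomp_id _ Ga) (negPf nid) (anti0 aphi) gcomp0.
Qed.

Lemma gr_part_linear phi c a b : anti phi ->
  gr_part phi (c *: a + b) = c *: gr_part phi a + gr_part phi b.
Proof.
move=> [lphi _ _]; rewrite /gr_part scaler_sumr -big_split; apply: eq_bigr => d _ /=.
by rewrite gcomp_linear lphi gcomp_linear.
Qed.

Lemma gr_part_sum phi (I : Type) (s : seq I) (F : I -> L) : anti phi ->
  gr_part phi (\sum_(i <- s) F i) = \sum_(i <- s) gr_part phi (F i).
Proof.
move=> aphi.
have gD : {morph gr_part phi : x y / x + y}.
  by move=> x y; have := gr_part_linear 1 x y aphi; rewrite !scale1r.
have g0 : gr_part phi 0 = 0 by apply: (@addrI _ (gr_part phi 0)); rewrite -gD !addr0.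
exact: (big_morph _ gD g0).
Qed.

Lemma gr_part_anti phi : anti phi -> (forall i b, chi i (phi b) = chi i b) ->
  anti (gr_part phi).
Proof.
move=> aphi cphi; split=> [c a b||a b]; first exact: gr_part_linear.
  by rewrite (gr_part_hom aphi (gr_one G)) (anti1 aphi) gcomp1.
rewrite (gcomp_sum G a) (gcomp_sum G b) mulr_suml !(gr_part_sum _ _ aphi).
rewrite mulr_sumr; apply: eq_bigr => i _.
rewrite mulr_sumr (gr_part_sum _ _ aphi) mulr_suml; apply: eq_bigr => j _.
have Gi := gcomp_mem G i a; have Gj := gcomp_mem G j b.
rewrite (gr_part_hom aphi (grM Gi Gj)) (gr_part_hom aphi Gi) (gr_part_hom aphi Gj).
rewrite (antiM aphi) addnC; apply: (gr_aboveM _ _).2.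
  by apply: anti_above => //; exact: gr_above_mem Gj.
by apply: anti_above => //; exact: gr_above_mem Gi.
Qed.

Lemma gr_part_mem phi d a : anti phi -> a \in G d -> gr_part phi a \in G d.
Proof. by move=> aphi Ga; rewrite (gr_part_hom aphi Ga) gcomp_mem. Qed.

Lemma gr_part_cancel phi psi : anti phi -> anti psi ->
  (forall i b, chi i (phi b) = chi i b) -> (forall i b, chi i (psi b) = chi i b) ->
  cancel phi psi -> cancel (gr_part phi) (gr_part psi).
Proof.
move=> aphi apsi cphi cpsi phiK a.
rewrite {1}(gcomp_sum G a) [RHS](gcomp_sum G a) (gr_part_sum _ _ aphi) (gr_part_sum _ _ apsi).
apply: eq_bigr => d _; have Gd := gcomp_mem G d a.
rewrite (gr_part_hom apsi (gr_part_mem aphi Gd)) (gr_part_hom aphi Gd).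
set x := gcomp G d a in Gd *.
(* [phi x] differs from its leading part by terms of higher degree, and [psi] keeps these in higher
   degree. *)
have xE : gcomp G d (phi x) = phi x - (phi x - gcomp G d (phi x)) by rewrite opprB addrC subrK.
rewrite {1}xE (antiB apsi) phiK gcompD -[- psi _]scaleN1r gcompZ.
have above : gr_above d.+1 (phi x - gcomp G d (phi x)).
  move=> n; rewrite ltnS => le_n; rewrite gcompD -scaleN1r gcompZ.
  rewrite (gcomp_id _ (gcomp_mem G d _)); case: eqP => [->|/eqP nn].
    by rewrite scaleN1r subrr.
  rewrite scaler0 addr0; apply: (anti_above aphi cphi (gr_above_mem (leqnn d) Gd)).
  by rewrite ltn_neqAle nn.
by rewrite (anti_above apsi cpsi above) // scaler0 addr0 (gcomp_id _ Gd) eqxx.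
Qed.

Lemma gr_part_e phi i : anti phi -> (forall i b, chi i (phi b) = chi i b) ->
  gr_part phi (e i) = e i.
Proof.
move=> aphi cphi; rewrite (gr_part_hom aphi (He i)) (gcomp0_chi HG0 He HS).
rewrite (bigD1 i) //= big1 ?addr0 => [|j nij]; rewrite cphi chi_e //.
  by rewrite eqxx scale1r.
by rewrite (negPf nij) scale0r.
Qed.

End GradedAnti.

(** * The module whose dual is regular, and its endomorphisms *)

Section FromDuality.

Variables (k : fieldType) (L : falgType k) (r : nat) (G : grading L).
Variables (e : 'I_r -> L) (S : 'I_r -> gmod G).
Hypotheses (HG0 : degree0_iso_power G r) (He : forall i, e i \in G 0%N).
Hypothesis HS : ordered_simples e (fun i => gm_mod (S i)).
Hypothesis HSc : forall j, concentrated (S j) 0.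
Variable D : duality (fin_cat (Mod L)).
Local Notation C := (fin_cat (Mod L)).
Local Notation chi := (chi HG0 He HS).
Local Notation sgen := (sgen HG0 He HS HSc).

Definition fhom (X Y : C) (f : sval X -> sval Y) (lf : linear f) : hom X Y :=
  @Hom L C X Y f lf.

Lemma dual_hom_ext (X Y : C) (f g : hom X Y) : f =1 g -> dual_hom D f =1 dual_hom D g.
Proof.
move=> fg y; pose i : hom X X := @Hom L C X X id (mor_id X).
have := @dual_hom_comp _ _ _ D _ _ _ i g f fg y; rewrite /= => ->.
exact: (@dual_hom_id _ _ _ D X i (fun=> erefl)).
Qed.

Lemma fin_gen_regular : fin_gen (L^o : lmodType L).
Proof.
exists 1%N, (fun=> 1) => x; exists (fun=> x).
by rewrite big_ord1 /GRing.scale /= mulr1.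
Qed.

Definition Robj : C := exist (fun X : Mod L => fin_gen (carrier X)) (L^o : lmodType L) fin_gen_regular.

Variables (W : C) (f : hom (D W) Robj) (g : hom Robj (D W)).
Hypotheses (fK : cancel f g) (gK : cancel g f).

Let u0 : carrier (D W) := g (1 : L).

Lemma u0_gen y : y = (f y : L) *: u0.
Proof.
by rewrite -(linZ (hom_mor g)) -[LHS]fK; congr (g _); rewrite /GRing.scale /= mulr1.
Qed.

Lemma u0_free a : a *: u0 = 0 -> a = 0.
Proof.
move/(congr1 f); rewrite (linZ (hom_mor f)) (lin0 (hom_mor f)) gK.
by rewrite /GRing.scale /= mulr1.
Qed.

(** Maps X -> W correspond to maps D W -> D X, and hence, D W being free on [u0], to elements of D
    X. *)
Lemma yoneda_ex (X : C) (x : carrier (D X)) : exists q : hom X W, dual_hom D q u0 = x.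
Proof.
have lh : linear (fun y : carrier (D W) => (f y : L) *: x).
  by move=> a y z; rewrite (hom_mor f) scalerDl scalerA.
have [q qE] := dual_hom_full (fhom lh : hom (D W) (D X)).
by exists q; rewrite qE /= gK scale1r.
Qed.

Lemma yoneda_inj (X : C) (p q : hom X W) : dual_hom D p u0 = dual_hom D q u0 -> p =1 q.
Proof.
move=> e0; apply: (dual_hom_faithful (d := D)) => y.
by rewrite (u0_gen y) !(linZ (hom_mor (dual_hom D _))) e0.
Qed.

(** [gam c] is the endomorphism of W dual to right multiplication by c. Two reversals of order
    cancel, so [gam] is multiplicative and gives W a second action of L, commuting with the
    first. *)
Let gam_ex (c : L) := yoneda_ex (c *: u0).
Let gam (c : L) : hom W W := sval (cid (gam_ex c)).

Let gamE c : dual_hom D (gam c) u0 = c *: u0.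
Proof. exact: svalP (cid (gam_ex c)). Qed.

Let lgam c : linear (gam c) := hom_mor (gam c).

Let gamM c d w : gam c (gam d w) = gam (c * d) w.
Proof.
pose h : hom W W := @fhom W W _ (Mod_comp (lgam d) (lgam c)).
apply: (@yoneda_inj W h) => {w}.
rewrite (@dual_hom_comp _ _ _ D _ _ _ (gam d) (gam c) h) //= gamE.
by rewrite (linZ (hom_mor (dual_hom D _))) gamE scalerA -gamE.
Qed.

Let klinear_hom (X Y : C) (a : k) (p q : hom X Y) :
  linear (fun x => a%:A *: p x + q x).
Proof.
move=> b x y; rewrite (hom_mor p) (hom_mor q) !scalerDr !scalerA addrACA.
by congr (_ *: _ + _ + _); rewrite -scalerAl mul1r -scalerAr mulr1.
Qed.

Let gam_linear a c d w : gam (a *: c + d) w = a%:A *: gam c w + gam d w.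
Proof.
pose h : hom W W := @fhom W W _ (klinear_hom a (gam c) (gam d)).
apply: (@yoneda_inj W _ h) => {w}; rewrite gamE.
by rewrite (@dual_hom_linear _ _ _ D _ _ a (gam c) (gam d) h) // !gamE scalerDl kscaleE.
Qed.

Let gam0 w : gam 0 w = 0.
Proof. by have := gam_linear (-1) 0 0 w; rewrite scaler0 addr0 scaleN1r scaleN1r addNr. Qed.

Let gam1 w : gam 1 w = w.
Proof.
pose h : hom W W := @Hom L C W W id (mor_id W).
apply: (@yoneda_inj W _ h) => {w}; rewrite gamE scale1r.
by rewrite (@dual_hom_id _ _ _ D W h).
Qed.

Let gam_eq0 c : (forall w, gam c w = 0) -> c = 0.
Proof.
move=> c0; apply: u0_free; rewrite -gamE.
rewrite (@dual_hom_ext _ _ (gam c) (gam 0)); first by rewrite gamE scale0r.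
by move=> w; rewrite c0 gam0.
Qed.

Variable (fS : forall i, fin_gen (S i : lmodType L)).
Let Sobj i : C := exist (fun X : Mod L => fin_gen (carrier X)) (S i : lmodType L) (fS i).
Hypothesis SD : forall i, isomorphic (sval (D (Sobj i))) (gm_mod (S i) : Mod L).

(** Hom(S_i, W) is identified with D S_i, hence with S_i, which is a line: so S_i occurs exactly
    once in the socle of W, and both actions of L on it are given by chi_i. *)
Let socle_ex i : exists w : sval W, [/\ w != 0,
  forall a, a *: w = (chi i a)%:A *: w, forall c, gam c w = (chi i c)%:A *: w &
  forall v : sval W, (forall a, a *: v = (chi i a)%:A *: v) -> exists c : k, v = c%:A *: w].
Proof.
have [a [b [aK bK]]] := SD i; have la := hom_mor a; have lb := hom_mor b.
pose s' : carrier (D (Sobj i)) := b (sgen i).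
have s'Z c : c *: s' = (chi i c)%:A *: s' by rewrite -(linZ lb) sgenZ (linZ lb).
have s'P y : exists c : k, y = c%:A *: s'.
  have [c cE] := sgenP HG0 He HS HSc (a y).
  by exists (chi i c); rewrite -s'Z -(linZ lb) -cE aK.
have [io ioE] := yoneda_ex s'; have lio := hom_mor io.
exists (io (sgen i)); split.
- apply/eqP => w0; have : s' = 0.
    pose h : hom (Sobj i) W := @fhom (Sobj i) W _ (klinear_hom (-1) io io).
    have eh : io =1 h.
      move=> x; have [c ->] := sgenP HG0 He HS HSc x.
      by rewrite (linZ lio) w0 scaler0 (linZ (hom_mor h)) /= w0 scaler0 addr0 scaler0.
    rewrite -ioE (dual_hom_ext eh) (@dual_hom_linear _ _ _ D _ _ (-1) io io h) //.
    by rewrite scaleN1r scaleN1r addNr.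
  by move/(congr1 a); rewrite bK (lin0 la) => /eqP; rewrite (negPf (sgen_neq0 _ _ _ _ _)).
- by move=> c; rewrite -(linZ lio) sgenZ (linZ lio).
- move=> c; pose h1 : hom (Sobj i) W := @fhom (Sobj i) W _ (Mod_comp lio (lgam c)).
  pose h2 : hom (Sobj i) W := @fhom (Sobj i) W _ (klinear_hom (chi i c - 1) io io).
  have eh : h1 =1 h2.
    apply: yoneda_inj.
    rewrite (@dual_hom_comp _ _ _ D _ _ _ io (gam c) h1) //= gamE.
    rewrite (linZ (hom_mor (dual_hom D _))) ioE s'Z.
    rewrite (@dual_hom_linear _ _ _ D _ _ (chi i c - 1) io io h2) // ioE.
    by rewrite scalerBl scalerBl !scale1r subrK.
  by have := eh (sgen i); rewrite /= => ->; rewrite scalerBl scalerBl !scale1r subrK.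
move=> v vE; have [q lq qE] := simple_map HSc vE.
have [c cE] := s'P (dual_hom D (@fhom (Sobj i) W q lq) u0).
exists c; pose h2 : hom (Sobj i) W := @fhom (Sobj i) W _ (klinear_hom (c - 1) io io).
have eh : @fhom (Sobj i) W q lq =1 h2.
  apply: yoneda_inj; rewrite cE (@dual_hom_linear _ _ _ D _ _ (c - 1) io io h2) // ioE.
  by rewrite scalerBl scalerBl !scale1r subrK.
have := eh (sgen i); rewrite /= qE => ->.
by rewrite scalerBl scalerBl !scale1r subrK.
Qed.

(* A functional on W that is non-zero on every simple submodule separates the
   points of W, both through the action of L and through End(W) = L; counting
   dimensions, [eps (a w) = eps (c . w)] defines a bijection a |-> c. *)
Lemma duality_anti0 : exists2 t : L -> L, anti t /\ bijective t &
  forall i a, chi i (t a) = chi i a.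
Proof.
have [w wP] := choice socle_ex.
have bex i : exists b : sval W -> k, kfun b /\ b (w i) = 1.
  have [nw _ _ _] := wP i; by have [b kb b1] := kfun_exists nw; exists b.
have [b bP] := choice bex.
pose eps (v : sval W) := \sum_i b i (e i *: v).
have keps : kfun eps.
  move=> c x y; rewrite /eps mulr_sumr -big_split; apply: eq_bigr => i _ /=.
  rewrite -(bP i).1; congr (b i _); rewrite scalerDr !scalerA; congr (_ *: _ + _).
  by rewrite -scalerAr mulr1 mulr_algl.
have epsw i : eps (w i) = 1.
  rewrite /eps (bigD1 i) //= big1 ?addr0 => [|j nij]; have [_ wZ _ _] := wP i.
    by rewrite wZ chi_e eqxx !scale1r (bP i).2.
  by rewrite wZ chi_e eq_sym (negPf nij) !scale0r (kfun0 (bP j).1).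
(* For the largest d such that L_d v is non-zero, a vector e_i a v with a in L_d is killed by all
   positive degrees, hence is a multiple of [w i]. *)
have soc (v : sval W) : v != 0 -> exists a i (c : k), c != 0 /\ a *: v = c%:A *: w i.
  move=> nv; have ex : exists d, `[<exists2 a, a \in G d & a *: v != 0>].
    exists 0%N; apply/asboolP; exists 1; rewrite ?gr_one ?scale1r //.
  have bd d : `[<exists2 a, a \in G d & a *: v != 0>] -> (d <= gr_top G)%N.
    move=> /asboolP[a Ga]; rewrite leqNgt; apply: contra => /gr_mem_top/(_ Ga) ->.
    by rewrite scale0r.
  case: (ex_maxnP ex bd) => d /asboolP[a Ga na] maxd.
  have [i ni] : exists i, e i *: (a *: v) != 0.
    apply: contraPP na => nex; apply/negP/negPn/eqP.
    rewrite -[a *: v]scale1r -(e_sum HS) scaler_suml big1 // => i _.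
    by apply/eqP/negPn/negP => ni; apply: nex; exists i.
  have xZ c : c *: (e i *: (a *: v)) = (chi i c)%:A *: (e i *: (a *: v)).
    rewrite {1}(gcomp_sum G c) big_ord_recl scalerDl scaler_suml [X in _ + X]big1 ?addr0.
      rewrite (gcomp0_chi HG0 He HS) scaler_suml (bigD1 i) //= big1 ?addr0.
        by rewrite kscaleE !scalerA mulrA (e_idem HS) -!scalerA.
      by move=> j nij; rewrite kscaleE scalerA (e_mul HS) (negPf nij) scale0r scaler0.
    move=> m _; rewrite !scalerA; apply/eqP/negPn/negP => n0.
    have : (d.+1 + m <= d)%N.
      apply: maxd; apply/asboolP; exists (gcomp G (lift ord0 m) c * e i * a) => //.
      rewrite addSnnS addnC; apply: grM Ga.
      by rewrite -[X in G X]addn0; apply: grM (He i); exact: gcomp_mem.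
    by rewrite addSn ltnNge leq_addr.
  have [_ _ _ /(_ _ xZ)[c cE]] := wP i.
  exists (e i * a), i, c; rewrite -scalerA; split=> //.
  by apply: contraNneq ni => c0; rewrite cE c0 !scale0r.
have eps_sep v : (forall a, eps (a *: v) = 0) -> v = 0.
  move=> v0; apply/eqP/negPn/negP => /soc[a [i [c [nc aE]]]].
  have := v0 a; rewrite aE (kfunZ keps) epsw mulr1 => c0.
  by rewrite c0 eqxx in nc.
have eps_gam c : (forall v, eps (gam c v) = 0) -> c = 0.
  move=> c0; apply: gam_eq0 => v; apply: eps_sep => a.
  by rewrite -(linZ (lgam c)) c0.
have [n0 /kfg_coord[n [cW [dW [_ cWP]]]]] := fin_gen_kfg (svalP W).
have [m0 /kfg_coord[m [cL [dL [_ cLP]]]]] := fin_gen_kfg fin_gen_regular.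
have [cdW dcW kcW] := cWP; have [cdL dcL kcL] := cLP.
have dLV a u v : dL (a *: u + v) = a *: (dL u : L) + dL v :> L.
  by rewrite (kcoordV cLP) /GRing.scale /= mulr_algl.
have basisW (b1 b2 : sval W -> k) : kfun b1 -> kfun b2 ->
    (forall j, b1 (dW (delta_mx 0 j)) = b2 (dW (delta_mx 0 j))) -> forall v, b1 v = b2 v.
  move=> k1 k2 b12 v; have [u ->] : exists u, v = \sum_j (u j)%:A *: dW (delta_mx 0 j).
    exists (fun j => cW v 0 j); have dD : {morph dW : x y / x + y}.
      by move=> x y; have := kcoordV cWP 1 x y; rewrite !scale1r.
    rewrite -{1}[v]cdW {1}[cW v]row_sum_delta (big_morph dW dD (kcoordV0 cWP)).
    by apply: eq_bigr => j _; rewrite -[_ *: _ in LHS]addr0 (kcoordV cWP) (kcoordV0 cWP) addr0.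
  rewrite (kfun_sum k1) (kfun_sum k2); apply: eq_bigr => j _.
  by rewrite (kfunZ k1) (kfunZ k2) b12.
have keps1 c : kfun (fun v => eps (gam c v)).
  by move=> x y z; rewrite (lin_klin (lgam c)) keps.
have keps2 c : kfun (fun v => eps (c *: v)).
  move=> x y z; rewrite -keps scalerDr !scalerA; congr (eps (_ *: _ + _)).
  by rewrite -scalerAr mulr1 mulr_algl.
have [E1 E1P] : exists E1 : 'M[k]_(n, m), forall u,
    \row_j eps ((dL (delta_mx 0 j) : L) *: dW u) = u *m E1.
  apply: linear_row_mx => c x y; apply/rowP => j; rewrite !mxE (kcoordV cWP).
  exact: keps2.
have [E2 E2P] : exists E2 : 'M[k]_(m, n), forall u,
    \row_j eps (gam (dL u : L) (dW (delta_mx 0 j))) = u *m E2.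
  by apply: linear_row_mx => c x y; apply/rowP => j; rewrite !mxE dLV gam_linear keps.
have free2 : row_free E2.
  apply: inj_row_free => u; rewrite -E2P => /rowP uz.
  rewrite -[u]dcL [dL u](_ : _ = 0) ?(kcoord0 cLP) //; apply: eps_gam.
  apply: (basisW (fun v => eps (gam _ v)) (fun=> 0) (keps1 _) (@dual0P _ _ _)) => j.
  by have := uz j; rewrite !mxE.
have kL (h : L -> k) (x : L) : (forall c y z, h (c *: y + z) = c * h y + h z) ->
    (forall j, h (dL (delta_mx 0 j)) = 0) -> h x = 0.
  move=> hl h0; have hD : {morph h : y z / y + z}.
    by move=> y z; have := hl 1 y z; rewrite scale1r mul1r.
  have hz : h 0 = 0 by apply: (@addrI _ (h 0)); rewrite -hD !addr0.
  have d0 : dL 0 = 0 := kcoordV0 cLP.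
  rewrite -[x]cdL [cL x]row_sum_delta.
  have dD : {morph dL : y z / y + z >-> (y : L) + (z : L)}.
    by move=> y z; have := dLV 1 y z; rewrite !scale1r.
  rewrite (big_morph dL dD d0) (big_morph h hD hz) big1 // => j _.
  by rewrite -[_ *: _]addr0 dLV d0 hl h0 hz mulr0 addr0.
have epsl v c y z : eps ((c *: y + z : L) *: v) = c * eps (y *: v) + eps (z *: v).
  by rewrite scalerDl kscaleE keps.
have free1 : row_free E1.
  apply: inj_row_free => u; rewrite -E1P => /rowP uz.
  rewrite -[u]dcW [dW u](_ : _ = 0) ?(kcoord0 cWP) //; apply: eps_sep => a.
  apply: (kL (fun a => eps (a *: dW u))) => [c y z|j]; first exact: epsl.
  by have := uz j; rewrite !mxE.
(* One form embeds W in the dual of L, the other embeds L in the dual of W; the dimensions agree and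
   both embeddings are bijective. *)
have enm : n = m.
  have := rank_leq_col E1; have := rank_leq_col E2; rewrite (eqP free1) (eqP free2).
  by move=> le1 le2; apply/eqP; rewrite eqn_leq le1 le2.
have /row_fullP[F1 F1E] : row_full E1 by rewrite /row_full (eqP free1) enm.
have /row_fullP[F2 F2E] : row_full E2 by rewrite /row_full (eqP free2) enm.
have surj2 (be : sval W -> k) : kfun be -> exists c, forall v, be v = eps (gam c v).
  move=> kbe; exists (dL ((\row_j be (dW (delta_mx 0 j))) *m F2) : L) => v.
  apply: (basisW be (fun v => eps (gam _ v)) kbe (keps1 _)) => j.
  have := E2P ((\row_j be (dW (delta_mx 0 j))) *m F2).
  by rewrite -mulmxA F2E mulmx1 => /rowP/(_ j); rewrite !mxE => ->.
have sep1 x : (forall v, eps (x *: v) = 0) -> x = 0.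
  move=> x0; have: cL x = 0; last by move/(congr1 dL); rewrite cdL (kcoordV0 cLP).
  apply/rowP => j.
  pose h y := eps (y *: dW (row j F1)) - cL y 0 j.
  have /eqP : h x = 0; last by rewrite /h x0 add0r oppr_eq0 mxE => /eqP.
  apply: kL => [c y z|l].
    rewrite /h epsl; have := kcL c y z; rewrite {1}/GRing.scale /= mulr_algl => ->.
    by rewrite !mxE mulrBr opprD addrACA.
  have := E1P (row j F1); rewrite -row_mul F1E => /rowP/(_ l); rewrite !mxE /h => ->.
  by rewrite dcL !mxE eqxx /= subrr.
have [t tE] := choice (fun a => surj2 _ (keps2 a)).
have uniq x y : (forall v, eps (gam x v) = eps (gam y v)) -> x = y.
  move=> xy; apply/subr0_eq/eps_gam => v; rewrite addrC -scaleN1r gam_linear keps xy.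
  by rewrite mulN1r addNr.
(* The two actions commute, so eps (a a' v) = eps (gam (t a) (a' v)) = eps (a' (gam (t a) v)) = eps
   (gam (t a') (gam (t a) v)), which reverses products. *)
have tP : anti t.
  split=> [c a a'||a a']; apply: uniq => v; rewrite ?gam1 -?gamM ?gam_linear ?keps -!tE.
  - exact: epsl.
  - by rewrite scale1r.
  by rewrite -scalerA tE (linZ (lgam _)).
have tinj : injective t.
  move=> x y xy; apply/subr0_eq/sep1 => v; rewrite scalerBl (kfunB keps) !tE xy.
  by rewrite subrr.
exists t; last first.
  move=> i a; have [_ wZ wg _] := wP i.
  by have := tE a (w i); rewrite wZ wg !(kfunZ keps) epsw !mulr1.
split=> //; have ts : surj t.
  apply: (@klin_inj_surj k L (L^o : lmodType L) t) => //; first exact: fin_gen_regular.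
  move=> c x y; have [tl _ _] := tP; rewrite /GRing.scale /= !mulr_algl; exact: tl.
have [t' t'K] := choice ts; exists t' => // x; apply: tinj; exact: t'K.
Qed.

End FromDuality.

Section AntiAutomorphism.

Variables (k : fieldType) (L : falgType k) (r : nat) (G : grading L).
Variables (e : 'I_r -> L) (S : 'I_r -> gmod G).
Hypotheses (HG0 : degree0_iso_power G r) (He : forall i, e i \in G 0%N).
Hypothesis HG1 : generated_in_degree1 G.
Hypothesis HS : ordered_simples e (fun i => gm_mod (S i)).
Hypothesis HSc : forall j, concentrated (S j) 0.
Variable D : duality (fin_cat (Mod L)).
Hypothesis HDS : forall i, dual_to D (gm_mod (S i)) (gm_mod (S i)).

Lemma anti_graded : exists tau tau', [/\ anti tau, anti tau',
  cancel tau tau' /\ cancel tau' tau,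
  (forall d a, a \in G d -> tau a \in G d) /\ (forall d a, a \in G d -> tau' a \in G d)
  & forall i, tau (e i) = e i /\ tau' (e i) = e i].
Proof.
have [W [f [g [fK gK]]]] := dual_ess_surj D (Robj L).
have [fS SD] : exists fS : forall i, fin_gen (S i : lmodType L), forall i,
    isomorphic (sval (D (exist (fun X : Mod L => fin_gen (carrier X)) (S i : lmodType L) (fS i)))) (gm_mod (S i) : Mod L).
  have fS i : fin_gen (S i : lmodType L) by have [] := HDS i.
  exists fS => i; have [fM] := HDS i; by rewrite (Prop_irrelevance fM (fS i)).
have [t [aphi [t' tK t'K]] cphi] := duality_anti0 HG0 He HS HSc fK gK SD.
have apsi : anti t'.
  split=> [c a b||a b]; apply: (can_inj tK).
  - by rewrite t'K; have [tl _ _] := aphi; rewrite tl !t'K.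
  - by rewrite t'K (anti1 aphi).
  by rewrite t'K (antiM aphi) !t'K.
have cpsi i b : chi HG0 He HS i (t' b) = chi HG0 He HS i b by rewrite -cphi t'K.
exists (gr_part G t), (gr_part G t'); split.
- apply: (@gr_part_anti k L r G e S HG0 He HG1 HS) => //.
- apply: (@gr_part_anti k L r G e S HG0 He HG1 HS) => //.
- by split; [apply: (@gr_part_cancel k L r G e S HG0 He HG1 HS) tK | apply: (@gr_part_cancel k L r G e S HG0 He HG1 HS) t'K].
- by split=> d a; exact: gr_part_mem.
by move=> i; split; apply: (@gr_part_e k L r G e S HG0 He HS).
Qed.

End AntiAutomorphism.

(** * Standard modules and the Delta-grading *)

Section Standard.

Variables (k : fieldType) (L : falgType k) (r : nat) (G : grading L).
Variables (e : 'I_r -> L) (S Delta : 'I_r -> gmod G).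
Hypotheses (HG0 : degree0_iso_power G r) (He : forall i, e i \in G 0%N).
Hypothesis HG1 : generated_in_degree1 G.
Hypothesis HS : ordered_simples e (fun i => gm_mod (S i)).
Hypothesis HSc : forall j, concentrated (S j) 0.
Hypothesis HDelta :
  forall i, standard e (fun i => gm_mod (S i)) i (gm_mod (Delta i)).
Hypothesis Hdiv : forall i, division_End (gm_mod (Delta i)).
Hypothesis Htop : forall j, exists p : hom (Delta j : Gr G) (S j : Gr G), surj p.

Local Notation chi := (chi HG0 He HS).
Local Notation eM := (e_mul HS).
Local Notation eI := (e_idem HS).

(** The trace ideal of the projectives L e_m with m > j; Delta_j is L e_j modulo the elements of
    this ideal that it contains. *)
Definition ideal_above (j : 'I_r) : {vspace L} :=
  (\sum_(m < r | (j < m)%N) fullv * (<[e m]> * fullv))%VS.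

Lemma ideal_above_mem (j m : 'I_r) a b : (j < m)%N -> a * e m * b \in ideal_above j.
Proof.
move=> jm; rewrite /ideal_above (bigD1 m) //= -[_ * _]addr0 memv_add ?mem0v //.
by rewrite -mulrA !memv_mul ?memvf ?memv_line.
Qed.

Lemma ideal_above_ind (j : 'I_r) (P : L -> Prop) : P 0 -> (forall x y, P x -> P y -> P (x + y)) ->
  (forall (m : 'I_r) a b, (j < m)%N -> P (a * e m * b)) -> forall a, a \in ideal_above j -> P a.
Proof.
move=> P0 PD PM a /memv_sumP[v vP ->]; apply: big_ind => // m jm.
apply: (prodv_ind P0 PD) (vP m jm) => x y _.
apply: (@prodv_ind _ _ _ _ (fun y => P (x * y))); first by rewrite mulr0.
  by move=> u w Pu Pw; rewrite mulrDr; exact: PD.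
by move=> _ w /vlineP[c ->] _; rewrite mulrA -scalerAr scalerAl; exact: PM.
Qed.

Lemma ideal_above_sub j : is_sub (fun x : left_ideal (e j) => left_ideal_val x \in ideal_above j).
Proof.
split=> [|a x y Ix Iy]; first exact: mem0v.
rewrite [left_ideal_val _](_ : _ = a * left_ideal_val x + left_ideal_val y) //.
rewrite memvD //; move: (left_ideal_val x) Ix.
apply: ideal_above_ind => [|u v hu hv|m u v jm].
- by rewrite mulr0 mem0v.
- by rewrite mulrDr memvD.
by rewrite !mulrA ideal_above_mem.
Qed.

Lemma chi_ideal j a : a \in ideal_above j -> chi j a = 0.
Proof.
move: a; apply: ideal_above_ind => [|x y|m x y jm]; first exact: chi0.
  by rewrite chiD => -> ->; rewrite addr0.
by rewrite !chi_mul chi_e -val_eqE /= ltn_eqF // mulr0 mul0r.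
Qed.

(** Maximality is applied to L e_j modulo [ideal_above j]: this has no higher factors, so it is a
    quotient of Delta_j, which bounds the annihilator of the generator. *)
Lemma standard_gen_exists j : exists d : Delta j,
  [/\ e j *: d = d, forall x, exists a, x = a *: d,
      forall (m : 'I_r) x, (j < m)%N -> e m *: x = 0 :> Delta j
    & forall a, a *: d = 0 -> a * e j \in ideal_above j].
Proof.
have [nf [p [sp up]]] := HDelta j; have lp := hom_mor p.
have kill (m : 'I_r) (x : Delta j) : (j < m)%N -> e m *: x = 0.
  by move=> jm; apply: (no_factor_aboveP HG0 He HS HSc j _).1 => //; exact: nf.
pose Q := quo (ideal_above_sub j).
have sq : surj (@quo_pi _ _ _ (ideal_above_sub j)) := @quo_surj _ _ _ _.
have nfQ : no_factor_above (fun i => gm_mod (S i)) j Q.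
  apply/(no_factor_aboveP HG0 He HS HSc) => m jm q; have [x <-] := sq q.
  rewrite -(linZ (@quo_pi_lin _ _ _ _)); apply/quo_pi0 => /=.
  by rewrite -[e m *: _]/(e m * left_ideal_val x) -[e m]mul1r ideal_above_mem.
have [f fp] := up Q (mkhom (@quo_pi_lin _ _ _ (ideal_above_sub j))) sq nfQ.
exists (p (mkli e j 1)); split.
- by rewrite -(linZ lp) -mkliZ mulr1; congr (p _); apply: val_inj; rewrite /= eI mul1r.
- move=> x; have [y <-] := sp x; exists (left_ideal_val y).
  by rewrite -(linZ lp) -mkliZ mulr1 (mkli_val HS).
- by move=> m x; exact: kill.
move=> a; rewrite -(linZ lp) -mkliZ mulr1 => pa.
have := fp (mkli e j a); rewrite pa (lin0 (hom_mor f)) => /esym/quo_pi0 //.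
Qed.

Definition dgen j : Delta j := sval (cid (standard_gen_exists j)).

Lemma dgen_e j : e j *: dgen j = dgen j.
Proof. by case: (svalP (cid (standard_gen_exists j))). Qed.
Lemma dgenP j (x : Delta j) : exists a, x = a *: dgen j.
Proof. by case: (svalP (cid (standard_gen_exists j))) => _ + _ _; apply. Qed.
Lemma dgen_above (j m : 'I_r) (x : Delta j) : (j < m)%N -> e m *: x = 0.
Proof. by case: (svalP (cid (standard_gen_exists j))) => _ _ + _; apply. Qed.
Lemma dgen_ann j a : a *: dgen j = 0 -> a * e j \in ideal_above j.
Proof. by case: (svalP (cid (standard_gen_exists j))) => _ _ _; apply. Qed.

Lemma chi_dgen j a : a *: dgen j = 0 -> chi j a = 0.
Proof.
by move/dgen_ann/chi_ideal; rewrite chi_mul chi_e eqxx mulr1.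
Qed.

Lemma dgen_neq0 j : dgen j != 0.
Proof.
apply/eqP => d0; have /chi_dgen/eqP : 1 *: dgen j = 0 by rewrite d0 scaler0.
by rewrite chi1 oner_eq0.
Qed.

Lemma standard_map j (M : lmodType L) (x : M) : e j *: x = x ->
  (forall (m : 'I_r) a, (j < m)%N -> e m *: (a *: x) = 0) ->
  exists2 f : Delta j -> M, linear f & forall a, f (a *: dgen j) = a *: x.
Proof.
move=> ex kx; have ann a : a *: dgen j = 0 -> a *: x = 0.
  move/dgen_ann => Ia; rewrite -ex scalerA; move: (a * e j) Ia.
  apply: ideal_above_ind => [|u v u0 v0|m u v jm].
  - exact: scale0r.
  - by rewrite scalerDl u0 v0 addr0.
  by rewrite -!scalerA kx // scaler0.
have [c cP] := choice (@dgenP j); exists (fun y => c y *: x) => [a y z|a].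
  apply/subr0_eq; rewrite scalerA -scalerDl -scalerBl; apply: ann.
  by rewrite scalerBl scalerDl -scalerA -!cP subrr.
by apply/subr0_eq; rewrite -scalerBl; apply: ann; rewrite scalerBl -cP subrr.
Qed.

(** For n = e_j a e_j - chi_j(a) e_j, sending the generator to its multiple by n defines an
    endomorphism of Delta_j. It is nilpotent, as n has no part in degree 0, hence zero in a division
    ring. *)
Lemma e_dgen j a : e j *: (a *: dgen j) = (chi j a)%:A *: dgen j.
Proof.
pose n := e j * a * e j - chi j a *: e j.
have nE : n *: dgen j = e j *: (a *: dgen j) - (chi j a)%:A *: dgen j.
  by rewrite /n scalerBl kscaleE -!scalerA !dgen_e.
apply/subr0_eq; rewrite -nE; apply/eqP/negPn/negP => nn.
have n0 : gcomp G 0 n = 0.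
  apply: (chi_all0 (HG0 := HG0) (He := He) (HS := HS)) => i.
  rewrite chiB chiZ !chi_mul chi_e; case: eqP => [->|_]; last by rewrite !mul0r mulr0 subrr.
  by rewrite mul1r mulr1 subrr.
have [|m b jm|f lf fE] := @standard_map j (Delta j) (n *: dgen j).
- by rewrite scalerA /n mulrBr !mulrA eI -scalerAr eI.
- exact: dgen_above.
have [_ /(_ (mkhom lf))[|g fK _]] := Hdiv j.
  by exists (dgen j); rewrite -[dgen j]scale1r /= fE scale1r.
have z i : n ^+ i *: dgen j = 0 -> dgen j = 0.
  elim: i => [|i IH]; rewrite ?scale1r // exprSr -scalerA -fE => fz; apply: IH.
  by apply: (can_inj fK); rewrite /= fz (lin0 lf).
by have := dgen_neq0 j; rewrite (z (gr_top G).+1) ?eqxx // rad_nilp // scale0r.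
Qed.

(** By [e_dgen] the degree 0 part of the generator is a scalar multiple of it; the map onto S_j,
    which lives in degree 0, shows that the scalar is 1. *)
Lemma dgen_degree j : gm_pr 0 (dgen j) = dgen j.
Proof.
have [q sq] := Htop j; have [lq dq] := hom_mor q.
have qn : q (dgen j) != 0.
  apply/eqP => q0; case/eqP: (sgen_neq0 HG0 He HS HSc j).
  have [x <-] := sq (sgen HG0 He HS HSc j); have [a ->] := dgenP x.
  by rewrite (linZ lq) q0 scaler0.
have [a aE] := dgenP (gm_pr 0 (dgen j)).
have : gm_pr 0 (dgen j) = (chi j a)%:A *: dgen j.
  by rewrite -e_dgen -aE -(gprZ0 _ _ (He j)) dgen_e.
have : q (gm_pr 0 (dgen j)) = q (dgen j) by rewrite dq; exact: HSc.
move=> /[swap] cE; rewrite cE (linZ lq) => e1.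
have -> : chi j a = 1; last by rewrite !scale1r.
by apply: (kscale_inj qn); rewrite e1 !scale1r.
Qed.

Variables (h : 'I_r -> nat).
Hypothesis Hh1 : H1 h S Delta.

(** (H1) for elements: a non-zero homogeneous [x] fixed by [e i] spans a copy of S_i over L_0. *)
Lemma standard_degree i j (l : int) (x : Delta j) : e i *: x = x -> gm_pr l x = x ->
  x != 0 -> (h i)%:Z = (h j)%:Z - l.
Proof.
move=> ex xl nx; apply/eqP/negPn/negP => /Hh1; apply.
have [c cP] := choice (@sgenP _ _ _ _ _ _ HG0 He HS HSc i).
pose ka y := chi i (c y).
have kaE y : y = (ka y)%:A *: sgen HG0 He HS HSc i by rewrite /ka -sgenZ -cP.
have ka_uni y (d : k) : y = d%:A *: sgen HG0 He HS HSc i -> ka y = d.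
  by rewrite {1}(kaE y); apply: kscale_inj; exact: sgen_neq0.
have ax a : a \in G 0%N -> a *: x = (chi i a)%:A *: x.
  move=> Ga; rewrite -{1}(gcomp_id 0 Ga : gcomp G 0 a = a) (gcomp0_chi HG0 He HS).
  rewrite scaler_suml (bigD1 i) //= big1 ?addr0 => [|m nmi].
    by rewrite kscaleE ex.
  by rewrite kscaleE -ex scalerA eM (negPf nmi) scale0r scaler0.
have lf : linear (fun y : restrict (@gr0_val _ _ G) (S i) => (ka y)%:A *: x : restrict (@gr0_val _ _ G) (Delta j)).
  move=> a y z; have Ga : gr0_val a \in G 0%N := valP a.
  have kE : a *: y + z = (chi i (gr0_val a) * ka y + ka z)%:A *: sgen HG0 He HS HSc i.
    rewrite kscaleDl kscaleA -!kaE; congr (_ + _).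
    rewrite -[a *: y]/(gr0_val a *: (y : S i)) (kaE y) kscaleC sgenZ.
    by rewrite [RHS]kscaleC.
  rewrite (ka_uni _ _ kE) kscaleDl kscaleA; congr (_ + _).
  by rewrite -[RHS]/(gr0_val a *: ((ka y)%:A *: x)) kscaleC ax // kscaleC.
exists (restrict (@gr0_val _ _ G) (S i) : Mod (gr0 G)), (mkhom lf), (mkhom (@Mod_id _ _)).
split.
- apply: (lin_inj lf) => y /= y0; rewrite (kaE y).
  by rewrite (kscale_eq0 nx y0) !scale0r.
- by move=> y; exists y.
by move=> y /=; rewrite /in_degree gprZk xl.
Qed.

Variables (tau : L -> L) (tauP : anti tau).
Hypotheses (tauK : injective tau) (tauG : forall d a, a \in G d -> tau a \in G d).
Hypothesis taue : forall i, tau (e i) = e i.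

Lemma e_sandwich d i j a : a \in G d -> e i * a * e j \in G d.
Proof.
by move=> Ga; rewrite -[d]addn0; apply: grM (He j); rewrite -[d]add0n; exact: grM.
Qed.

Lemma gcomp_e_sandwich d i j a : gcomp G d (e i * a * e j) = e i * gcomp G d a * e j.
Proof. by rewrite (gcompMr _ _ (He j)) leq0n subn0 (gcompMl _ _ (He i)) leq0n subn0. Qed.

Lemma e_sandwich0 i j a : i != j -> gcomp G 0 (e i * a * e j) = 0.
Proof.
by move=> nij; rewrite gcomp_e_sandwich (chiE HG0 He HS) -scalerAl eM (negPf nij) scaler0.
Qed.

(** The arrow acts non-trivially on the generator of Delta_j. Otherwise it would be a sum of
    products through some m > j; as m differs from both i and j, these have degree at least 2. *)
Lemma arrow_down (i j : 'I_r) x : x \in G 1%N -> (i <= j)%N -> e i * x * e j != 0 ->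
  h j = (h i).+1.
Proof.
move=> Gx le_ij nx; set y := e i * x * e j in nx.
have Gy : y \in G 1%N by exact: e_sandwich.
have nyd : y *: dgen j != 0.
  apply/eqP => /dgen_ann; rewrite /y -(mulrA _ (e j)) eI -/y => Iy.
  have : gcomp G 1 (e i * y * e j) = 0.
    move: (y) Iy; apply: ideal_above_ind => [|u v u0 v0|m u v jm].
    - by rewrite mulr0 mul0r gcomp0.
    - by rewrite mulrDr mulrDl gcompD u0 v0 addr0.
    have nim : i != m by rewrite -val_eqE /= ltn_eqF // (leq_ltn_trans le_ij).
    have nmj : m != j by rewrite -val_eqE /= gtn_eqF.
    have -> : e i * (u * e m * v) * e j = (e i * u * e m) * (e m * v * e j).
      by rewrite !mulrA -(mulrA _ (e m) (e m)) eI.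
    have ab1 p q w : p != q -> gr_above G 1 (e p * w * e q).
      by move=> npq [|n] // _; exact: e_sandwich0.
    exact: (gr_aboveM (ab1 _ _ _ nim) (ab1 _ _ _ nmj)).1.
  rewrite /y !mulrA eI -(mulrA _ (e j)) eI (gcomp_id _ Gy) eqxx => y0.
  by rewrite y0 eqxx in nx.
have : (h i)%:Z = (h j)%:Z - 1.
  apply: (@standard_degree i j 1 (y *: dgen j)) => //.
    by rewrite scalerA /y !mulrA eI.
  by have := in_degreeZ Gy (dgen_degree j); rewrite addr0.
by move=> hE; apply/eqP; rewrite -eqz_nat -addn1 PoszD hE subrK.
Qed.

(** [tau] reverses arrows and keeps degrees. *)
Lemma arrow_up (i j : 'I_r) x : x \in G 1%N -> (j <= i)%N -> e i * x * e j != 0 ->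
  h i = (h j).+1.
Proof.
move=> Gx le_ji nx; apply: (@arrow_down j i (tau x)) => //; first exact: tauG.
apply: contraNneq nx => t0; apply/eqP/tauK.
by rewrite !(antiM tauP) !taue (anti0 tauP) mulrA.
Qed.

Lemma sandwich_sum (u v : L) : u * v = \sum_m u * e m * v.
Proof. by rewrite -mulr_suml -mulr_sumr (e_sum HS) mulr1. Qed.

(** Along a product of arrows, [d] counts the factors from L_1 of the form e_i u e_m with i > m. All
    others have i < m, a loop being impossible since it would give h(i) = h(i) + 1; so d = 0 leaves
    i < j or the trivial path. *)
Lemma path_height l (i j : 'I_r) a : a \in G l -> e i * a * e j != 0 ->
  exists d, (l + h i = h j + d.*2)%N /\
    (d = 0%N -> (i < j)%N \/ i = j /\ l = 0%N).
Proof.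
elim: l i a => [|l IH] i a Ga.
  rewrite -(gcomp_id 0 Ga : gcomp G 0 a = a) (chiE HG0 He HS) -scalerAl eM.
  have [->|nij] := eqVneq i j; last by rewrite scaler0 eqxx.
  by move=> _; exists 0%N; rewrite add0n addn0; split=> //; right.
have := gr_step HG1 Ga; move: a {Ga}; apply: prodv_ind => [|x y hx hy|u v Gu Gv].
- by rewrite mulr0 mul0r eqxx.
- have [x0|nx] := eqVneq (e i * x * e j) 0; last by move=> _; exact: hx.
  by rewrite mulrDr mulrDl x0 add0r; exact: hy.
rewrite (sandwich_sum u v) mulr_sumr mulr_suml => ns.
have [m nm] : exists m, e i * (u * e m * v) * e j != 0.
  apply: contraPP ns => nex; apply/negP/negPn/eqP/big1 => m _.
  by apply/eqP/negPn/negP => nm; apply: nex; exists m.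
have nm' : (e i * u * e m) * (e m * v * e j) != 0.
  by rewrite !mulrA -(mulrA _ (e m) (e m)) eI -!mulrA; rewrite !mulrA in nm *.
have n1 : e i * u * e m != 0 by apply: contraNneq nm' => ->; rewrite mul0r.
have n2 : e m * v * e j != 0 by apply: contraNneq nm' => ->; rewrite mulr0.
have [d [dE d0]] := IH m v Gv n2.
have [lt_im|lt_mi|eim] := ltngtP i m.
- have hE := arrow_down Gu (ltnW lt_im) n1.
  exists d; split; first by rewrite -dE hE addSnnS.
  by move=> /d0[lt_mj|[<- _]]; left=> //; exact: ltn_trans lt_mj.
- have hE := arrow_up Gu (ltnW lt_mi) n1.
  by exists d.+1; split=> //; rewrite hE addnS addSn dE doubleS !addnS.
have /eqP := arrow_down Gu (eq_leq eim) n1.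
have -> : i = m by exact: val_inj.
by rewrite -[X in X == _]addn0 -addn1 eqn_add2l.
Qed.

End Standard.

(** * Construction of the Delta-grading *)

Section DeltaGrading.

Variables (k : fieldType) (L : falgType k) (r : nat) (G : grading L).
Variables (e : 'I_r -> L) (h : 'I_r -> nat).
Hypothesis He : forall i, e i \in G 0%N.
Hypothesis eM : forall i j, e i * e j = if i == j then e i else 0.
Hypothesis esum : \sum_i e i = 1.
Hypothesis path : forall l (i j : 'I_r) a, a \in G l -> e i * a * e j != 0 ->
  exists d, (l + h i = h j + d.*2)%N.

Let eI i : e i * e i = e i. Proof. by rewrite eM eqxx. Qed.

Lemma piece_sum a : a = \sum_i \sum_j \sum_(l < (gr_top G).+1) e i * gcomp G l a * e j.
Proof.
under eq_bigr => i _ do under eq_bigr => j _ do rewrite -mulr_suml -mulr_sumr -gcomp_sum.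
under eq_bigr => i _ do rewrite -mulr_sumr esum mulr1.
by rewrite -mulr_suml esum mul1r.
Qed.

Lemma delta_mem l (i j : 'I_r) a d : a \in G l -> (l + h i = h j + d.*2)%N ->
  e i * a * e j \in delta_comp G e h d.
Proof.
move=> Ga ld; have [le_l|lt_l] := leqP l (gr_top G); last first.
  by rewrite (gr_mem_top lt_l Ga) mulr0 mul0r mem0v.
apply: (subvP (sumv_sup i _ (subvv _))) => //.
apply: (subvP (sumv_sup j _ (subvv _))) => //.
apply: (subvP (sumv_sup (Ordinal (le_l : (l < (gr_top G).+1)%N)) _ (subvv _))).
  by rewrite ld.
by rewrite !memv_mul ?memv_line.
Qed.

Lemma delta_ind d (P : L -> Prop) : P 0 -> (forall x y, P x -> P y -> P (x + y)) ->
  (forall l (i j : 'I_r) a, a \in G l -> (l + h i = h j + d.*2)%N -> P (e i * a * e j)) ->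
  forall a, a \in delta_comp G e h d -> P a.
Proof.
move=> P0 PD PM a /memv_sumP[u uP ->]; apply: big_ind => // i _.
have /memv_sumP[v vP ->] := uP i isT; apply: big_ind => // j _.
have /memv_sumP[w wP ->] := vP j isT; apply: big_ind => // l lE.
apply: (prodv_ind P0 PD) (wP l lE) => x _ + /vlineP[c ->].
move: x; apply: prodv_ind => [|x y hx hy|_ x /vlineP[b ->] Gx].
- by rewrite mul0r.
- by rewrite mulrDl; exact: PD.
have -> : b *: e i * x * (c *: e j) = e i * (b *: (c *: x)) * e j.
  rewrite -[in LHS]scalerAl -[in LHS]scalerAl -[in LHS]scalerAr.
  by rewrite -[in RHS]scalerAr -[in RHS]scalerAr -[in RHS]scalerAl -[in RHS]scalerAl.
by apply: (PM l); rewrite ?memvZ //; apply/eqP.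
Qed.

Lemma delta_piece d l (i j : 'I_r) a : a \in delta_comp G e h d ->
  (l + h i != h j + d.*2)%N -> e i * gcomp G l a * e j = 0.
Proof.
move=> + nl; move: a; apply: delta_ind => [|x y x0 y0|m p q a Ga mE].
- by rewrite gcomp0 mulr0 mul0r.
- by rewrite gcompD mulrDr mulrDl x0 y0 addr0.
rewrite (gcompMr _ _ (He q)) leq0n subn0 (gcompMl _ _ (He p)) leq0n subn0 (gcomp_id _ Ga).
case: eqP => [lm|_]; last by rewrite !(mulr0, mul0r).
rewrite !mulrA eM; case: eqP => [ip|_]; last by rewrite !mul0r.
rewrite -mulrA eM; case: eqP => [qj|_]; last by rewrite mulr0.
by rewrite lm ip -qj mE eqxx in nl.
Qed.

(** A crude bound for Delta-degrees, from 2d <= l + h(i). *)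
Let N := (gr_top G + \sum_i h i)%N.

Lemma delta_small d l (i j : 'I_r) : (l <= gr_top G)%N -> (l + h i = h j + d.*2)%N -> (d <= N)%N.
Proof.
move=> le_l ld; apply: (@leq_trans (l + h i)).
  by rewrite ld -addnn addnA leq_addl.
by rewrite leq_add // (bigD1 i) //= leq_addr.
Qed.

Fact delta_bound d : (N < d)%N -> delta_comp G e h d = 0%VS.
Proof.
move=> lt_d; apply/eqP; rewrite -subv0; apply/subvP; apply: delta_ind.
- exact: mem0v.
- by move=> x y; exact: memvD.
move=> l i j a Ga lE; rewrite memv0; apply/eqP.
have [le_l|lt_l] := leqP l (gr_top G); last by rewrite (gr_mem_top lt_l Ga) mulr0 mul0r.
by have := delta_small le_l lE; rewrite leqNgt lt_d.
Qed.

(** Each piece e_i L_(l) e_j belongs to at most one Delta-degree, so independence can be checked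
    piece by piece. *)
Let delta_independent (u : 'I_N.+1 -> L) : (forall d : 'I_N.+1, true -> u d \in delta_comp G e h d) ->
  \sum_d u d = 0 -> forall d, true -> u d = 0.
Proof.
move=> uP u0 d _.
rewrite (piece_sum (u d)) big1 // => i _; rewrite big1 // => j _; rewrite big1 // => l _.
have [lE|nl] := eqVneq (l + h i)%N (h j + d.*2)%N; last exact: delta_piece (uP d isT) nl.
have: e i * gcomp G l (\sum_d u d) * e j = 0 by rewrite u0 gcomp0 mulr0 mul0r.
rewrite (bigD1 d) //= gcompD mulrDr mulrDl gcomp_bigsum mulr_sumr mulr_suml.
rewrite [X in _ + X]big1 ?addr0 // => d' nd; apply: delta_piece (uP d' isT) _.
by rewrite lE eqn_add2l -!muln2 eqn_mul2r /= eq_sym.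
Qed.

Fact delta_full : (\sum_(d < N.+1) delta_comp G e h d)%VS = fullv.
Proof.
apply/eqP; rewrite eqEsubv subvf /=; apply/subvP => a _; rewrite (piece_sum a).
rewrite memv_suml // => i _; rewrite memv_suml // => j _; rewrite memv_suml // => l _.
have [->|nz] := eqVneq (e i * gcomp G l a * e j) 0; first exact: mem0v.
have [d lE] := path (gcomp_mem G l a) nz.
have le_d : (d < N.+1)%N by rewrite ltnS; apply: delta_small lE; rewrite -ltnS; exact: ltn_ord.
by apply: (subvP (sumv_sup (Ordinal le_d) _ (subvv _))) => //; exact: delta_mem (gcomp_mem G l a) lE.
Qed.

Fact delta_one : 1 \in delta_comp G e h 0.
Proof.
rewrite -esum memv_suml // => i _; rewrite -eI -{1}[e i]mulr1.
apply: (@delta_mem 0%N i i 1); first exact: gr_one.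
by rewrite addn0.
Qed.

Fact delta_mul d d' : (delta_comp G e h d * delta_comp G e h d' <= delta_comp G e h (d + d'))%VS.
Proof.
apply/prodvP => a b Ga; move: b; apply: delta_ind => [|x y|l i j b Gb lE].
- by rewrite mulr0 mem0v.
- by rewrite mulrDr; exact: memvD.
move: a Ga; apply: delta_ind => [|x y|m p q a Ga mE].
- by rewrite mul0r mem0v.
- by rewrite mulrDl; exact: memvD.
rewrite !mulrA -(mulrA _ (e q)) eM; case: eqP => [eqi|_]; last by rewrite mulr0 !mul0r mem0v.
have -> : e p * a * e q * b * e j = e p * (a * (e q * b)) * e j by rewrite !mulrA.
apply: (@delta_mem (m + l)).
  by apply: grM Ga _; rewrite -[l]add0n; exact: grM.
by move: lE mE; rewrite eqi; lia.
Qed.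

Definition delta_grading : grading L :=
  Grading delta_bound (introT directv_sum_independent delta_independent) delta_full delta_one delta_mul.

End DeltaGrading.

(** * Costandard modules over the degree 0 part *)

Section Borel.

Variables (k : fieldType) (L : falgType k) (r : nat) (D G : grading L).
Variables (e : 'I_r -> L) (chi : 'I_r -> L -> k).
Variables (Delta : 'I_r -> gmod G) (d : forall j, Delta j).
Hypothesis eM : forall i j, e i * e j = if i == j then e i else 0.
Hypothesis esum : \sum_i e i = 1.
Hypothesis eB : forall i, e i \in D 0%N.
Hypothesis chiM : forall i a b, chi i (a * b) = chi i a * chi i b.
Hypothesis chie : forall i j, chi i (e j) = (i == j)%:R.
Hypothesis chi_part : forall i a, chi i (gcomp D 0 a) = chi i a.
Hypothesis B_tri : forall (i j : 'I_r) b, b \in D 0%N -> (j < i)%N -> e i * b * e j = 0.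
Hypothesis B_diag : forall i b, b \in D 0%N -> e i * b * e i = chi i b *: e i.
Hypothesis de : forall j, e j *: d j = d j.
Hypothesis dP : forall j x, exists a, x = a *: d j.
Hypothesis d_above : forall (j m : 'I_r) (x : Delta j), (j < m)%N -> e m *: x = 0.
Hypothesis d_ann : forall j a, a *: d j = 0 -> a * e j \in ideal_above e j.
Hypothesis d_free : forall j b, b \in D 0%N -> b *: d j = 0 -> b * e j = 0.
Hypothesis d_pos : forall j n a (x : Delta j), (0 < n)%N -> a \in D n -> a *: x = 0.
Hypothesis d_map : forall j (M : lmodType L) (x : M), e j *: x = x ->
  (forall (m : 'I_r) a, (j < m)%N -> e m *: (a *: x) = 0) ->
  exists2 f : Delta j -> M, linear f & forall a, f (a *: d j) = a *: x.
Hypothesis L_filtered : filtered (C := Mod L) (fun i => gm_mod (Delta i)) (L^o : lmodType L).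

Let B : {vspace L} := D 0%N.
Let B1 : 1 \in B := gr_one D.
Let BM a b : a \in B -> b \in B -> a * b \in B.
Proof. exact: (@grM _ _ D 0 0). Qed.

Lemma eV i (M : lmodType L) (x : M) : e i *: (e i *: x) = e i *: x.
Proof. by rewrite scalerA eM eqxx. Qed.

Lemma e_decomp (M : lmodType L) (x : M) : x = \sum_i e i *: x.
Proof. by rewrite -scaler_suml esum scale1r. Qed.

Lemma d_part j a (x : Delta j) : gcomp D 0 a *: x = a *: x.
Proof.
rewrite [in RHS](gcomp_sum D a) big_ord_recl scalerDl scaler_suml big1 ?addr0 // => i _.
exact: d_pos (gcomp_mem D _ a).
Qed.

Lemma dB j x : exists b, b \in B /\ x = b *: d j.
Proof. by have [a ->] := dP x; exists (gcomp D 0 a); rewrite gcomp_mem d_part. Qed.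

Lemma e_d j a : e j *: (a *: d j) = (chi j a)%:A *: d j.
Proof.
rewrite -[a *: _]d_part -{1}de !scalerA B_diag ?gcomp_mem // chi_part.
by rewrite kscaleE de.
Qed.

(** By [d_free] the generator has over [B] no more relations than [e j], so a lift may send it to
    any preimage fixed by [e j]. *)
Lemma bproj_standard j : bproj B (Delta j).
Proof.
move=> X Y q f lq bf fq; have [x0 x0E] := fq (d j); pose x := e j *: x0.
have qx : q x = f (d j) by rewrite (linZ lq) -x0E -(blinZ B1 bf) ?de.
have [c cP] := choice (@dB j).
have cx b : b \in B -> b *: d j = 0 -> b *: x = 0.
  by move=> Bb b0; rewrite /x scalerA (d_free Bb b0) scale0r.
exists (fun y => c y *: x) => [b y z Bb|y].
  rewrite scalerA -scalerDl; apply/subr0_eq; rewrite -scalerBl; apply: cx.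
    by rewrite memvB ?memvD ?BM ?(cP _).1.
  by rewrite scalerBl scalerDl -scalerA -!(cP _).2 subrr.
by rewrite (linZ lq) qx -(blinZ B1 bf) ?(cP y).1 // -(cP y).2.
Qed.

Lemma bproj_regular : bproj B L^o.
Proof. exact: (bproj_filtered B1 bproj_standard L_filtered). Qed.

(* B-linear maps from M to the simple B-module S_i *)
Definition bfun (i : 'I_r) (M : lmodType L) (b : M -> k) : Prop :=
  kfun b /\ forall c x, c \in B -> b (c *: x) = chi i c * b x.

Lemma bfun_e i (M : lmodType L) (b : M -> k) j x : bfun i b ->
  b (e j *: x) = if i == j then b x else 0.
Proof.
by case=> _ bb; rewrite bb // chie; case: eqP; rewrite ?mul1r ?mul0r.
Qed.

Lemma bfun_comp i (M N : lmodType L) (f : M -> N) (b : N -> k) :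
  blin B f -> bfun i b -> bfun i (b \o f).
Proof.
move=> bf [kb bb]; split=> [c x y|c x Bc] /=.
  by rewrite bf ?kb // memvZ.
by rewrite (blinZ B1 bf) // bb.
Qed.

(** Induction on the filtration, with top factor Delta_s and a lift [v] of its generator. If s < m,
    then [e m] moves multiples of [v] into the submodule. If i < m <= s, the B-part of w = a e_m c
    contributes the factor chi_i(w) = 0; the rest of w annihilates the generator, so it passes
    through some e_q with q > s, as in the first case. *)
Lemma bfun_above_filtered (M : lmodType L) : filtered (C := Mod L) (fun i => gm_mod (Delta i)) M ->
  forall i (b : M -> k) (m : 'I_r) a x, bfun i b -> (i < m)%N -> b (a *: (e m *: x)) = 0.
Proof.
elim=> {M} [X X0 i b m a x [kb _] _|s X Y Z u p _ IH [f [g [fK gK]]] [iu sp up]].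
  by rewrite [_ *: _]X0 (kfun0 kb).
move=> i b m a y bb im; have [kb _] := bb.
have lu := hom_mor u; have lp := hom_mor p; have lf := hom_mor f.
have bu c (m' : 'I_r) x : (i < m')%N -> b (c *: (e m' *: u x)) = 0.
  move=> im'; rewrite -!(linZ lu); apply: (IH i (b \o u)) => //.
  exact: bfun_comp (lin_blin lu) bb.
have ker y' : f (p y') = 0 -> exists x, y' = u x.
  by move=> fp0; apply/up; rewrite -[p y']fK fp0 (lin0 (hom_mor g)).
have [v0 v0E] := sp (g (d s)); pose v := e s *: v0.
have vE : f (p v) = d s by rewrite (linZ lp) (linZ lf) v0E gK de.
have low c (q : 'I_r) c' : (s < q)%N -> (i < q)%N -> b (c *: (e q *: (c' *: v))) = 0.
  move=> sq iq; have [|x xE] := ker (e q *: (c' *: v)).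
    by rewrite (linZ lp) (linZ lf) d_above.
  by rewrite -eV xE bu.
have [c cE] := dP (f (p y)).
have [|x xE] := ker (y - c *: v).
  by rewrite (linB lp) (linB lf) (linZ lp c) (linZ lf c) vE cE subrr.
have -> : y = u x + c *: v by rewrite -xE subrK.
rewrite !scalerDr (kfunD kb) bu // add0r.
have [sm|ms] := ltnP s m; first exact: low.
have is_ : (i < s)%N := leq_trans im ms.
pose w := a * e m * c; have -> : a *: (e m *: (c *: v)) = w *: v by rewrite !scalerA.
have -> : w = gcomp D 0 w + (w - gcomp D 0 w) by rewrite addrC subrK.
rewrite scalerDl (kfunD kb) bb.2 ?gcomp_mem // chi_part /w !chiM chie.
have -> : i == m = false by rewrite -val_eqE /= ltn_eqF.
rewrite mulr0 !mul0r add0r -/w.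
have : (w - gcomp D 0 w) * e s \in ideal_above e s.
  by apply: d_ann; rewrite scalerBl d_part subrr.
have -> : (w - gcomp D 0 w) *: v = ((w - gcomp D 0 w) * e s) *: v by rewrite -scalerA eV.
move: (_ * e s); apply: ideal_above_ind => [|c1 c2 h1 h2|q c1 c2 sq].
- by rewrite scale0r (kfun0 kb).
- by rewrite scalerDl (kfunD kb) h1 h2 addr0.
by rewrite -!scalerA low // (ltn_trans is_).
Qed.

(** The functional is pulled back to the regular module along c |-> c x. *)
Lemma bfun_above i (M : lmodType L) (b : M -> k) (m : 'I_r) a x :
  bfun i b -> (i < m)%N -> b (a *: (e m *: x)) = 0.
Proof.
move=> [kb bb] im; pose g (c : L^o) := b ((c : L) *: x).
have bg : bfun i g.
  split=> [c y z|c y Bc]; last by rewrite /g -scalerA bb.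
  by rewrite /g scalerDl -kb -scalerA.
have := bfun_above_filtered L_filtered a 1 bg im; rewrite /g => <-.
by rewrite -!scalerA scale1r.
Qed.

(** Characterises the module coinduced from the simple B-module S_i: [ep] is the counit, the last
    clause is the existence half of the adjunction, and separation gives uniqueness. *)
Definition costd (i : 'I_r) (N : lmodType L) : Prop :=
  exists ep : N -> k, [/\ bfun i ep, forall x, (forall a, ep (a *: x) = 0) -> x = 0
  & forall (M : lmodType L) (b : M -> k), bfun i b ->
    exists2 g : M -> N, linear g & forall x, ep (g x) = b x].

(** The B-linear projection [rho] onto the kernel of [phi] makes f \o rho meaningful on all of [F];
    its composite with [ep] comes from a linear [g], and separation shows that [g] extends [f]. *)
Lemma extends_costd i (F U N : lmodType L) (phi : F -> U) :
  linear phi -> bsplit B phi -> costd i N -> extends phi N.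
Proof.
move=> lphi [s bs sK] [ep [bep sep univ]] f fP.
pose rho x := x - s (phi x).
have rho0 x : phi (rho x) = 0 by rewrite (linB lphi) sK subrr.
have f0 : f 0 = 0.
  apply: (@addrI _ (f 0)); have := fP 1 0 0 (lin0 lphi) (lin0 lphi).
  by rewrite !scale1r !addr0.
have brho : blin B rho.
  by apply: blin_sub; [exact: blin_id | exact: blin_comp (lin_blin lphi) bs].
have [|g lg gE] := univ F (fun x => ep (f (rho x))).
  split=> [c x y|c x Bc].
    have Bc : c%:A \in B by rewrite memvZ.
    by rewrite brho // fP // bep.1.
  rewrite -[c *: x]addr0 brho // fP // (blin0 B1 brho).
  by rewrite f0 addr0 bep.2.
exists g => // x x0; apply/subr0_eq/sep => a.
have rx y : phi y = 0 -> rho y = y by move=> y0; rewrite /rho y0 (blin0 B1 bs) subr0.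
have ax0 : phi (a *: x) = 0 by rewrite (linZ lphi) x0 scaler0.
rewrite scalerBr (kfunB bep.1) -(linZ lg) gE rx //.
by rewrite -[a *: x]addr0 fP ?(lin0 lphi) // f0 addr0 subrr.
Qed.

(** * Duals of standard modules are coinduced *)

Section DualStandard.

Variables (tau tau' : L -> L) (tauP : anti tau) (tauP' : anti tau').
Hypotheses (tauK : cancel tau tau') (tauK' : cancel tau' tau).
Hypotheses (taue : forall i, tau (e i) = e i) (taue' : forall i, tau' (e i) = e i).

(** By directedness only the e_i b e_q with q >= i survive; [tau] moves e_q to the left, where it
    annihilates Delta_i unless q = i. *)
Lemma tau_d i b : b \in B -> tau b *: d i = (chi i b)%:A *: d i.
Proof.
move=> Bb; have h q : tau (e i * b * e q) *: d i = if q == i then (chi i b)%:A *: d i else 0.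
  have [lt_qi|lt_iq|eqi] := ltngtP q i.
  - by rewrite B_tri // (anti0 tauP) scale0r -val_eqE /= ltn_eqF.
  - by rewrite -val_eqE /= gtn_eqF // (antiM tauP) taue -scalerA d_above.
  have -> : q = i by exact: val_inj.
  by rewrite eqxx B_diag // (antiZ tauP) taue kscaleE de.
have -> : tau b *: d i = \sum_q tau (e i * b * e q) *: d i.
  rewrite -scaler_suml -(anti_sum tauP) -mulr_sumr esum mulr1.
  by rewrite (antiM tauP) taue -scalerA de.
by under eq_bigr do rewrite h; rewrite -big_mkcond big_pred1_eq.
Qed.

Lemma ideal_bfun i (M : lmodType L) (b : M -> k) a x : bfun i b ->
  a *: d i = 0 -> b (tau' a *: x) = 0.
Proof.
move=> bb /d_ann; have [kb _] := bb.
have -> : b (tau' a *: x) = b (tau' (a * e i) *: x).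
  by rewrite (antiM tauP') taue' -scalerA (bfun_e _ _ bb) eqxx.
move: (a * e i); apply: ideal_above_ind => [|u v hu hv|m u v im].
- by rewrite (anti0 tauP') scale0r (kfun0 kb).
- by rewrite (antiD tauP') scalerDl (kfunD kb) hu hv addr0.
by rewrite !(antiM tauP') taue' -!scalerA (bfun_above _ _ bb).
Qed.

Definition ev_dual i (xi : kdual (Delta i) tauP) : k := xi (d i).

Lemma bfun_ev i : bfun i (@ev_dual i).
Proof.
split=> [c x y|c x Bc].
  by rewrite /ev_dual -[_ (d i)]/((c%:A *: x) (d i) + y (d i)) dualE (antiC tauP) (kfunZ (dualP x)).
by rewrite /ev_dual dualE tau_d // (kfunZ (dualP x)).
Qed.

Lemma ev_sep i (xi : kdual (Delta i) tauP) : (forall a, ev_dual (a *: xi) = 0) -> xi = 0.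
Proof.
move=> xi0; apply: dual_eq => y; have [a ->] := dP y.
by have := xi0 (tau' a); rewrite /ev_dual dualE tauK' => ->.
Qed.

(** The functional [g x] sends c d_i to b (tau' c x); this does not depend on the choice of c,
    because [b] kills everything passing through an e_m with m > i. *)
Lemma ev_univ i (M : lmodType L) (b : M -> k) : bfun i b ->
  exists2 g : M -> kdual (Delta i) tauP, linear g & forall x, ev_dual (g x) = b x.
Proof.
move=> bb; have [kb _] := bb; have [c cP] := choice (@dP i).
have wd x a a' : a *: d i = a' *: d i -> b (tau' a *: x) = b (tau' a' *: x).
  move=> aa; apply/subr0_eq; rewrite -(kfunB kb) -scalerBl -(antiB tauP').
  by apply: ideal_bfun bb _; rewrite scalerBl aa subrr.
have kg x : kfun (fun y => b (tau' (c y) *: x)).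
  move=> a y z; rewrite -kb -kscaleE -scalerDl; have [tl _ _] := tauP'; rewrite -tl.
  by apply: wd; rewrite scalerDl (kscaleE a (c y)) -!cP.
exists (fun x => Dual tauP (kg x)).
  move=> a x y; apply: dual_eq => z /=.
  rewrite -[RHS]/(b (tau' (c (tau a *: z)) *: x) + b (tau' (c z) *: y)) scalerDr (kfunD kb).
  congr (_ + _); rewrite scalerA -{1}(tauK a) -(antiM tauP').
  by apply: wd; rewrite -scalerA -!cP.
move=> x; by rewrite /ev_dual /= (wd x _ 1) ?(anti1 tauP') ?scale1r // -cP.
Qed.

Lemma costd_dual i : costd i (kdual (Delta i) tauP).
Proof.
by exists (@ev_dual i); split; [exact: bfun_ev | exact: ev_sep | exact: ev_univ].
Qed.

Lemma e_dual i (xi zeta : kdual (Delta i) tauP) : ev_dual xi = 1 ->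
  e i *: zeta = (ev_dual zeta)%:A *: (e i *: xi).
Proof.
move=> xi1; apply: dual_eq => y; have [a ->] := dP y; rewrite !dualE (antiC tauP) taue kscaleC.
rewrite e_d (kfunZ (dualP zeta)) !(kfunZ (dualP xi)) -/(ev_dual _) -/(ev_dual _) xi1.
by rewrite mulr1 mulrC.
Qed.

End DualStandard.

(** * Costandard modules are coinduced, and their duals are standard *)

Section TwoDuals.

Variables (tau tau' : L -> L) (tauP : anti tau) (tauP' : anti tau').
Hypotheses (tauK : cancel tau tau') (tauK' : cancel tau' tau).
Hypotheses (taue : forall i, tau (e i) = e i) (taue' : forall i, tau' (e i) = e i).

(** The dual of [N] is Delta_i, with [ep] as image of the generator. Injectivity is tested with the
    map to [N] from the dual of Delta_i twisted by [tau']; surjectivity holds because the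
    functionals x |-> ep (a x) separate the points of a finite dimensional space. *)
Lemma bproj_dual_costd i (N : lmodType L) : fin_gen N -> costd i N ->
  bproj B (kdual N tauP).
Proof.
move=> /fin_gen_kfg[n0 /kfg_coord[n [c [c' [_ cP]]]]] [ep [bep sep univ]].
have [cK cK' kc] := cP; have [kep _] := bep.
pose E : kdual N tauP := Dual tauP kep.
have [||f lf fE] := @d_map i (kdual N tauP) E.
- by apply: dual_eq => x; rewrite dualE taue /= (bfun_e _ _ bep) eqxx.
- move=> m a im; apply: dual_eq => x; rewrite !dualE taue /=.
  exact: bfun_above bep im.
have finj : injective f.
  apply: (lin_inj lf) => y; have [a ->] := dP y; rewrite fE => aE.
  have [g lg gE] := univ _ _ (bfun_ev tauP' taue' i).
  apply/eqP/negPn/negP => /kfun_exists[b kb b1].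
  have := gE (tau a *: Dual tauP' kb); rewrite (linZ lg) /ev_dual dualE tauK /= b1.
  have := congr1 (fun z : kdual N tauP => z (g (Dual tauP' kb))) aE.
  by rewrite dualE /= => -> /eqP; rewrite eq_sym oner_eq0.
have fsurj : surj f.
  move=> z; pose bs := vbasis {:L}.
  have [M0 M0P] : exists M0 : 'M[k]_(n, \dim {:L}), forall u,
      \row_j ep (bs`_j *: c' u) = u *m M0.
    apply: linear_row_mx => a u v; apply/rowP => j; rewrite !mxE (kcoordV cP).
    by rewrite scalerDr kscaleC kep.
  have /row_freeP[F FE] : row_free M0.
    apply: inj_row_free => u; rewrite -M0P => /rowP u0.
    rewrite -[u]cK' [c' u](_ : _ = 0) ?(kcoord0 cP) //; apply: sep => a.
    rewrite (coord_vbasis (memvf a)) scaler_suml (kfun_sum kep) big1 // => j _.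
    by rewrite kscaleE (kfunZ kep); have := u0 j; rewrite !mxE => ->; rewrite mulr0.
  pose w := F *m (\col_l z (c' (delta_mx 0 l))).
  exists (tau' (\sum_j w j 0 *: bs`_j) *: d i); rewrite fE; apply: dual_eq => x.
  rewrite dualE tauK' /= scaler_suml (kfun_sum kep).
  have -> : \sum_j ep ((w j 0 *: bs`_j) *: x) = (c x *m M0 *m w) 0 0.
    rewrite mxE; apply: eq_bigr => j _; rewrite -M0P [X in _ = X * _]mxE cK.
    by rewrite kscaleE (kfunZ kep) mulrC.
  rewrite /w mulmxA -(mulmxA _ M0) FE mulmx1 mxE.
  have dD : {morph c' : u v / u + v} by move=> u v; have := kcoordV cP 1 u v; rewrite !scale1r.
  rewrite -[in RHS](cK x) [in RHS](row_sum_delta (c x)) (big_morph c' dD (kcoordV0 cP)).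
  rewrite (kfun_sum (dualP z)); apply: eq_bigr => l _.
  by rewrite mxE -[_ *: _ in RHS]addr0 (kcoordV cP) (kcoordV0 cP) addr0 (kfunZ (dualP z)).
have [g gK] := choice fsurj.
have gf : cancel f g by move=> x; apply: finj.
have bg : blin B g by move=> a x y _; apply: finj; rewrite lf !gK.
exact: (bproj_retract bg (lin_blin lf) gK (@bproj_standard i)).
Qed.

(* The given costandard module embeds in the injective envelope of the simple
   module as the largest submodule without higher composition factors; so does
   the dual of the standard module, and the two coincide. *)
Variables (S : 'I_r -> Mod L) (s : forall i, S i).
Hypothesis s_neq0 : forall i, s i != 0.
Hypothesis sZ : forall i a, a *: s i = (chi i a)%:A *: s i.
Hypothesis sP : forall i x, exists a, x = a *: s i.
Hypothesis nfP : forall i (M : lmodType L), no_factor_above S i M <->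
  forall (m : 'I_r), (i < m)%N -> forall x : M, e m *: x = 0.

Lemma costandard_costd i (N : lmodType L) : costandard S i N -> costd i N.
Proof.
case=> /nfP Nabove [I [[injI [io [iio essI]]] [u [iu uP]]]].
have lio := hom_mor io; have lu := hom_mor u.
have Sabove : no_factor_above S i (S i).
  apply/nfP => m im x; have [a ->] := sP x.
  by rewrite sZ kscaleC sZ chie -val_eqE /= ltn_eqF // !scale0r scaler0.
have [f0 f0E] := uP (S i) io iio Sabove; have lf0 := hom_mor f0.
pose t := f0 (s i).
have tZ a : a *: t = (chi i a)%:A *: t by rewrite -(linZ lf0) sZ (linZ lf0).
(* The line of [t] is the socle of [N]: if io (s i) were outside the submodule generated by u x,
   then S_i would embed in the quotient of [I] by it, and essentiality would make the quotient map
   injective. *)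
have ess x : x != 0 -> exists a, a *: x = t.
  move=> nx; pose P (y : I) := exists a, y = a *: u x.
  have sub_P : is_sub P.
    split=> [|a _ _ [b ->] [c ->]]; first by exists 0; rewrite scale0r.
    by exists (a * b + c); rewrite scalerDl scalerA.
  have lq := @quo_pi_lin _ _ _ sub_P.
  have [[a aE]|nP] := pselect (P (io (s i))).
    by exists a; apply: iu; rewrite (linZ lu) -aE f0E.
  have /essI iq : injective (mkhom lq \o io).
    apply: (lin_inj (Mod_comp lio lq)) => y /= /quo_pi0[a aE].
    have [c cE] := sP y; move: aE; rewrite cE sZ; set c0 := chi i c.
    have [->|nc] := eqVneq c0 0; first by rewrite !scale0r.
    rewrite (linZ lio) => aE; case: nP; exists (c0^-1%:A * a).
    by rewrite -scalerA -aE -kscaleA mulVf // !scale1r.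
  case/eqP: nx; apply: iu; apply: iq; rewrite (lin0 lu) /= (lin0 lq).
  by apply/quo_pi0; exists 1; rewrite scale1r.
have nt : t != 0.
  apply: contraNneq (s_neq0 i) => t0; apply/eqP/iio.
  by rewrite (lin0 lio) -f0E -/t t0 (lin0 lu).
have [b0 kb0 b0t] := kfun_exists nt.
pose ep (x : N) := b0 (e i *: x).
have bep : bfun i ep.
  split=> [c x y|c x Bc]; first by rewrite /ep scalerDr kscaleC kb0.
  rewrite /ep {1}[x]e_decomp scaler_sumr scaler_sumr (kfun_sum kb0) (bigD1 i) //=.
  rewrite big1 ?addr0 => [|q nqi].
    by rewrite !scalerA B_diag // kscaleE (kfunZ kb0).
  have [lt_qi|lt_iq|eqi] := ltngtP q i.
  - by rewrite !scalerA B_tri // scale0r (kfun0 kb0).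
  - by rewrite (Nabove q lt_iq x) !scaler0 (kfun0 kb0).
  by rewrite (val_inj eqi) eqxx in nqi.
have sep x : (forall a, ep (a *: x) = 0) -> x = 0.
  move=> x0; apply/eqP/negPn/negP => /ess[a aE].
  have := x0 a; rewrite /ep aE tZ chie eqxx !scale1r b0t => /eqP.
  by rewrite oner_eq0.
pose Fi := kdual (Delta i) tauP; pose ev := @ev_dual tau tauP i.
(* S_i embeds in the dual of Delta_i, and injectivity of [I] extends [io] to that dual. The
   extension [g0] is injective, since every non-zero submodule of the dual meets the image of S_i;
   maximality of [N] then makes it factor through [N]. *)
have [si0 lsi0 si0E] : exists2 sg : S i -> Fi, linear sg & ev (sg (s i)) = 1.
  have [c cP] := choice (@sP i).
  have kaE x : x = (chi i (c x))%:A *: s i by rewrite -sZ -cP.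
  have ka_uni x (a : k) : x = a%:A *: s i -> chi i (c x) = a.
    by rewrite {1}(kaE x); exact: kscale_inj.
  have [|g lg gE] := @ev_univ tau tau' tauP tauP' tauK taue' i (S i) (fun x => chi i (c x)).
    split=> [a x y|a x _]; apply: ka_uni.
      by rewrite kscaleDl kscaleA -!kaE.
    by rewrite kscaleA -kaE {1}(kaE x) kscaleC sZ [LHS]kscaleC -kaE.
  by exists g => //; rewrite /ev gE; apply: ka_uni; rewrite !scale1r.
have iS : injective si0.
  apply: (lin_inj lsi0) => x; have [a ->] := sP x; rewrite sZ (linZ lsi0) => h0.
  have := congr1 ev h0; rewrite /ev (kfunZ (bfun_ev tauP taue i).1) (kfun0 (bfun_ev tauP taue i).1) -/ev si0E.
  by rewrite mulr1 => ->; rewrite !scale0r.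
have [g0 g0E] := injI (S i) (Fi : Mod L) (mkhom lsi0) io iS; have lg0 := hom_mor g0.
have g0s : g0 (e i *: si0 (s i)) = io (s i).
  by rewrite -(linZ lsi0) sZ chie eqxx !scale1r; exact: g0E.
have ig0 : injective g0.
  apply: (lin_inj lg0) => xi xi0; apply: (ev_sep tauK') => a.
  apply/eqP/negPn/negP => na; case/eqP: nt; apply: iu; rewrite (lin0 lu) f0E -g0s.
  have := e_dual taue (a *: xi) si0E => eE.
  have : g0 (e i *: (a *: xi)) = 0 by rewrite !(linZ lg0) xi0 !scaler0.
  rewrite eE (linZ lg0) => z0; apply/eqP/negPn/negP => nz; case/eqP: na.
  exact: kscale_eq0 nz z0.
have [u' u'E] : exists u' : hom (Fi : Mod L) (N : Mod L), forall x, u (u' x) = g0 x.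
  apply: uP ig0 _; apply/nfP => m im x; apply: dual_eq => y; rewrite dualE taue.
  by rewrite d_above // (kfun0 (dualP x)).
have lu' := hom_mor u'.
(* Along u', [ep] pulls back to c times the evaluation with c non-zero; the universal property is
   transported at the cost of the factor 1/c. *)
pose c := ep (u' (si0 (s i))).
have epu xi : ep (u' xi) = ev xi * c.
  have <- : ep (u' (e i *: xi)) = ep (u' xi).
    by rewrite (linZ lu') (bfun_e _ _ bep) eqxx.
  rewrite (e_dual taue xi si0E) (linZ lu') (kfunZ bep.1) (linZ lu') (bfun_e _ _ bep) eqxx.
  by [].
have nc : c != 0.
  apply/eqP => c0; have u0 : u' (si0 (s i)) = 0.
    apply: sep => a; rewrite -(linZ lu') -(linZ lsi0) sZ (linZ lsi0) (linZ lu').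
    by rewrite (kfunZ bep.1) -/c c0 mulr0.
  case/eqP: (s_neq0 i); apply: iS; apply: ig0; rewrite -u'E u0 (lin0 lu).
  by rewrite (lin0 lsi0) (lin0 lg0).
exists ep; split=> // M b bb.
have [g lg gE] := ev_univ tauP tauP' tauK taue' bb.
exists (fun x => c^-1%:A *: u' (g x)) => [a x y|x].
  by rewrite lg (hom_mor u') scalerDr kscaleC.
by rewrite (kfunZ bep.1) epu /ev gE mulrCA mulVf ?mulr1.
Qed.

End TwoDuals.

Lemma bfun_std i j (b : Delta j -> k) a : bfun i b -> b (a *: d j) = chi i a * b (d j).
Proof. by move=> bb; rewrite -d_part bb.2 ?gcomp_mem // chi_part. Qed.

Lemma bfun_scale i (M : lmodType L) (b : M -> k) (c : k) : bfun i b -> bfun i (fun x => c * b x).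
Proof.
move=> [kb bb]; split=> [a x y|a x Ba]; first by rewrite kb mulrDr mulrCA.
by rewrite bb // mulrCA.
Qed.

Lemma e_not_standard i j (b : Delta j -> k) : bfun i b -> b (d j) != 0 -> i = j.
Proof.
move=> bb; rewrite -de (bfun_e _ _ bb).
by have [//|_] := eqVneq i j; rewrite eqxx.
Qed.

(* Modules which are injective relative to the B-split maps out of projective
   modules, and to the maps out of a standard module that are detected by a
   functional on the target.  Both classes of maps are seen by costandard modules. *)
Definition good (N : lmodType L) : Prop :=
  (forall (F U : lmodType L) (phi : F -> U), linear phi -> lproj F -> bsplit B phi ->
     extends phi N) /\
  (forall m (U : lmodType L) (al : Delta m -> U) (b : U -> k),
     linear al -> bproj B U -> bfun m b -> b (al (d m)) != 0 ->
     forall f : Delta m -> N, linear f ->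
     exists2 g : U -> N, linear g & forall y, g (al y) = f y).

Lemma good_zero (N : lmodType L) : (forall x : N, x = 0) -> good N.
Proof.
move=> N0; split=> [F U phi _ _ _|m U al b _ _ _ _ f _]; first exact: extends_zero.
by exists (fun=> 0) => [a x y|y]; rewrite ?scaler0 ?addr0 // [f y]N0.
Qed.

Lemma good_retract (M N : lmodType L) (i : M -> N) (p : N -> M) :
  linear i -> linear p -> cancel i p -> good N -> good M.
Proof.
move=> li lp ip [eN dN]; split=> [F U phi lphi pF sphi|m U al b lal pU bb nb f lf].
  exact: extends_retract li lp ip (eN _ _ _ lphi pF sphi).
have [g lg gE] := dN m U al b lal pU bb nb (i \o f) (Mod_comp lf li).
by exists (p \o g) => [|y /=]; [exact: Mod_comp | rewrite gE /= ip].
Qed.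

(** For the second property, the map obtained in [Z] is lifted to [Y] along a free cover of [U],
    which is B-split because [U] is projective over [B]; the remaining error is a map to [X]. *)
Lemma good_ext (X Y Z : lmodType L) (i : X -> Y) (p : Y -> Z) :
  linear i -> linear p -> injective i -> surj p ->
  (forall y, p y = 0 <-> exists x, y = i x) -> good X -> good Z -> good Y.
Proof.
move=> li lp ii sp ip [eX dX] [eZ dZ].
split=> [F U phi lphi pF sphi|m U al b lal pU bb nb f lf].
  by apply: (extends_ext lphi pF li lp) => //; [exact: eX | exact: eZ].
have [g lg gE] := dZ m U al b lal pU bb nb (p \o f) (Mod_comp lf lp).
have lc := @free_cover_lin _ L U; have sc := @free_cover_surj _ L U.
have pc := @lproj_free _ L U.
have [g1 lg1 g1E] := extends_lift lc pc li lp ii sp ip sc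
  (eX _ _ _ lc pc (bproj_bsplit lc sc pU)) lg.
have ex y : exists x, i x = f y - g1 (al y).
  have [|x xE] := (ip (f y - g1 (al y))).1; last by exists x.
  by rewrite (linB lp) g1E gE subrr.
have [c cP] := choice ex.
have lc' : linear c.
  by move=> a x y; apply: ii; rewrite li !cP lf lal lg1 scalerBr opprD addrACA.
have [g2 lg2 g2E] := dX m U al b lal pU bb nb c lc'.
exists (fun x => i (g2 x) + g1 x) => [a x y|y].
  by rewrite lg2 li lg1 scalerDr addrACA.
by rewrite g2E cP subrK.
Qed.

(** Maps to [N] amount to functionals, and on Delta_m a functional is determined by its value on the
    generator. A non-zero value forces i = m, and then a multiple of [b] has the prescribed
    restriction. *)
Lemma good_costd i (N : lmodType L) : costd i N -> good N.
Proof.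
move=> cN; split=> [F U phi lphi pF sphi|m U al b lal pU bb nb f lf].
  exact: extends_costd cN.
have [ep [bep sep univ]] := cN.
have bf := bfun_comp (lin_blin lf) bep : bfun i (ep \o f).
have [fd0|nfd] := eqVneq (ep (f (d m))) 0.
  exists (fun=> 0) => [a x y|y]; first by rewrite scaler0 addr0.
  apply/esym/sep => a; rewrite -(linZ lf); have [c ->] := dP y.
  by rewrite scalerA; have := bfun_std (a * c) bf; rewrite /= fd0 mulr0.
have eim : i = m := e_not_standard bf nfd.
move: al b lal bb nb f lf bf nfd; rewrite -eim {eim} => al b lal bb nb f lf bf nfd.
have bal := bfun_comp (lin_blin lal) bb.
have [g lg gE] := univ U _ (bfun_scale (ep (f (d i)) / b (al (d i))) bb).
exists g => // y; apply/subr0_eq/sep => a.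
rewrite scalerBr (kfunB bep.1) -(linZ lg) gE -(linZ lf) -(linZ lal).
have [c ->] := dP y; rewrite scalerA.
have := bfun_std (a * c) bf; have := bfun_std (a * c) bal; rewrite /= => -> ->.
by rewrite mulrCA mulfVK // subrr.
Qed.

Lemma good_sum (I : finType) (T : I -> lmodType L) (X : lmodType L) :
  direct_sum (C := Mod L) T X -> (forall i, good (T i)) -> good X.
Proof.
move=> [inj [pr [K1 K2 K3]]] gT; have li i := hom_mor (inj i); have lp i := hom_mor (pr i).
split=> [F U phi lphi pF sphi f fP|m U al b lal pU bb nb f lf].
  have ex i : exists g : F -> T i, linear g /\ forall x, phi x = 0 -> g x = pr i (f x).
    have [|g lg gE] := (gT i).1 F U phi lphi pF sphi (pr i \o f); last by exists g.
    by move=> a x y x0 y0 /=; rewrite fP // lp.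
  have [g gP] := dep_choice ex; exists (fun x => \sum_i inj i (g i x)) => [a x y|x x0].
    rewrite scaler_sumr -big_split; apply: eq_bigr => i _.
    by rewrite (gP i).1 li.
  by rewrite -[RHS]K3; apply: eq_bigr => i _; rewrite (gP i).2.
have ex i : exists g : U -> T i, linear g /\ forall x, g (al x) = pr i (f x).
  have [g lg gE] := (gT i).2 m U al b lal pU bb nb (pr i \o f) (Mod_comp lf (lp i)).
  by exists g.
have [g gP] := dep_choice ex; exists (fun x => \sum_i inj i (g i x)) => [a x y|x].
  rewrite scaler_sumr -big_split; apply: eq_bigr => i _.
  by rewrite (gP i).1 li.
by rewrite -[RHS]K3; apply: eq_bigr => i _; rewrite (gP i).2.
Qed.

Lemma bproj_sum (I : finType) (T : I -> lmodType L) (X : lmodType L) :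
  direct_sum (C := Mod L) T X -> (forall i, bproj B (T i)) -> bproj B X.
Proof.
move=> [inj [pr [K1 K2 K3]]] gT X' Y q f lq bf fq.
have li i := hom_mor (inj i); have lp i := hom_mor (pr i).
have ex i : exists g : T i -> X', blin B g /\ forall x, q (g x) = f (inj i x).
  have [||g lg gE] := gT i X' Y q (f \o inj i) lq; last by exists g.
    exact: blin_comp (lin_blin (li i)) bf.
  by move=> x; exact: fq.
have [g gP] := dep_choice ex; exists (fun x => \sum_i g i (pr i x)) => [b x y Bb|x].
  rewrite scaler_sumr -big_split; apply: eq_bigr => i _.
  by rewrite lp (gP i).1.
rewrite (lin_sum lq) -[in RHS](K3 x) (blin_sum B1 bf); apply: eq_bigr => i _.
by rewrite (gP i).2.
Qed.

Section FilteredDual.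

Variables (tau : L -> L) (tauP : anti tau) (P : lmodType L -> Prop).
Hypothesis P0 : forall N : lmodType L, (forall x : N, x = 0) -> P N.
Hypothesis Pr : forall (M N : lmodType L) (i : M -> N) (p : N -> M),
  linear i -> linear p -> cancel i p -> P N -> P M.
Hypothesis Pe : forall (X Y Z : lmodType L) (i : X -> Y) (p : Y -> Z),
  linear i -> linear p -> injective i -> surj p ->
  (forall y, p y = 0 <-> exists x, y = i x) -> P X -> P Z -> P Y.

Lemma closed_filtered (I : Type) (Fa : I -> lmodType L) (N : lmodType L) :
  (forall a, P (Fa a)) -> filtered (C := Mod L) Fa N -> P N.
Proof.
move=> PF; elim=> [X X0|a X Y Z i p _ PX [f [g [fK gK]]] [ii sp ip]]; first exact: P0.
apply: (Pe (hom_mor i) (hom_mor p) ii sp ip PX).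
exact: Pr (hom_mor f) (hom_mor g) fK (PF a).
Qed.

Lemma dual_filtered (I : Type) (Fa : I -> lmodType L) (N : lmodType L) :
  (forall a, P (kdual (Fa a) tauP)) -> filtered (C := Mod L) Fa N -> P (kdual N tauP).
Proof.
move=> PF; elim=> [X X0|a X Y Z i p _ PX [f [g [fK gK]]] [ii sp ip]].
  by apply: P0 => b; apply: dual_eq => x; rewrite [x]X0 !(kfun0 (dualP _)).
have [li lp] := (hom_mor i, hom_mor p).
apply: (Pe (dual_map_lin (tauP := tauP) lp) (dual_map_lin (tauP := tauP) li)) PX.
- exact: dual_map_inj.
- exact: dual_map_surj li lp ii sp ip.
- by move=> b; exact: dual_map_exact.
apply: Pr (dual_map_lin (tauP := tauP) (hom_mor g)) (dual_map_lin (tauP := tauP) (hom_mor f)) _ (PF a).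
by move=> b; apply: dual_eq => x /=; rewrite fK.
Qed.

End FilteredDual.

Section BFunPart.

Hypothesis B_homog : forall l b, b \in D 0%N -> gcomp G l b \in D 0%N.
Hypothesis chi_0 : forall i a, chi i (gcomp G 0 a) = chi i a.
Hypothesis chi_pos : forall i l a, (0 < l)%N -> a \in G l -> chi i a = 0.

(** [B] is homogeneous for the original grading and chi_i vanishes in positive degree, so only the
    degree 0 part of [c] contributes. *)
Lemma bfun_part i (M : gmod G) (b : M -> k) w : bfun i b -> bfun i (fun x => b (gm_pr w x)).
Proof.
move=> [kb bb]; split=> [c x y|c x Bc]; first by rewrite gm_prD gprZk kb.
have h l : b (gm_pr w (gcomp G l c *: x)) = chi i (gcomp G l c) * b (gm_pr (w - l%:Z) x).
  have {1}-> : w = l%:Z + (w - l%:Z) by rewrite addrC subrK.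
  by rewrite (gprZ _ _ (gcomp_mem G l c)) bb // B_homog.
rewrite {1}(gcomp_sum G c) scaler_suml gpr_sum (kfun_sum kb) big_ord_recl h chi_0 subr0.
by rewrite big1 ?addr0 // => l _; rewrite h (chi_pos _ _ (gcomp_mem G _ c)) ?mul0r.
Qed.

End BFunPart.

Section DualGraded.

Variables (tau : L -> L) (tauP : anti tau).
Hypothesis tauG : forall n a, a \in G n -> tau a \in G n.
Variables (M : gmod G) (fM : fin_gen M).

Fact dual_pr_fun (i : int) (b : kdual M tauP) : kfun (fun x => b (gm_pr (- i) x)).
Proof. by move=> c x y; rewrite gm_prD gprZk (dualP b). Qed.

(** The sign is forced: [a] acts on the argument of a functional through [tau a], which raises
    degrees there. *)
Definition dual_pr i (b : kdual M tauP) : kdual M tauP := Dual tauP (dual_pr_fun i b).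

Fact dual_prD i b c : dual_pr i (b + c) = dual_pr i b + dual_pr i c.
Proof. exact: dual_eq. Qed.

Fact dual_pr_orth i j b :
  dual_pr i (dual_pr j b) = if i == j then dual_pr j b else 0.
Proof.
apply: dual_eq => x /=; rewrite gm_pr_orth eqr_opp eq_sym.
by case: eqP => [->//|_]; rewrite (kfun0 (dualP b)).
Qed.

Fact dual_pr_sum b : exists2 s : seq int, uniq s & b = \sum_(i <- s) dual_pr i b.
Proof.
have [s us sP] := fin_gen_bounded fM.
exists [seq - i | i <- s]; first by rewrite map_inj_uniq //; exact: oppr_inj.
apply: dual_eq => x; rewrite big_map.
have [ev evE] : exists ev : kdual M tauP -> k, (forall c, ev c = c x) by exists (fun c => c x).
rewrite -!evE (big_morph ev (_ : {morph ev : u v / u + v}) (_ : ev 0 = 0)) ?evE //; last first.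
  by move=> u v; rewrite !evE.
rewrite {1}(gpr_fsum x) (fsumE us) ?(kfun_sum (dualP b)) => [|i ni]; last exact: sP.
by apply: eq_bigr => i _; rewrite evE /= opprK.
Qed.

Fact dual_pr_scale (n : nat) (a : L) (i : int) b : a \in G n ->
  dual_pr (n%:Z + i) (a *: dual_pr i b) = a *: dual_pr i b.
Proof.
move=> /tauG Ga; apply: dual_eq => x.
rewrite -[LHS]/(b (gm_pr (- i) (tau a *: gm_pr (- (n%:Z + i)) x))).
rewrite -[RHS]/(b (gm_pr (- i) (tau a *: x))).
have -> : - i = n%:Z + - (n%:Z + i) by rewrite opprD addNKr.
by rewrite !(gprZ _ _ Ga) gpr_idem.
Qed.

Definition dual_gmod : gmod G := Gmod dual_prD dual_pr_orth dual_pr_sum dual_pr_scale.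

End DualGraded.

Lemma add_closed (P : lmodType L -> Prop) (T X : lmodType L) :
  (forall (M N : lmodType L) (i : M -> N) (p : N -> M),
     linear i -> linear p -> cancel i p -> P N -> P M) ->
  (forall (I : finType) (U : I -> lmodType L) (N : lmodType L),
     direct_sum (C := Mod L) U N -> (forall i, P (U i)) -> P N) ->
  P T -> add_closure (C := Mod L) T X -> P X.
Proof.
move=> Pr Ps PT [n [Y [dY [i [p ip]]]]].
by apply: Pr (hom_mor i) (hom_mor p) ip _; exact: Ps dY (fun=> PT).
Qed.

Lemma fin_gen_retract (M N : lmodType L) (i : M -> N) (p : N -> M) :
  linear i -> linear p -> cancel i p -> fin_gen N -> fin_gen M.
Proof.
move=> li lp ip [n [g gP]]; exists n, (fun j => p (g j)) => x.
have [a aE] := gP (i x); exists a; rewrite -(ip x) aE (lin_sum lp).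
by apply: eq_bigr => j _; rewrite (linZ lp).
Qed.

Lemma kfg_fin_gen (M : lmodType L) n : kfg M n -> fin_gen M.
Proof.
by case=> t st; exists n, t => x; have [v ->] := st x; exists (fun i => (v i)%:A).
Qed.

Lemma fin_gen_sum (I : finType) (T : I -> lmodType L) (X : lmodType L) :
  direct_sum (C := Mod L) T X -> (forall i, fin_gen (T i)) -> fin_gen X.
Proof.
move=> [inj [pr [K1 K2 K3]]] fT.
have [n nP] := dep_choice (fun i => fin_gen_kfg (fT i)); have [t tP] := dep_choice nP.
apply: (@kfg_fin_gen _ #|{: {i : I & 'I_(n i)}}|).
apply: (@kspan_kfg _ _ _ _ (fun u : {i : I & 'I_(n i)} => inj (tag u) (t (tag u) (tagged u)))).
move=> x; have [v vP] := dep_choice (fun i => tP i (pr i x)).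
exists (fun u => v (tag u) (tagged u)).
rewrite -{1}(K3 x) -(sig_big_dep (fun i => true) (fun i _ => true)
  (fun i (j : 'I_(n i)) => (v i j)%:A *: inj i (t i j))) /=.
apply: eq_bigr => i _; rewrite {1}(vP i) (lin_sum (hom_mor (inj i))).
by apply: eq_bigr => j _; rewrite (linZ (hom_mor (inj i))).
Qed.

(* Krull-Schmidt, in the weak form of an induction principle. *)
Lemma indecomposable_ind (P : gmod G -> Prop) (Q : gmod G) : fin_gen Q ->
  (forall X : gmod G, (forall x : X, x = 0) -> P X) ->
  (forall (Y : bool -> gmod G) (X : gmod G),
     direct_sum (C := Gr G) Y X -> (forall b, P (Y b)) -> P X) ->
  (forall X : gmod G, indecomposable (C := Gr G) X -> summand (C := Gr G) X Q -> P X) ->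
  P Q.
Proof.
move=> fQ P0 Ps Pi.
have main n : forall X : gmod G, kfg X n -> summand (C := Gr G) X Q -> P X.
  have [m] := ubnP n; elim: m n => // m IH n lt_n X kX sX.
  have [/P0//|nX] := pselect (forall x : X, x = 0).
  have [indX|nind] := pselect (indecomposable (C := Gr G) X); first exact: Pi.
  have [Y dY nY] : exists2 Y : bool -> gmod G, direct_sum (C := Gr G) Y X &
      forall b, exists y : Y b, y != 0.
    apply: contrapT => nex; apply: nind; split=> // Y dY.
    apply: contrapT => nz; apply: nex; exists Y => // b.
    apply: contrapT => ny; apply: nz; exists b => y; apply/eqP/negPn/negP => ny'.
    by apply: ny; exists y.
  have [inj [pr [K1 K2 K3]]] := dY.
  have [li lp] : (forall b, linear (inj b)) /\ (forall b, linear (pr b)).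
    by split=> b; [exact: (mor_linear (hom_mor (inj b))) | exact: (mor_linear (hom_mor (pr b)))].
  apply: Ps dY _ => b; have [q lt_q kq] : exists2 q, (q < n)%N & kfg (Y b) q.
    apply: (summand_kfg (li b) (lp b) (li (~~ b)) (lp (~~ b)) (K1 b) (K1 _)) (nY (~~ b)) kX.
    by move=> y; apply: K2; case: b {y}.
  apply: (IH q) => //; first by rewrite (leq_trans lt_q).
  have [i [p ip]] := sX.
  exists (Hom (mor_comp (hom_mor (inj b)) (hom_mor i))), (Hom (mor_comp (hom_mor p) (hom_mor (pr b)))).
  by move=> y /=; rewrite ip K1.
have [n kQ] := fin_gen_kfg fQ; apply: main kQ _.
by exists (Hom (mor_id (Q : Gr G))), (Hom (mor_id (Q : Gr G))).
Qed.

(** * Tilting modules: self-duality, degrees of tops and socles *)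

Section Tilting.

Hypothesis B_homog : forall l b, b \in D 0%N -> gcomp G l b \in D 0%N.
Hypothesis chi_0 : forall i a, chi i (gcomp G 0 a) = chi i a.
Hypothesis chi_pos : forall i l a, (0 < l)%N -> a \in G l -> chi i a = 0.
Hypothesis d_deg : forall j, gm_pr 0 (d j) = d j.
Variables (tau tau' : L -> L) (tauP : anti tau) (tauP' : anti tau').
Hypotheses (tauK : cancel tau tau') (tauK' : cancel tau' tau).
Hypotheses (taue : forall i, tau (e i) = e i) (taue' : forall i, tau' (e i) = e i).
Hypothesis tauG : forall n a, a \in G n -> tau a \in G n.
Variables (T Nabla : 'I_r -> gmod G) (Tc : lmodType L) (h : 'I_r -> nat).
Hypothesis Tind : forall i, indecomposable (C := Mod L) (gm_mod (T i)).
Hypothesis Tsum : direct_sum (C := Mod L) (fun i => gm_mod (T i)) Tc.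
Hypothesis Tfg : fin_gen Tc.
Hypothesis TD : filtered (C := Mod L) (fun i => gm_mod (Delta i)) Tc.
Hypothesis TN : filtered (C := Mod L) (fun i => gm_mod (Nabla i)) Tc.
Hypothesis Nc : forall i, costd i (Nabla i).
Hypothesis Tlift : forall j, exists (i : hom (Delta j : Gr G) (T j : Gr G))
  (p : hom (T j : Gr G) (Nabla j : Gr G)),
  [/\ injective i, surj p & exists x, p (i x) != 0].
Hypothesis Hh2 : H2 h Delta T Tc.

Lemma T_retract m : exists (i : T m -> Tc) (p : Tc -> T m), [/\ linear i, linear p & cancel i p].
Proof.
case: Tsum => [inj [pr [K1 _ _]]]; exists (inj m), (pr m).
by split; [exact: (hom_mor (inj m)) | exact: (hom_mor (pr m)) | exact: K1].
Qed.

Lemma T_fg m : fin_gen (T m).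
Proof. by have [i [p [li lp ip]]] := T_retract m; exact: fin_gen_retract li lp ip Tfg. Qed.

Lemma Nabla_fg m : fin_gen (Nabla m).
Proof.
have [_ [p [_ sp _]]] := Tlift m; have [n [g gP]] := T_fg m.
exists n, (fun j => p (g j)) => y; have [x <-] := sp y; have [a ->] := gP x.
have lp := mor_linear (hom_mor p).
by exists a; rewrite (lin_sum lp); apply: eq_bigr => j _; rewrite (linZ lp).
Qed.

Lemma Tc_good : good Tc.
Proof. exact: (closed_filtered good_zero good_retract good_ext (fun i => good_costd (Nc i)) TN). Qed.

Lemma Tc_bproj : bproj B Tc.
Proof. exact: (bproj_filtered B1 bproj_standard TD). Qed.

Lemma T_good m : good (T m).
Proof. by have [i [p [li lp ip]]] := T_retract m; exact: good_retract li lp ip Tc_good. Qed.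

Lemma T_bproj m : bproj B (T m).
Proof.
have [i [p [li lp ip]]] := T_retract m.
exact: (bproj_retract (lin_blin li) (lin_blin lp) ip Tc_bproj).
Qed.

Let bproj_lin_retract (M N : lmodType L) (i : M -> N) (p : N -> M) :
  linear i -> linear p -> cancel i p -> bproj B N -> bproj B M.
Proof. by move=> li lp; apply: bproj_retract; exact: lin_blin. Qed.

Lemma dual_T_retract (P : lmodType L -> Prop) m :
  (forall (M N : lmodType L) (i : M -> N) (p : N -> M),
     linear i -> linear p -> cancel i p -> P N -> P M) ->
  P (kdual Tc tauP) -> P (kdual (T m) tauP).
Proof.
have [i [p [li lp ip]]] := T_retract m => Pr; apply: Pr (dual_map_lin lp) (dual_map_lin li) _.
by move=> b; apply: dual_eq => x /=; rewrite ip.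
Qed.

Lemma dual_T_good m : good (kdual (T m) tauP).
Proof.
apply: dual_T_retract good_retract _.
apply: (dual_filtered good_zero good_retract good_ext) TD => i.
exact: good_costd (costd_dual tauP tauP' tauK tauK' taue taue' i).
Qed.

Lemma dual_T_bproj m : bproj B (kdual (T m) tauP).
Proof.
apply: dual_T_retract bproj_lin_retract _.
apply: (dual_filtered (bproj_zero B1) bproj_lin_retract (bproj_ext B1)) TN => i.
exact: (@bproj_dual_costd _ _ tauP tauP' tauK tauK' taue taue' i (Nabla i) (@Nabla_fg i) (Nc i)).
Qed.

(** The functional is the counit of nabla_m on the degree 0 part of T_m. If it vanished on the
    generator, separation would make the composite Delta_m -> nabla_m zero. *)
Lemma T_data m : exists (al : Delta m -> T m) (b : T m -> k),
  [/\ graded_mor al, bfun m b, forall x, b (gm_pr 0 x) = b x & b (al (d m)) != 0].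
Proof.
have [al [p [_ _ [x nx]]]] := Tlift m; have [ep [bep sep _]] := Nc m.
have [lal dal] := hom_mor al; have [lp dp] := hom_mor p.
have bb : bfun m (fun y => ep (p y)) by apply: bfun_comp bep; exact: lin_blin.
exists al, (fun y => ep (p (gm_pr 0 y))); split=> //.
- exact: bfun_part bb.
- by move=> y; rewrite gpr_idem.
rewrite -dal d_deg; apply: contra nx => /eqP e0.
have [a ->] := dP x; apply/eqP/sep => c; rewrite -(linZ lp) -(linZ lal) scalerA.
have := bfun_std (c * a) (bfun_comp (lin_blin lal) bb).
by rewrite /= e0 mulr0.
Qed.

Lemma al_neq0 m (M : lmodType L) (b : M -> k) x : bfun m b -> b x != 0 -> x != 0.
Proof. by move=> [kb _]; apply: contraNneq => ->; rewrite (kfun0 kb). Qed.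

(** Delta_m also maps to the dual of T_m: the generator goes to the functional of [T_data], and
    evaluation at its image in T_m detects it. Both targets are [good] and projective over [B], so
    each map extends along the other; the composite fixes the image of the generator, and Fitting's
    lemma applies. *)
Lemma T_self_dual m : exists2 phi : T m -> dual_gmod tauP tauG (T_fg m),
  graded_mor phi & injective phi.
Proof.
have [al [b [gal bb b0 nb]]] := T_data m; have [lal _] := gal; have [kb _] := bb.
pose xi : kdual (T m) tauP := Dual tauP kb.
have [||al' lal' al'E] := @d_map m (kdual (T m) tauP) xi.
- by apply: dual_eq => x; rewrite dualE taue /= (bfun_e _ _ bb) eqxx.
- move=> q a mq; apply: dual_eq => x; rewrite !dualE taue /=.
  exact: bfun_above bb mq.
have al'd : al' (d m) = xi by rewrite -[d m]scale1r al'E scale1r.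
have gal' : @graded_mor _ _ _ (Delta m) (dual_gmod tauP tauG (T_fg m)) al'.
  split=> // i x; have [a ->] := dP x; rewrite (gcomp_sum G a) !scaler_suml gpr_sum.
  rewrite !(lin_sum lal') (gpr_sum (M := dual_gmod tauP tauG (T_fg m))).
  apply: eq_bigr => n _; set c := gcomp G n a.
  have Gc : c \in G n by exact: gcomp_mem.
  have cd : gm_pr n%:Z (c *: d m) = c *: d m.
    by have := in_degreeZ Gc (d_deg m); rewrite addr0.
  have cxi : gm_pr (g := dual_gmod tauP tauG (T_fg m)) n%:Z (c *: xi) = c *: xi.
    have := @in_degreeZ _ _ _ (dual_gmod tauP tauG (T_fg m)) _ _ 0 xi Gc; rewrite addr0; apply.
    by apply: dual_eq => x'; rewrite /= oppr0 b0.
  rewrite al'E -cxi -cd !gm_pr_orth; case: eqP => _; last exact: (lin0 lal').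
  by rewrite cd cxi al'E.
pose ze (y : kdual (T m) tauP) : k := y (al (d m)).
have bze : bfun m ze.
  exact: bfun_comp (lin_blin (dual_map_lin lal)) (bfun_ev tauP taue m).
have nze : ze (al' (d m)) != 0 by rewrite al'd.
have [phi lphi phiE] := (dual_T_good m).2 m (T m) al b lal (@T_bproj m) bb nb al' lal'.
have [psi lpsi psiE] := (T_good m).2 m _ al' ze lal' (@dual_T_bproj m) bze nze al lal.
have [p0 [gp0 p0E _]] := graded_part_comp (N := dual_gmod tauP tauG (T_fg m)) lphi.
have [q0 [gq0 q0E _]] := graded_part_comp (M := dual_gmod tauP tauG (T_fg m)) lpsi.
exists p0 => //.
have /bij_inj : bijective (q0 \o p0).
  apply: (fitting (T_fg m) (Tind m) (Mod_comp gp0.1 gq0.1) (x0 := al (d m))).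
    by rewrite /= (p0E _ _ _ gal gal' phiE) (q0E _ _ _ gal' gal psiE).
  exact: al_neq0 bb nb.
by move=> inj x y xy; apply: inj; rewrite /= xy.
Qed.

Lemma closure_good (X : lmodType L) : add_closure (C := Mod L) Tc X -> good X.
Proof. exact: (add_closed good_retract good_sum Tc_good). Qed.

Lemma closure_bproj (X : lmodType L) : add_closure (C := Mod L) Tc X -> bproj B X.
Proof. exact: (add_closed bproj_lin_retract bproj_sum Tc_bproj). Qed.

Lemma closure_fg (X : lmodType L) : add_closure (C := Mod L) Tc X -> fin_gen X.
Proof. exact: (add_closed fin_gen_retract fin_gen_sum Tfg). Qed.

(** Controls the degrees of B-linear maps from [X] to S_i, equivalently of maps from [X] to
    nabla_i. *)
Definition top_degree (t : int) (X : gmod G) : Prop := forall i w (b : X -> k),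
  bfun i b -> (forall j x, j != w -> b (gm_pr j x) = 0) -> (exists x, b x != 0) ->
  w = (h i)%:Z - t.

(** Controls the degrees of maps Delta_i -> X; such a map is given by the image [x] of the
    generator. *)
Definition socle_degree (t : int) (X : gmod G) : Prop := forall i w (x : X),
  e i *: x = x -> (forall (p : 'I_r) a, (i < p)%N -> e p *: (a *: x) = 0) ->
  gm_pr w x = x -> x != 0 -> w = t - (h i)%:Z.

Lemma top_degree_zero t (X : gmod G) : (forall x : X, x = 0) -> top_degree t X.
Proof. by move=> X0 i w b [kb _] _ [x]; rewrite [x]X0 (kfun0 kb) eqxx. Qed.

Lemma socle_degree_zero t (X : gmod G) : (forall x : X, x = 0) -> socle_degree t X.
Proof. by move=> X0 i w x _ _ _; rewrite [x]X0 eqxx. Qed.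

Lemma top_degree_sum t (Y : bool -> gmod G) (X : gmod G) : direct_sum (C := Gr G) Y X ->
  (forall c, top_degree t (Y c)) -> top_degree t X.
Proof.
move=> [inj [pr [_ _ K3]]] dY i w b bb bw [x nx].
have [c nc] : exists c, b (inj c (pr c x)) != 0.
  apply: contrapT => nex; case/eqP: nx; rewrite -(K3 x) (kfun_sum bb.1) big1 // => c _.
  by apply/eqP/negPn/negP => nc; apply: nex; exists c.
have [lc dc] := hom_mor (inj c); apply: (dY c i w (b \o inj c)).
- exact: bfun_comp (lin_blin lc) bb.
- by move=> j y nj /=; rewrite dc bw.
by exists (pr c x).
Qed.

Lemma socle_degree_sum t (Y : bool -> gmod G) (X : gmod G) : direct_sum (C := Gr G) Y X ->
  (forall c, socle_degree t (Y c)) -> socle_degree t X.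
Proof.
move=> [inj [pr [_ _ K3]]] dY i w x ex xp xw nx.
have [c nc] : exists c, pr c x != 0.
  apply: contrapT => nex; case/eqP: nx; rewrite -(K3 x) big1 // => c _.
  rewrite -[RHS](lin0 (mor_linear (hom_mor (inj c)))); congr (inj c _).
  by apply/eqP/negPn/negP => nc; apply: nex; exists c.
have [lc dc] := hom_mor (pr c); apply: (dY c i w (pr c x)) => // [|p a ip|].
- by rewrite -(linZ lc) ex.
- by rewrite -!(linZ lc) xp // (lin0 lc).
by rewrite -dc xw.
Qed.

(** Degree w in [X] is degree w + u in T_q. As the parameter enters the two degree conditions with
    opposite signs, it becomes h(q) + u for tops and h(q) - u for socles. *)
Lemma top_degree_shift q (u : int) (X : gmod G) :
  isomorphic (X : Gr G) (shift (T q) (- u)) -> top_degree (h q) (T q) ->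
  top_degree ((h q)%:Z + u) X.
Proof.
move=> [f [g [fK gK]]] dq i w b bb bw [x nx]; have [lg dg] := hom_mor g.
have : w + u = (h i)%:Z - (h q)%:Z; last by lia.
apply: (dq i (w + u) (fun y => b (g y))).
- exact: bfun_comp (lin_blin lg) bb.
- move=> j y nj; have -> : g (gm_pr j y) = gm_pr (j - u) (g y).
    by have := dg (j - u) y; rewrite /= /shift_pr opprK subrK.
  by rewrite bw //; apply: contra nj => /eqP <-; rewrite subrK.
by exists (f x); rewrite fK.
Qed.

Lemma socle_degree_shift q (u : int) (X : gmod G) :
  isomorphic (X : Gr G) (shift (T q) (- u)) -> socle_degree (h q) (T q) ->
  socle_degree ((h q)%:Z - u) X.
Proof.
move=> [f [g [fK gK]]] dq i w x ex xp xw nx; have [lf df] := hom_mor f.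
have : w + u = (h q)%:Z - (h i)%:Z; last by lia.
apply: (dq i (w + u) (f x)).
- by rewrite -(linZ lf) ex.
- by move=> p a ip; rewrite -!(linZ lf) xp // (lin0 lf).
- by have := df w x; rewrite /= /shift_pr opprK xw.
by apply: contraNneq nx => fx0; rewrite -(fK x) fx0 (lin0 (mor_linear (hom_mor g))).
Qed.

(* By induction along the coresolution of the standard module: a functional on
   T_m is either seen on Delta_m, or comes from the next term. *)
Lemma T_top_degree m : top_degree (h m) (T m).
Proof.
have [n] := ubnP (h m); elim: n m => // n IH m lt_m.
have [N [Q [eta [dd [[[ie e0 ed] _ _] addQ Q0 dec]]]]] := Hh2 m.
have [leta deta] := hom_mor eta.
have ldd u : linear (dd u) := mor_linear (hom_mor (dd u)).
have [[rho brho rhoK] sp] := coresolution_bsplit B1 leta ldd ie e0 ed Q0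
  (fun u => @closure_bproj _ (addQ u)).
have [al [b0 [gal bb0 b00 nb0]]] := T_data m; have [lal dal] := gal.
have [c0 [bc0 nc0]] : exists c : Delta m -> k, bfun m c /\ c (d m) != 0.
  by exists (b0 \o al); split=> //; exact: bfun_comp (lin_blin lal) bb0.
(* T_m is a summand of the first term: maps in both directions compatible with Delta_m compose to
   one fixing the image of the generator. Hence [b] can be studied on Q 0. *)
have [th lth thE] : exists2 th : Q 0%N -> T m, linear th & forall y, th (eta y) = al y.
  apply: (T_good m).2 (bfun_comp brho bc0) _ _ lal => //.
  - exact: (@closure_bproj _ (addQ 0%N)).
  - by rewrite /= rhoK.
have [ch lch chE] : exists2 ch : T m -> Q 0%N, linear ch & forall y, ch (al y) = eta y.
  exact: (closure_good (addQ 0%N)).2 lal (@T_bproj m) bb0 nb0 _ leta.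
have [t0 [gt0 t0E _]] := graded_part_comp lth.
have [s0 [gs0 s0E _]] := graded_part_comp lch.
have bij : bijective (t0 \o s0).
  apply: (fitting (T_fg m) (Tind m) (Mod_comp gs0.1 gt0.1) (x0 := al (d m))).
    by rewrite /= (s0E _ _ _ gal (hom_mor eta) chE) (t0E _ _ _ (hom_mor eta) gal thE).
  exact: al_neq0 bb0 nb0.
move=> i w b bb bw [x nx].
have [y yE] : exists y, t0 y = x by have [g _ gK] := bij; exists (s0 (g x)); exact: gK.
pose b1 z := b (t0 z).
have bb1 : bfun i b1 by exact: bfun_comp (lin_blin gt0.1) bb.
have b1w j z : j != w -> b1 (gm_pr j z) = 0 by move=> nj; rewrite /b1 gt0.2 bw.
have b1E z : b1 (gm_pr w z) = b1 z.
  apply: esym; move: z; apply: (@gm_eq _ _ _ (Q 0%N) _ b1 (fun z => b1 (gm_pr w z))).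
  - by move=> u v; rewrite (kfunD bb1.1).
  - by move=> u v; rewrite gm_prD (kfunD bb1.1).
  move=> j u uj; have [<-|nj] := eqVneq j w; first by rewrite uj.
  by rewrite -{1}uj b1w // (gpr_other uj) ?(kfun0 bb1.1) // eq_sym.
pose y0 := gm_pr w y; have ny0 : b1 y0 != 0 by rewrite b1E /b1 yE.
have bb2 : bfun i (b1 \o eta) by exact: bfun_comp (lin_blin leta) bb1.
(* If the functional is non-zero on Delta_m, then i = m and its degree is that of the generator,
   namely 0. *)
have [etad|netad] := eqVneq (b1 (eta (d m))) 0; last first.
  rewrite (e_not_standard bb2 netad) subrr; apply/eqP; apply: contraNT netad => nw.
  by rewrite -d_deg deta b1w // eq_sym.
have b1eta z : b1 (eta z) = 0.
  by have [a ->] := dP z; have := bfun_std a bb2; rewrite /= etad mulr0.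
(* Vanishing on Delta_m, the functional factors through the differential, and the B-linear section
   carries it to Q 1. *)
have [s bs sK] := sp 0%N.
have b1s z : b1 (s (dd 0%N z)) = b1 z.
  have [|z' z'E] := (e0 (z - s (dd 0%N z))).1; first by rewrite (linB (ldd _)) sK subrr.
  by apply/esym/subr0_eq; rewrite -(kfunB bb1.1) z'E b1eta.
have bb3 : bfun i (fun z => b1 (s (gm_pr w z))).
  exact: (bfun_part B_homog chi_0 chi_pos w (bfun_comp bs bb1)).
suff dQ : top_degree (h m) (Q 1%N).
  apply: (dQ i w _ bb3) => [j z nj|].
    by rewrite gm_pr_orth eq_sym (negPf nj) (blin0 B1 bs) (kfun0 bb1.1).
  exists (dd 0%N y0); have [_ ddd] := hom_mor (dd 0%N).
  by rewrite -ddd /y0 gpr_idem b1s.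
have [lt_N|le_N] := ltnP N 1; first exact: top_degree_zero (Q0 _ lt_N).
apply: indecomposable_ind (closure_fg (addQ 1%N)) (@top_degree_zero _) (@top_degree_sum _) _.
move=> X indX sX; have [q [hq iq]] := dec _ _ le_N indX sX.
(* By (H2) the summands of Q 1 are T_q shifted by -1 with h(q) = h(m) - 1, so the induction
   hypothesis applies. *)
have -> : (h m)%:Z = (h q)%:Z + 1 by lia.
by apply: top_degree_shift iq _; apply: IH; lia.
Qed.

(** The assumptions on [x] say that tau'(B) acts on it by chi_i. Self-duality turns it into a
    B-linear functional on T_m of opposite degree, which [T_top_degree] controls. *)
Lemma T_socle_degree m : socle_degree (h m) (T m).
Proof.
move=> i w x ex xp xw nx; have [phi [lphi dphi] iphi] := T_self_dual m.
have kphi : kfun (phi x : kdual (T m) tauP) by exact: (dualP (phi x)).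
have nphi : exists y, (phi x : kdual (T m) tauP) y != 0.
  apply: contrapT => nex; case/eqP: nx; apply: iphi; rewrite (lin0 lphi).
  apply: dual_eq => y; apply/eqP/negPn/negP => ny; by apply: nex; exists y.
have tx c : c \in B -> tau' c *: x = (chi i c)%:A *: x.
  move=> Bc; rewrite [LHS](e_decomp) (bigD1 i) //= big1 ?addr0 => [|q nqi].
    rewrite -{1}ex !scalerA -[in LHS]taue' -!(antiM tauP') mulrA B_diag //.
    by rewrite (antiZ tauP') taue' kscaleE ex.
  have [lt_qi|lt_iq|eqi] := ltngtP q i.
  - rewrite -{1}ex !scalerA -[e q]taue' -[e i in LHS]taue' -!(antiM tauP') mulrA.
    by rewrite B_tri // (anti0 tauP') scale0r.
  - exact: xp.
  by rewrite (val_inj eqi) eqxx in nqi.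
have bphi : bfun i (phi x : kdual (T m) tauP).
  split=> // c y Bc; have := dualE (tau' c) (phi x : kdual (T m) tauP) y.
  rewrite tauK' => <-; rewrite -[tau' c *: _](linZ lphi) tx // (linZ lphi).
  by rewrite -[LHS]/((phi x : kdual (T m) tauP) (tau (chi i c)%:A *: y)) (antiC tauP) (kfunZ kphi).
suff : - w = (h i)%:Z - (h m)%:Z by lia.
apply: (T_top_degree bphi _ nphi) => j y nj.
have := dphi w x; rewrite xw => ->; rewrite /= gm_pr_orth eq_sym (negPf nj).
exact: kfun0 kphi.
Qed.

Lemma tilting_coresolution j : exists (Q : nat -> Gr G) (eta : hom (Delta j : Gr G) (Q 0%N))
  (dd : forall u, hom (Q u) (Q u.+1)), [/\ coresolution eta dd, forall u, good (Q u)
  & forall u, socle_degree ((h j)%:Z - u.*2%:Z) (Q u)].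
Proof.
have [N [Q [eta [dd [[cQ _ _] addQ Q0 dec]]]]] := Hh2 j.
exists Q, eta, dd; split=> // [u|u]; first exact: closure_good.
have [lt_N|le_N] := ltnP N u; first exact: socle_degree_zero (Q0 _ lt_N).
apply: indecomposable_ind (closure_fg (addQ u)) (@socle_degree_zero _) (@socle_degree_sum _) _.
move=> X indX sX; have [q [hq iq]] := dec _ _ le_N indX sX.
have -> : (h j)%:Z - u.*2%:Z = (h q)%:Z - u%:Z by lia.
by apply: socle_degree_shift iq _; exact: T_socle_degree.
Qed.

End Tilting.

End Borel.

(** * Directed algebras *)

Section Tensor.

Variables (k : fieldType) (A : falgType k).
Let b := vbasis {:A}.
Let N := \dim {:A}.
Let co (a : A) (j : 'I_N) : k := coord b j a.

Let coE a : a = \sum_(j < N) co a j *: b`_j.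
Proof. exact: coord_vbasis (memvf a). Qed.

Let coZ c a j : co (c *: a) j = c * co a j.
Proof. exact: linearZ. Qed.
Let coD a c j : co (a + c) j = co a j + co c j.
Proof. exact: linearD. Qed.
Let co_sum j (F : 'I_N -> A) : co (\sum_i F i) j = \sum_i co (F i) j.
Proof. exact: linear_sum. Qed.
Let co_basis (i j : 'I_N) : co (b`_i) j = (i == j)%:R.
Proof. exact: coord_free (basis_free (vbasisP _)). Qed.

Section Module.

Variable M : lmodType A.

(* The module A (x)_k M, in coordinates with respect to a basis of A *)
Definition tens : Type := {ffun 'I_N -> M}.

HB.instance Definition _ := GRing.Zmodule.on tens.

Definition tens_scale (a : A) (F : tens) : tens :=
  [ffun j => \sum_(i < N) (co (a * b`_i) j)%:A *: F i].

Fact tens_scaleA a c F : tens_scale a (tens_scale c F) = tens_scale (a * c) F.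
Proof.
apply/ffunP => j; rewrite !ffunE.
transitivity (\sum_(l < N) \sum_(i < N) (co (a * b`_l) j * co (c * b`_i) l)%:A *: F i).
  by apply: eq_bigr => l _; rewrite ffunE scaler_sumr; apply: eq_bigr => i _; rewrite kscaleA.
rewrite exchange_big; apply: eq_bigr => i _; rewrite -scaler_suml -scaler_suml.
congr (_ *: _ *: _); rewrite -mulrA {2}[c * b`_i]coE mulr_sumr co_sum.
by apply: eq_bigr => l _; rewrite -scalerAr coZ mulrC.
Qed.

Fact tens_scale1 : left_id 1 tens_scale.
Proof.
move=> F; apply/ffunP => j; rewrite ffunE (bigD1 j) //= big1 ?addr0 => [|i nij].
  by rewrite mul1r co_basis eqxx !scale1r.
by rewrite mul1r co_basis (negPf nij) !scale0r.
Qed.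

Fact tens_scaleDr : right_distributive tens_scale +%R.
Proof.
move=> a F H; apply/ffunP => j; rewrite !ffunE -big_split.
by apply: eq_bigr => i _; rewrite ffunE scalerDr.
Qed.

Fact tens_scaleDl F : {morph tens_scale^~ F : a c / a + c}.
Proof.
move=> a c; apply/ffunP => j; rewrite !ffunE -big_split.
by apply: eq_bigr => i _; rewrite mulrDl coD kscaleDl.
Qed.

HB.instance Definition _ := GRing.Zmodule_isLmodule.Build A tens
  tens_scaleA tens_scale1 tens_scaleDr tens_scaleDl.

Definition tens1 (m : M) : tens := [ffun j => (co 1 j)%:A *: m].

Lemma tens1_klin : klin tens1.
Proof.
move=> c x y; apply/ffunP => j; rewrite !ffunE scalerDr; congr (_ + _).
rewrite (eq_bigr (fun i : 'I_N => (c * co (b`_i) j * co 1 i)%:A *: x)) => [|i _]; last first.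
  by rewrite ffunE mulr_algl coZ -kscaleA.
rewrite -scaler_suml -scaler_suml -kscaleC -kscaleA; congr (_ *: _ *: _).
under eq_bigr do rewrite -mulrA; rewrite -mulr_sumr; congr (_ * _).
rewrite [in LHS](coE 1) co_sum; apply: eq_bigr => i _.
by rewrite coZ mulrC.
Qed.

(** The map adjoint to a k-linear one under extension of scalars, with unit [tens1]. *)
Definition tens_ext (X : lmodType A) (s : M -> X) (F : tens) : X := \sum_(i < N) b`_i *: s (F i).

Lemma tens_ext_lin (X : lmodType A) (s : M -> X) : klin s -> linear (tens_ext s).
Proof.
move=> ks a F H; rewrite /tens_ext.
under eq_bigr => i _ do rewrite ffunE (klinD ks) scalerDr.
rewrite big_split; congr (_ + _).
transitivity (\sum_(j < N) \sum_(i < N) (co (a * b`_i) j *: b`_j) *: s (F i)).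
  apply: eq_bigr => j _; rewrite ffunE (big_morph s (klinD ks) (klin0 ks)) scaler_sumr.
  apply: eq_bigr => i _; have := ks (co (a * b`_i) j) (F i) 0.
  by rewrite (klin0 ks) !addr0 => ->; rewrite kscaleC -kscaleE.
rewrite exchange_big scaler_sumr; apply: eq_bigr => i _.
by rewrite -scaler_suml -coE scalerA.
Qed.

Lemma tens_ext1 (X : lmodType A) (s : M -> X) m : klin s -> tens_ext s (tens1 m) = s m.
Proof.
move=> ks; rewrite /tens_ext; under eq_bigr => i _ do rewrite ffunE.
have sZ c x : s (c%:A *: x) = c%:A *: s x.
  by have := ks c x 0; rewrite (klin0 ks) !addr0.
under eq_bigr => i _ do rewrite sZ kscaleC -kscaleE.
by rewrite -scaler_suml -coE scale1r.
Qed.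

Lemma tens_gen (F : tens) : tens_ext tens1 F = F.
Proof.
apply/ffunP => j; rewrite /tens_ext sum_ffunE (bigD1 j) //= big1 ?addr0 => [|i nij].
  rewrite !ffunE; under eq_bigr do rewrite ffunE -kscaleA.
  rewrite -scaler_suml -scaler_suml (_ : \sum_(i < N) _ = 1) ?scale1r ?scale1r //.
  transitivity (co (b`_j * 1) j); last first.
    by rewrite mulr1 co_basis eqxx.
  rewrite [in RHS](coE 1) mulr_sumr co_sum; apply: eq_bigr => i _.
  by rewrite -scalerAr coZ mulrC.
rewrite !ffunE; under eq_bigr do rewrite ffunE -kscaleA.
rewrite -scaler_suml -scaler_suml (_ : \sum_(_ < N) _ = 0) ?scale0r ?scale0r //.
transitivity (co (b`_i * 1) j); last first.
  by rewrite mulr1 co_basis (negPf nij).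
rewrite [in RHS](coE 1) mulr_sumr co_sum; apply: eq_bigr => l _.
by rewrite -scalerAr coZ mulrC.
Qed.

Lemma tens_projective : projective (tens : Mod A).
Proof.
move=> X Y q f sq; have [s ks sK] := ksection (lin_klin (hom_mor q)) sq.
have lf := hom_mor f.
have kg : klin (fun m => s (f (tens1 m))) by move=> c x y; rewrite tens1_klin (lin_klin lf) ks.
exists (mkhom (tens_ext_lin kg)) => F /=.
rewrite /tens_ext (lin_sum (hom_mor q)) -[in RHS](tens_gen F) /tens_ext (lin_sum lf).
by apply: eq_bigr => i _; rewrite (linZ (hom_mor q)) sK (linZ lf).
Qed.

End Module.

End Tensor.

(** * Global dimension of a directed algebra *)

Section Directed.

Variables (k : fieldType) (A : falgType k) (r : nat).
Variables (e : 'I_r -> A) (chi : 'I_r -> A -> k).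
Hypothesis eM : forall i j, e i * e j = if i == j then e i else 0.
Hypothesis esum : \sum_i e i = 1.
Hypothesis tri : forall (i j : 'I_r) a, (j < i)%N -> e i * a * e j = 0.
Hypothesis diag : forall i a, e i * a * e i = chi i a *: e i.

Lemma projective_retract (M P : Mod A) (i : hom M P) (p : hom P M) :
  cancel i p -> projective P -> projective M.
Proof.
move=> ip pP X Y q f sq; have [g gE] := pP X Y q (Hom (mor_comp (hom_mor p) (hom_mor f))) sq.
exists (Hom (mor_comp (hom_mor i) (hom_mor g))) => x /=.
by rewrite gE /= ip.
Qed.

Lemma pd_zero (M : Mod A) n : zero_obj M -> pd_le M n.
Proof.
move=> M0; have id_ := Hom (mor_id M).
have zero x y : x = y :> carrier M by rewrite (M0 x) (M0 y).
exists (fun=> M), id_, (fun=> id_); split=> //.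
  split=> [y|x|m x]; first by exists y; exact: zero.
    by split=> _; [exists x; exact: zero | exact: M0].
  by split=> _; [exists x; exact: zero | exact: M0].
move=> m X Y q f sq.
exists (mkhom (f := fun _ : M => 0 : X) (fun a x y => esym (etrans (addr0 _) (scaler0 _ a)))) => x /=.
by rewrite (M0 x) (lin0 (hom_mor f)) (lin0 (hom_mor q)).
Qed.

Lemma pd_step (K P M : Mod A) (i : hom K P) (p : hom P M) n :
  injective i -> surj p -> (forall x, p x = 0 <-> exists y, x = i y) ->
  projective P -> pd_le K n -> pd_le M n.+1.
Proof.
move=> ii sp ip pP [Q [eps [d [[seps e0 ed] pQ Q0]]]].
pose Q' m := if m is l.+1 then Q l else P.
pose d' m : hom (Q' m.+1) (Q' m) :=
  match m with 0 => Hom (mor_comp (hom_mor eps) (hom_mor i)) | l.+1 => d l end.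
exists Q', p, d'; split; last by case.
  split=> // [x|[|m] x] /=; last exact: ed.
    split=> [/ip[y ->]|[y ->]]; last by apply/ip; exists (eps y).
    by have [z <-] := seps y; exists z.
  rewrite -e0; split=> [ix|->]; last exact: (lin0 (hom_mor i)).
  by apply: ii; rewrite ix (lin0 (hom_mor i)).
by case.
Qed.

(** M is covered by the sum P of the A e_j (x) e_j M. At the largest index i with e_i M possibly
    non-zero, directedness leaves e_i P = e_i (x) e_i M, which maps bijectively to e_i M, and above
    it e_i P = 0. So the kernel lives on one index less. *)
Lemma pd_directed n (M : Mod A) :
  (forall (i : 'I_r) (x : M), (n <= i)%N -> e i *: (x : (M : lmodType A)) = 0) -> pd_le M n.
Proof.
elim: n M => [|n IH] M M0.
  apply: pd_zero => x; rewrite -[x]scale1r -esum scaler_suml big1 // => i _.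
  exact: M0.
(* m is sent to the sum of the e_j (x) e_j m; the induced endomorphism [w] of A (x) M is idempotent,
   and P is its image. *)
pose s (m : (M : lmodType A)) : tens M := \sum_j e j *: tens1 (e j *: m).
have kt := @tens1_klin _ _ (M : lmodType A).
have ks : klin s.
  move=> c x y; rewrite /s scaler_sumr -big_split; apply: eq_bigr => j _.
  by rewrite scalerDr kscaleC kt scalerDr kscaleC.
pose w := tens_ext s; have lw : linear w := tens_ext_lin ks.
have ws m : w (s m) = s m.
  rewrite {1}/s (lin_sum lw); apply: eq_bigr => j _; rewrite (linZ lw) /w tens_ext1 //.
  rewrite /s scaler_sumr (bigD1 j) //= big1 ?addr0 => [|l nlj].
    by rewrite !scalerA eM eqxx.
  by rewrite [e l *: (e j *: m)]scalerA eM (negPf nlj) scale0r (klin0 kt) !scaler0.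
have ww F : w (w F) = w F.
  rewrite {2 3}/w /tens_ext (lin_sum lw); apply: eq_bigr => l _.
  by rewrite (linZ lw) ws.
have sP : is_sub (fun F : tens M => w F = F).
  by split=> [|a x y wx wy]; [exact: lin0 | rewrite lw wx wy].
pose P : Mod A := sub sP.
have lpr : linear (fun F => mksub sP (ww F) : sub sP).
  by move=> a x y; apply: sub_val_inj; rewrite (@sub_val_lin _ _ _ sP) /= lw.
have pP : projective P.
  apply: (@projective_retract P (tens M : Mod A) (mkhom (@sub_val_lin _ _ _ sP)) (mkhom lpr)).
    by move=> x; apply: sub_val_inj; rewrite /= (sub_prop x).
  exact: tens_projective.
have kid : klin (@id M) by [].
pose ev := tens_ext (@id (M : lmodType A)); have lev : linear ev := tens_ext_lin kid.
have evs m : ev (s m) = m.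
  rewrite /s (lin_sum lev); under eq_bigr => j _.
    rewrite (linZ lev) /ev tens_ext1 // scalerA eM eqxx; over.
  by rewrite -scaler_suml esum scale1r.
pose p : hom P M := mkhom (Mod_comp (@sub_val_lin _ _ _ sP) lev : linear (ev \o @sub_val _ _ _ sP)).
have kP : is_sub (fun x : sub sP => p x = 0).
  by split=> [|a x y x0 y0]; [exact: (lin0 (hom_mor p)) | rewrite (hom_mor p) x0 y0 scaler0 addr0].
apply: (@pd_step (sub kP : Mod A) P M (mkhom (@sub_val_lin _ _ _ kP)) p).
- exact: sub_val_inj.
- by move=> m; exists (mksub sP (ws m)); exact: evs.
- move=> x; split=> [x0|[y ->]]; first by exists (mksub kP x0).
  exact: (sub_prop y).
- exact: pP.
apply: IH => i x le_ni; apply: sub_val_inj; apply: sub_val_inj.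
set F := sub_val (sub_val x).
have wF : w F = F := sub_prop (sub_val x).
have eF : ev F = 0 := sub_prop x.
rewrite [LHS](_ : _ = e i *: F); last first.
  by rewrite (linZ (@sub_val_lin _ _ _ kP)) (linZ (@sub_val_lin _ _ _ sP)).
rewrite [RHS](_ : _ = 0); last by rewrite (lin0 (@sub_val_lin _ _ _ kP)) (lin0 (@sub_val_lin _ _ _ sP)).
have es a m : e i *: (a *: s m) = (chi i a)%:A *: (e i *: tens1 (e i *: m)).
  rewrite /s scaler_sumr scaler_sumr (bigD1 i) //= big1 ?addr0 => [|j nji].
    by rewrite !scalerA diag mulr_algl.
  rewrite !scalerA; have [lt_ij|lt_ji|eqji] := ltngtP i j.
  - by rewrite M0 ?(klin0 kt) ?scaler0 // (leq_ltn_trans le_ni).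
  - by rewrite tri ?scale0r.
  by rewrite (val_inj eqji) eqxx in nji.
pose ct (l : 'I_(\dim {:A})) := chi i (vbasis {:A})`_l.
(* On P, e_i F has the form e_i (x) e_i m, and applying [ev] gives e_i m = 0 for F in the kernel. *)
have eFE : e i *: F = e i *: tens1 (e i *: (\sum_(l < \dim {:A}) (ct l)%:A *: F l)).
  rewrite -{1}wF /w /tens_ext scaler_sumr.
  rewrite scaler_sumr (big_morph (@tens1 _ _ M) (klinD kt) (klin0 kt)) scaler_sumr.
  apply: eq_bigr => l _; rewrite es kscaleC.
  by have := kt (ct l) (e i *: F l) 0; rewrite (klin0 kt) !addr0 => ->; rewrite kscaleC.
rewrite eFE.
suff -> : e i *: (\sum_(l < \dim {:A}) (ct l)%:A *: F l) = 0 by rewrite (klin0 kt) scaler0.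
have := congr1 ev eFE; rewrite (linZ lev) eF scaler0 (linZ lev) /ev tens_ext1 //.
by rewrite scalerA eM eqxx.
Qed.

Lemma directed_gldim : finite_gldim A.
Proof. by exists r => M; apply: pd_directed => i x; rewrite leqNgt ltn_ord. Qed.

Lemma projective_lproj_mod (M : Mod A) : projective M -> lproj (M : lmodType A).
Proof.
move=> pM; have [g gE] := pM (freemod A (M : lmodType A) : Mod A) M
  (mkhom (@free_cover_lin _ A M)) (Hom (mor_id M)) (@free_cover_surj _ A M).
exact: (lproj_retract (hom_mor g) (@free_cover_lin _ A M) gE (@lproj_free _ A _)).
Qed.

Lemma lproj_bproj (M : lmodType A) : lproj M -> bproj {:A} M.
Proof.
move=> lM X Y q f lq bf fq.
have lf : linear f by move=> a x y; rewrite bf ?memvf.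
by have [g lg gE] := lM X Y q f lq lf fq; exists g => //; exact: lin_blin.
Qed.

Lemma self_orthogonal_lproj (M : Mod A) : lproj (M : lmodType A) -> self_orthogonal M.
Proof.
move=> lM [//|n] _ P eps d [se e0 ed] pP f fd.
have ld m : linear (d m) := hom_mor (d m).
have [_ sp] := resolution_bsplit (memvf 1) (hom_mor eps) ld se e0 ed (lproj_bproj lM)
  (fun m => lproj_bproj (projective_lproj_mod (pP m))).
have [s bs sK] := sp n.
have ls : linear (f \o s) by move=> a x y; rewrite /= bs ?memvf // (hom_mor f).
exists (mkhom ls) => x /=; apply/subr0_eq; rewrite -(linB (hom_mor f)).
have [|y ->] := (ed n (x - s (d n x))).1; first by rewrite (linB (ld n)) sK subrr.
exact: fd.
Qed.

(** * The regular module as a tilting module *)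

Section Regular.

(** The module needed later is a restriction of scalars and agrees with the regular module only
    through [u] and [v]. *)
Variables (N : lmodType A) (u : N -> A) (v : A -> N).
Hypotheses (lu : forall a x y, u (a *: x + y) = a * u x + u y).
Hypotheses (uK : cancel u v) (vK : cancel v u).
Hypothesis e_neq0 : forall i, e i != 0.

Let lu' : linear (u : N -> A^o) := lu.
Let uZ a x : u (a *: x) = a * u x := linZ lu' a x.
Let u_inj : injective u := can_inj uK.
Let gen x : x = u x *: v 1.
Proof. by apply: u_inj; rewrite uZ vK mulr1. Qed.

Lemma regular_lproj : lproj N.
Proof.
move=> X Y q f lq lf fq; have [x0 x0E] := fq (v 1).
exists (fun x => u x *: x0) => [a x y|x].
  by rewrite lu scalerDl scalerA.
by rewrite (linZ lq) -x0E -(linZ lf) -gen.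
Qed.

Fact piece_sub i : is_sub (fun x : N => u x * e i = u x).
Proof.
split=> [|a x y xi yi]; first by rewrite (lin0 lu') mul0r.
by rewrite lu mulrDl -mulrA xi yi.
Qed.

Definition piece i : Mod A := sub (piece_sub i).
Let uu i (x : piece i) : A := u (sub_val x).
Let uu_inj i : injective (@uu i).
Proof. by move=> x y /u_inj; exact: sub_val_inj. Qed.
Let uuZ i a (x : piece i) : uu (a *: (x : sub (piece_sub i))) = a * uu x.
Proof. by rewrite /uu (linZ (@sub_val_lin _ _ _ _)) uZ. Qed.

Let ge i : u (v (e i)) * e i = u (v (e i)).
Proof. by rewrite vK eM eqxx. Qed.
Let g i : sub (piece_sub i) := mksub (piece_sub i) (ge i).
Let uug i : uu (g i) = e i.
Proof. exact: vK. Qed.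

Let piece_gen i (x : piece i) : x = uu x *: g i.
Proof. by apply: uu_inj; rewrite uuZ uug; rewrite (sub_prop x). Qed.

Let piece_hom i j (f : piece i -> piece j) : linear f ->
  uu (f (g i)) = e i * uu (f (g i)) * e j.
Proof.
move=> lf; rewrite -mulrA (sub_prop (f (g i))) -uuZ -(linZ lf); congr (uu (f _)).
by apply: uu_inj; rewrite uuZ uug eM eqxx.
Qed.

(** A map from A e_i to A e_j is given by an element of e_i A e_j, which is zero for j < i; an
    isomorphism and its inverse leave only i = j. *)
Lemma piece_iso i j : isomorphic (piece i) (piece j) -> i = j.
Proof.
have main p q : isomorphic (piece p) (piece q) -> (p <= q)%N.
  move=> [f [f' [fK _]]]; rewrite leqNgt; apply/negP => lt_qp.
  case/eqP: (e_neq0 p); rewrite -uug -(fK (g p)) (_ : f (g p) = 0).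
    by rewrite (lin0 (hom_mor f')) /uu (lin0 (@sub_val_lin _ _ _ _)) (lin0 lu').
  apply: uu_inj; rewrite (piece_hom (hom_mor f)) tri //.
  by rewrite /uu (lin0 (@sub_val_lin _ _ _ _)) (lin0 lu').
move=> ij; apply/val_inj/eqP; rewrite eqn_leq (main _ _ ij) main //.
by have [f [f' [K K']]] := ij; exists f', f.
Qed.

(** Endomorphisms of A e_i are scalars by [diag], so an idempotent one is 0 or 1. *)
Lemma piece_indecomposable i : indecomposable (piece i).
Proof.
split=> [z|Y [inj [pr [K1 K2 K3]]]].
  case/eqP: (e_neq0 i); rewrite -uug (z (g i)).
  by rewrite /uu (lin0 (@sub_val_lin _ _ _ _)) (lin0 lu').
pose p x := inj true (pr true x); have lp : linear p := Mod_comp (hom_mor (pr true)) (hom_mor (inj true)).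
have pE x : p x = (chi i (uu (p (g i))))%:A *: x.
  rewrite {1}(piece_gen x) (linZ lp) [RHS](piece_gen _) uuZ mulr_algl kscaleE -kscaleC.
  by congr (_ *: _); apply: uu_inj; rewrite uuZ uug mulr_algl -diag -piece_hom.
set c := chi i _ in pE.
have cc : c * c = c.
  apply/(@kscale_inj _ _ _ _ _ (g i : sub (piece_sub i))).
    by apply: contra_neq (e_neq0 i) => g0; rewrite -uug g0 /uu (lin0 (@sub_val_lin _ _ _ _)) (lin0 lu').
  by rewrite kscaleA -!pE /p K1.
have [c0|nc] := eqVneq c 0.
  exists true => y; rewrite -(K1 true y) -{1}(K1 true y).
  by rewrite -[inj true _]/(p (inj true y)) pE c0 !scale0r (lin0 (hom_mor (pr true))).
have c1 : c = 1 by apply: (mulfI nc); rewrite cc mulr1.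
exists false => y; rewrite -(K1 false y).
have : p (inj false y) = 0 by rewrite /p K2 // (lin0 (hom_mor (inj true))).
by rewrite pE c1 !scale1r => ->; rewrite (lin0 (hom_mor (pr false))).
Qed.

Lemma piece_direct_sum : direct_sum piece (N : Mod A).
Proof.
have prP i x : u (v (u x * e i)) * e i = u (v (u x * e i)) by rewrite vK -mulrA eM eqxx.
have lpr i : linear (fun x : N => mksub (piece_sub i) (prP i x)).
  move=> a x y; apply: sub_val_inj; apply: u_inj.
  transitivity (u (v (u (a *: x + y) * e i))); first by [].
  transitivity (u (a *: v (u x * e i) + v (u y * e i))); last by [].
  by rewrite vK [in RHS]lu !vK lu mulrDl mulrA.
exists (fun i => mkhom (@sub_val_lin _ _ _ (piece_sub i))), (fun i => mkhom (lpr i)).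
split=> [i y|i j y nij|x] /=.
- by apply: sub_val_inj; apply: u_inj; rewrite /= vK (sub_prop y).
- apply: sub_val_inj; apply: u_inj; rewrite /= vK -(sub_prop y) -mulrA eM eq_sym (negPf nij).
  by rewrite mulr0 (lin0 lu').
apply: u_inj; rewrite (lin_sum lu'); under eq_bigr do rewrite /= vK.
by rewrite -mulr_sumr esum mulr1.
Qed.

Lemma regular_tilting : tilting (N : Mod A).
Proof.
split.
- by exists 1%N, (fun=> v 1) => x; exists (fun=> u x); rewrite big_ord1 -gen.
- exists r, piece; split; [exact: piece_indecomposable | exact: piece_iso|].
  exact: piece_direct_sum.
- by have [n nP] := directed_gldim; exists n.
- exact: self_orthogonal_lproj regular_lproj.
have lv : linear (v : A^o -> N) by move=> a x y; apply: u_inj; rewrite lu !vK.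
pose Z : Mod A := 'rV[A^o]_0.
have Z0 (x : 'rV[A^o]_0) : x = 0 by exact: thinmx0.
pose Q n : Mod A := if n is 0 then N else Z.
have l0 (X Y : lmodType A) : linear (fun _ : X => 0 : Y) by move=> a x y; rewrite scaler0 addr0.
pose d n : hom (Q n) (Q n.+1) := mkhom (l0 (Q n) (Q n.+1)).
exists 0%N, Q, (mkhom lv : hom (A^o : Mod A) (Q 0%N)), d; split; last by case.
  split=> [|x|n x]; first exact: (can_inj vK).
    by split=> // _; exists (u x); rewrite /= uK.
  by split=> // _; exists 0; exact: Z0.
case=> [|n].
  exists 1%N, N; split; last by exists (Hom (mor_id _)), (Hom (mor_id _)).
  exists (fun=> Hom (mor_id _)), (fun=> Hom (mor_id _)).
  split=> // [i j y|x]; first by rewrite !ord1.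
  by rewrite big_ord1.
exists 0%N, Z; split; last by exists (Hom (mor_id _)), (Hom (mor_id _)).
exists (fun=> mkhom (l0 _ _)), (fun=> mkhom (l0 _ _)).
by split=> [[]|[]|x] //; rewrite big_ord0; exact/esym/Z0.
Qed.

End Regular.

End Directed.

(** * Regrading *)

Section Regrade.

Variables (k : fieldType) (L : falgType k) (r : nat) (D G : grading L).
Variables (e : 'I_r -> L) (h : 'I_r -> nat).
Hypothesis eM : forall i j, e i * e j = if i == j then e i else 0.
Hypothesis esum : \sum_i e i = 1.
Hypothesis He : forall i, e i \in G 0%N.
Hypothesis D_ind : forall n (P : L -> Prop), P 0 ->
  (forall x y, P x -> P y -> P (x + y)) ->
  (forall l (i j : 'I_r) a, a \in G l -> (l + h i = h j + n.*2)%N -> P (e i * a * e j)) ->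
  forall a, a \in D n -> P a.

Lemma e_eq (M : lmodType L) (x y : M) : (forall i, e i *: x = e i *: y) -> x = y.
Proof.
move=> xy; rewrite -[x]scale1r -[y]scale1r -esum !scaler_suml.
by apply: eq_bigr => i _; exact: xy.
Qed.

Variables (c : int) (M : gmod G).

(* The degree d part for the new grading is the sum of the e_i M_(2d - h i + c);
   the parts of the other parity are attached to it as well, so that nothing of M
   is lost. *)
Definition old_deg (i : 'I_r) (t : int) : int := t + t - (h i)%:Z + c.

Definition reg_pr (t : int) (x : M) : M :=
  \sum_i e i *: (gm_pr (old_deg i t) x + gm_pr (old_deg i t + 1) x).

Lemma e_reg_pr i t x : e i *: reg_pr t x = e i *: (gm_pr (old_deg i t) x + gm_pr (old_deg i t + 1) x).
Proof.
rewrite /reg_pr scaler_sumr (bigD1 i) //= big1 ?addr0 => [|j nji].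
  by rewrite scalerA eM eqxx.
by rewrite scalerA eM eq_sym (negPf nji) scale0r.
Qed.

Lemma reg_prE i t x : e i *: x = x -> reg_pr t x = gm_pr (old_deg i t) x + gm_pr (old_deg i t + 1) x.
Proof.
move=> ex; have eD j : gm_pr j x = e i *: gm_pr j x by rewrite -gprZ0 // ex.
rewrite [RHS](_ : _ = e i *: (gm_pr (old_deg i t) x + gm_pr (old_deg i t + 1) x)); last first.
  by rewrite scalerDr -!eD.
rewrite -e_reg_pr; apply: e_eq => j; rewrite scalerA eM.
have [->//|nji] := eqVneq j i; rewrite scale0r e_reg_pr eD [X in _ + X]eD -scalerDr scalerA eM.
by rewrite (negPf nji) scale0r.
Qed.

Fact reg_prD t x y : reg_pr t (x + y) = reg_pr t x + reg_pr t y.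
Proof.
rewrite /reg_pr -big_split; apply: eq_bigr => i _.
by rewrite !gm_prD addrACA scalerDr.
Qed.

Fact reg_pr0 t : reg_pr t 0 = 0.
Proof. by rewrite /reg_pr big1 // => i _; rewrite !gpr0 addr0 scaler0. Qed.

Fact reg_pr_orth s t x : reg_pr s (reg_pr t x) = if s == t then reg_pr t x else 0.
Proof.
apply: e_eq => i; rewrite e_reg_pr scalerDr -!gprZ0 // e_reg_pr !gprZ0 //.
rewrite -scalerDr !gm_prD !gm_pr_orth; have [->|nst] := eqVneq s t.
  rewrite !eqxx e_reg_pr; congr (_ *: _).
  have -> : (old_deg i t == old_deg i t + 1) = false by lia.
  have -> : (old_deg i t + 1 == old_deg i t) = false by lia.
  by rewrite addr0 add0r.
rewrite !ifN ?addr0 ?scaler0 //; by rewrite /old_deg; lia.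
Qed.

Fact reg_pr_sum x : exists2 s : seq int, uniq s & x = \sum_(t <- s) reg_pr t x.
Proof.
suff [[s sP] xE] : fsupp (fun t => reg_pr t x) /\ x = fsum (fun t => reg_pr t x).
  exists (undup s); first exact: undup_uniq.
  rewrite {1}xE; apply: fsumE; first exact: undup_uniq.
  by move=> t; rewrite mem_undup; exact: sP.
pose P y := fsupp (fun t => reg_pr t y) /\ y = fsum (fun t => reg_pr t y).
have P0 : P 0.
  split; first by exists [::] => t _; exact: reg_pr0.
  by rewrite (fsum_eq reg_pr0) fsum0.
have PD y z : P y -> P z -> P (y + z).
  move=> [sy yE] [sz zE]; have E := fun t => reg_prD t y z; split.
    by have [s sP] := fsuppD sy sz; exists s => t /sP; rewrite E.
  by rewrite (fsum_eq E) fsumD // -yE -zE.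
rewrite -/(P x); move: x; apply: gm_ind => // j x xj.
rewrite -[x]scale1r -esum scaler_suml; apply: big_ind => // i _.
set y := e i *: x; have ey : e i *: y = y by rewrite scalerA eM eqxx.
have yj : gm_pr j y = y by rewrite gprZ0 // xj.
have [t tP] : exists t, j = old_deg i t \/ j = old_deg i t + 1.
  (* Floor division attaches each old degree, of either parity, to one new degree. *)
  by exists ((j + (h i)%:Z - c) %/ 2)%Z; rewrite /old_deg; lia.
have yt : reg_pr t y = y.
  rewrite (reg_prE _ ey); case: tP => jE; rewrite -jE yj (gpr_other yj) ?addr0 ?add0r //; lia.
have ns s : s != t -> reg_pr s y = 0.
  by move=> nst; rewrite -yt reg_pr_orth (negPf nst).
split; last by rewrite (fsum1 ns).
by exists [:: t] => s; rewrite inE; exact: ns.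
Qed.

Fact reg_pr_scale (n : nat) (a : L) (t : int) x : a \in D n ->
  reg_pr (n%:Z + t) (a *: reg_pr t x) = a *: reg_pr t x.
Proof.
move: a; apply: D_ind => [|a b Pa Pb|l i j a Ga lE].
- by rewrite scale0r reg_pr0.
- by rewrite scalerDl reg_prD Pa Pb.
set b := e i * a * e j; have Gb : b \in G l.
  by have := grM (grM (He i) Ga) (He j); rewrite add0n addn0.
have -> : b *: reg_pr t x = b *: (e j *: reg_pr t x).
  by rewrite [RHS]scalerA /b -(mulrA (e i * a) (e j)) eM eqxx.
rewrite e_reg_pr; set z := e j *: _.
have eb : e i *: (b *: z) = b *: z by rewrite scalerA /b !mulrA eM eqxx.
rewrite (reg_prE _ eb).
(* A restatement of l + h(i) = h(j) + 2n, which defines the Delta-degree n. *)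
have -> : old_deg i (n%:Z + t) = l%:Z + old_deg j t by rewrite /old_deg; lia.
rewrite -addrA !(gprZ _ _ Gb) -scalerDr; congr (_ *: _).
rewrite /z !gprZ0 // -scalerDr !gm_prD !gm_pr_orth !eqxx.
have -> : (old_deg j t == old_deg j t + 1) = false by lia.
have -> : (old_deg j t + 1 == old_deg j t) = false by lia.
by rewrite addr0 add0r.
Qed.

Definition regrade : gmod D := Gmod reg_prD reg_pr_orth reg_pr_sum reg_pr_scale.

End Regrade.

(** * The degree 0 part as a graded module *)

Section DegreeZero.

Variables (k : fieldType) (L : falgType k) (D : grading L).

Definition pr0 (a : L) : gr0 D := vsproj (gr0_aspace D) (gcomp D 0 a).

Lemma pr0_val a : gr0_val (pr0 a) = gcomp D 0 a.
Proof. by rewrite /gr0_val vsprojK // gcomp_mem. Qed.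

Lemma gr0_val_inj : injective (@gr0_val _ _ D).
Proof. exact: val_inj. Qed.

Lemma gr0_mem (x : gr0 D) : gr0_val x \in D 0%N.
Proof. exact: subvsP. Qed.

Lemma pr0K x : pr0 (gr0_val x) = x.
Proof. by apply: gr0_val_inj; rewrite pr0_val (gcomp_id _ (gr0_mem x)) eqxx. Qed.

Fact pr0_additive : zmod_morphism pr0.
Proof.
move=> a b; apply: gr0_val_inj; rewrite rmorphB /= !pr0_val.
by rewrite gcompD -scaleN1r gcompZ scaleN1r.
Qed.

Fact pr0_monoid : monoid_morphism pr0.
Proof.
split=> [|a b]; apply: gr0_val_inj; first by rewrite pr0_val gcomp1 rmorph1.
by rewrite rmorphM /= !pr0_val gcompM0.
Qed.

HB.instance Definition _ := GRing.isZmodMorphism.Build L (gr0 D) pr0 pr0_additive.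
HB.instance Definition _ := GRing.isMonoidMorphism.Build L (gr0 D) pr0 pr0_monoid.

Definition degree0_mod : lmodType L := restrict pr0 ((gr0 D)^o : lmodType (gr0 D)).

Lemma degree0Z a (x : degree0_mod) : gr0_val (a *: x : degree0_mod) = gcomp D 0 a * gr0_val (x : gr0 D).
Proof. by rewrite -[a *: x]/(pr0 a * (x : gr0 D)) rmorphM /= pr0_val. Qed.

Definition degree0_pr (i : int) (x : degree0_mod) : degree0_mod := if i == 0 then x else 0.

Fact degree0_prD i x y : degree0_pr i (x + y) = degree0_pr i x + degree0_pr i y.
Proof. by rewrite /degree0_pr; case: eqP => // _; rewrite addr0. Qed.

Fact degree0_pr_orth i j x :
  degree0_pr i (degree0_pr j x) = if i == j then degree0_pr j x else 0.
Proof.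
rewrite /degree0_pr; have [->|nij] := eqVneq i j; first by case: eqP.
by case: eqP => // i0; case: eqP => // j0; rewrite i0 j0 eqxx in nij.
Qed.

Fact degree0_pr_sum x : exists2 s : seq int, uniq s & x = \sum_(i <- s) degree0_pr i x.
Proof. by exists [:: 0] => //; rewrite big_seq1 /degree0_pr eqxx. Qed.

Fact degree0_pr_scale (d : nat) (a : L) (i : int) x : a \in D d ->
  degree0_pr (d%:Z + i) (a *: degree0_pr i x) = a *: degree0_pr i x.
Proof.
rewrite /degree0_pr => Da; have [->|_] := eqVneq i 0; last by rewrite scaler0 if_same.
rewrite addr0; case: d Da => [|d] Da; first by rewrite eqxx.
by rewrite /=; apply: gr0_val_inj; rewrite degree0Z (gcomp_id _ Da) mul0r.
Qed.

Definition degree0 : gmod D := Gmod degree0_prD degree0_pr_orth degree0_pr_sum degree0_pr_scale.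

Lemma degree0_concentrated : concentrated degree0 0.
Proof. by move=> x; rewrite /in_degree /= /degree0_pr eqxx. Qed.

Lemma degree0_part : is_degree0_part degree0.
Proof.
split; first exact: degree0_concentrated.
have lp : linear (pr0 : L^o -> degree0_mod).
  move=> a x y; apply: gr0_val_inj; rewrite pr0_val gcompD.
  transitivity (gr0_val (pr0 a * pr0 x) + gr0_val (pr0 y)); last by rewrite -rmorphD.
  by rewrite rmorphM /= !pr0_val -gcompM0.
exists (mkhom lp); split=> [n a n_gt0 Da|m].
  by apply: gr0_val_inj; rewrite /= pr0_val (gcomp_id _ Da) eq_sym gtn_eqF ?rmorph0.
exists (gr0_val (m : gr0 D)); split; first by split; [exact: gr0_mem | exact: pr0K].
by move=> a [Da <-]; rewrite /= pr0_val (gcomp_id _ Da) eqxx.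
Qed.

End DegreeZero.

(** * Extensions of the degree 0 part *)

Section Extensions.

Variables (k : fieldType) (L : falgType k) (r : nat) (D G : grading L).
Variables (e : 'I_r -> L) (h : 'I_r -> nat).
Hypothesis eM : forall i j, e i * e j = if i == j then e i else 0.
Hypothesis esum : \sum_i e i = 1.
Hypothesis He : forall i, e i \in G 0%N.
Hypothesis eB : forall i, e i \in D 0%N.
Hypothesis B_tri : forall (i j : 'I_r) b, b \in D 0%N -> (j < i)%N -> e i * b * e j = 0.
Hypothesis D_ind : forall n (P : L -> Prop), P 0 ->
  (forall x y, P x -> P y -> P (x + y)) ->
  (forall l (i j : 'I_r) a, a \in G l -> (l + h i = h j + n.*2)%N -> P (e i * a * e j)) ->
  forall a, a \in D n -> P a.
Hypothesis L_bproj : bproj (D 0%N) L^o.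
Hypothesis D0_bproj : bproj (D 0%N) (degree0 D).

Let reg c (M : gmod G) : gmod D := regrade eM esum He D_ind c M.

Lemma regrade_mor c (M N : gmod G) (f : M -> N) : graded_mor f ->
  @graded_mor _ _ _ (reg c M) (reg c N) f.
Proof.
move=> [lf df]; split=> // t x; rewrite /= /reg_pr (lin_sum lf); apply: eq_bigr => i _.
by rewrite (linZ lf) (linD lf) !df.
Qed.

Lemma shift_mor (H : grading L) (M N : gmod H) (f : M -> N) v : graded_mor f ->
  @graded_mor _ _ _ (shift M v) (shift N v) f.
Proof. by move=> [lf df]; split=> // i x; exact: df. Qed.

Lemma part_killed (M : gmod G) (p : 'I_r) (y : M) w a :
  (forall b, e p *: (b *: y) = 0) -> e p *: (a *: gm_pr w y) = 0.
Proof.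
move=> y0; rewrite (gcomp_sum G a) scaler_suml scaler_sumr big1 // => l _.
by rewrite -(gprZ _ _ (gcomp_mem G l a)) -gprZ0 // y0 gpr0.
Qed.

Variables (P : nat -> Gr D) (eps : hom (P 0%N) (degree0 D : Gr D)).
Variable del : forall m, hom (P m.+1) (P m).
Hypotheses (resP : resolution eps del) (projP : forall m, projective (P m)).

Let lprojP m : lproj (gm_mod (P m)).
Proof.
have [K [i [p [li lp ip]]]] := projective_lproj (@projP m).
exact: (lproj_retract li lp ip (@lproj_free _ L K)).
Qed.

Let bprojP m : bproj (D 0%N) (gm_mod (P m)).
Proof.
have [K [i [p [li lp ip]]]] := projective_lproj (@projP m).
apply: (bproj_retract (lin_blin li) (lin_blin lp) ip).
exact: (bproj_free (gr_one D) L_bproj).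
Qed.

Let leps : linear eps. Proof. exact: (mor_linear (hom_mor eps)). Qed.
Let ldel m : linear (del m). Proof. exact: (mor_linear (hom_mor (del m))). Qed.

(** Uniform access to the map preceding [del m], which is the augmentation when m = 0. *)
Lemma splitting m : exists (U : lmodType L) (phi : gm_mod (P m) -> U),
  [/\ linear phi, bsplit (D 0%N) phi & forall x, phi x = 0 <-> exists y, x = del m y].
Proof.
have [se e0 ed] := resP.
have [s0 s1] := resolution_bsplit (gr_one D) leps ldel se e0 ed D0_bproj bprojP.
case: m => [|m]; first by exists (degree0 D), eps.
by exists (gm_mod (P m)), (del m); split; [exact: ldel | exact: s1 | exact: ed].
Qed.

Lemma del_del m x : del m (del m.+1 x) = 0.
Proof. by have [_ _ ed] := resP; apply/ed; exists x. Qed.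

(* Ext^(m+1) into a module to which maps from kernels of B-split maps extend *)
Lemma ext_good m (N : lmodType L) (f : gm_mod (P m.+1) -> N) :
  (forall (F U : lmodType L) (phi : F -> U), linear phi -> lproj F ->
     bsplit (D 0%N) phi -> extends phi N) ->
  linear f -> (forall x, f (del m.+1 x) = 0) ->
  exists2 g : gm_mod (P m) -> N, linear g & forall x, g (del m x) = f x.
Proof.
move=> eN lf f0; have [U [phi [lphi sphi phi0]]] := splitting m.
have ex x : exists y, phi x = 0 -> x = del m y.
  by have [/phi0[y yE]|nx] := pselect (phi x = 0); [exists y | exists 0].
have [c cP] := choice ex.
have fE x y : del m x = del m y -> f x = f y.
  move=> xy; apply/subr0_eq; rewrite -(linB lf).
  have [_ _ ed] := resP; have [|z ->] := (ed m (x - y)).1; last exact: f0.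
  by rewrite (linB (@ldel m)) xy subrr.
have [|g lg gE] := eN _ _ phi lphi (@lprojP m) sphi (fun x => f (c x)).
  move=> a x y x0 y0; rewrite -lf; apply: fE; rewrite (@ldel m) -!cP //.
  by rewrite lphi x0 y0 scaler0 addr0.
have p0 x : phi (del m x) = 0 by apply/phi0; exists x.
by exists g => // x; rewrite gE //; apply: fE; rewrite -cP.
Qed.

Variables (t : int) (v : int) (Q : nat -> Gr G) (dd : forall u, hom (Q u) (Q u.+1)).
Hypothesis ddP : forall u x, dd u.+1 x = 0 <-> exists y, x = dd u y.
Hypothesis Q_ext : forall u (F U : lmodType L) (phi : F -> U), linear phi -> lproj F ->
  bsplit (D 0%N) phi -> extends phi (gm_mod (Q u)).
Hypothesis Q_socle : forall u, socle_degree e h (t - u.*2%:Z) (Q u).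

Let X u : gmod D := shift (reg t (Q u)) v.

Let gdd u : @graded_mor _ _ _ (X u) (X u.+1) (dd u).
Proof. apply: shift_mor; apply: regrade_mor; exact: (hom_mor (dd u)). Qed.

Let ldd u : linear (dd u : gm_mod (Q u) -> gm_mod (Q u.+1)).
Proof. exact: (mor_linear (hom_mor (dd u))). Qed.

(** The image y of e_i is killed by the e_p with p > i even after multiplication, so it is an image
    of the generator of Delta_i; it sits in new degree -v. Its old degree is t - h(i) - 2v or one
    more, while [Q_socle] requires t - h(i) - 2u. *)
Lemma hom_vanish u (f : gm_mod (P 0%N) -> X u) : @graded_mor _ _ _ (P 0%N) (X u) f ->
  (forall x, eps x = 0 -> f x = 0) -> u%:Z != v -> forall x, f x = 0.
Proof.
move=> [lf df] f0 nuv; have [se _ _] := resP.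
have fE x y : eps x = eps y -> f x = f y.
  by move=> xy; apply/subr0_eq; rewrite -(linB lf) f0 // (linB leps) xy subrr.
have [c cP] := choice (fun i => se (pr0 D (e i))).
have epsE x : gr0_val (eps x) = \sum_i gr0_val (eps x) * e i by rewrite -mulr_sumr esum mulr1.
have vE i : gr0_val (pr0 D (e i)) = e i by rewrite pr0_val (gcomp_id _ (eB i)) eqxx.
have sE i a : gr0_val (a *: (pr0 D (e i) : degree0 D)) = gcomp D 0 a * e i.
  by apply: etrans (degree0Z _ _) _; rewrite vE.
suff z0 i : f (c i) = 0.
  move=> x; rewrite (fE x (\sum_i gr0_val (eps x) *: c i)).
    by rewrite (lin_sum lf) big1 // => i _; rewrite (linZ lf) z0 scaler0.
  apply: gr0_val_inj; rewrite [LHS]epsE (lin_sum leps) (raddf_sum (@gr0_val _ _ D)).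
  apply: eq_bigr => i _; rewrite (linZ leps) cP; apply/esym/(etrans (sE _ _)).
  have := gcomp_id 0 (gr0_mem (eps x : gr0 D)); rewrite eqxx => vv.
  exact: (congr1 (fun b : L => b * e i) vv).
pose y : gm_mod (Q u) := f (c i); rewrite -[f (c i)]/y.
have ey : e i *: y = y.
  rewrite -(linZ lf); apply: fE; rewrite (linZ leps) cP; apply: gr0_val_inj.
  by apply: etrans (sE _ _) _; rewrite vE (gcomp_id _ (eB i)) eqxx eM eqxx.
have yp (p : 'I_r) a : (i < p)%N -> e p *: (a *: y) = 0.
  move=> ip; rewrite scalerA -(linZ lf); apply: f0; rewrite (linZ leps) cP; apply: gr0_val_inj.
  apply: etrans (sE _ _) _; rewrite gcompM0 (gcomp_id _ (eB p)) eqxx.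
  by rewrite B_tri ?gcomp_mem // rmorph0.
have yv : reg_pr e h t (- v) y = y.
  have E : f (gm_pr 0 (c i)) = reg_pr e h t (0 - v) y := df 0 (c i).
  rewrite sub0r in E; rewrite -E; apply: fE.
  have [_ de] := hom_mor eps.
  by rewrite de; exact: degree0_concentrated.
rewrite -yv (reg_prE _ eM esum He _ _ ey).
have part w : w = old_deg h t i (- v) \/ w = old_deg h t i (- v) + 1 -> gm_pr w y = 0.
  move=> wE; apply/eqP/negPn/negP => nw; case/eqP: nuv.
  have : w = t - u.*2%:Z - (h i)%:Z; last by case: wE => ->; rewrite /old_deg; lia.
  apply: (Q_socle _ _ _ nw) => [|p a ip|].
  - by rewrite -gprZ0 // ey.
  - by apply: part_killed => b; exact: yp.
  exact: gpr_idem.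
by rewrite !part ?addr0; [|right|left].
Qed.

(** Dimension shifting. If f = g del, then dd g is a cocycle one place lower in the resolution and
    one further in the coresolution, so the sum of the places stays different from v. At P 0 it is a
    map out of Lambda_0 and [hom_vanish] ends the descent. *)
Lemma ext_coresolution m u (f : gm_mod (P m.+1) -> X u) :
  @graded_mor _ _ _ (P m.+1) (X u) f -> (forall x, f (del m.+1 x) = 0) ->
  (forall x, dd u (f x) = 0) -> (m.+1 + u)%:Z != v ->
  exists g : gm_mod (P m) -> X u, [/\ @graded_mor _ _ _ (P m) (X u) g,
    forall x, dd u (g x) = 0 & forall x, f x = g (del m x)].
Proof.
elim: m u f => [|m IH] u f gf fd df nv; have [lf _] := gf;
  have [g0 lg0 g0E] := ext_good (@Q_ext u) lf fd;
  have [g [gg gE _]] := graded_part_comp (M := P _) (N := X u) lg0;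
  have {g0E lg0 g0}gE x : g (del _ x) = f x := gE (P _) _ _ (hom_mor (del _)) gf g0E x;
  have gh : @graded_mor _ _ D (P _) (X u.+1) (dd u \o g) := graded_mor_comp gg (@gdd u).
  exists g; split=> //; apply: (hom_vanish gh) => // x.
  by have [_ e0 _] := resP; move=> /e0[y ->]; rewrite /= gE df.
have [|x|| g2 [gg2 dg2 g2E]] := IH u.+1 _ gh.
- by move=> x; rewrite /= gE df.
- by apply/ddP; exists (g x).
- by rewrite addnS -addSn.
(* dd g = g2 del, and g2 lifts through dd by exactness and projectivity. Subtracting the lift after
   [del] puts g in the kernel of dd and leaves g del unchanged. *)
have [|g3 lg3 g3E] := @lprojP m _ _ _ _ (@ldd u) gg2.1.
  by move=> x; have /ddP[y yE] := dg2 x; exists y.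
have [g4 [gg4 _ g4E]] := graded_part_comp (M := P m) (N := X u) lg3.
have {}g4E x : dd u (g4 x) = g2 x := g4E (X u.+1) _ _ (gdd u) gg2 g3E x.
exists (fun x => g x - g4 (del m x)); split=> [|x|x].
- have [[lg dg] [lg4 dg4]] := (gg, gg4); split=> [a x y|i x].
    by rewrite lg (@ldel m) lg4 scalerBr opprD addrACA.
  have [_ ddPm] := hom_mor (del m).
  by rewrite dg ddPm dg4 gprB.
- by rewrite (linB (@ldd u)) g4E -g2E subrr.
by rewrite del_del gE (lin0 gg4.1) subr0.
Qed.

End Extensions.

Lemma concentrated_mor (k : fieldType) (L : falgType k) (H : grading L) (M N : gmod H)
    (f : M -> N) : concentrated M 0 -> concentrated N 0 -> linear f -> graded_mor f.
Proof.
move=> cM cN lf; split=> // i x; have [->|ni] := eqVneq i 0; first by rewrite cM cN.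
by rewrite (gpr_other (cM x)) // (gpr_other (cN (f x))) // (lin0 lf).
Qed.

(** * Koszulity with respect to the degree 0 part *)

Section DeltaKoszul.

Variables (k : fieldType) (L : falgType k) (r : nat) (D G : grading L).
Variables (e : 'I_r -> L) (chi : 'I_r -> L -> k) (h : 'I_r -> nat).
Variables (Delta : 'I_r -> gmod G) (d : forall j, Delta j).
Hypothesis eM : forall i j, e i * e j = if i == j then e i else 0.
Hypothesis esum : \sum_i e i = 1.
Hypothesis e_neq0 : forall i, e i != 0.
Hypothesis He : forall i, e i \in G 0%N.
Hypothesis eB : forall i, e i \in D 0%N.
Hypothesis B_tri : forall (i j : 'I_r) b, b \in D 0%N -> (j < i)%N -> e i * b * e j = 0.
Hypothesis B_diag : forall i b, b \in D 0%N -> e i * b * e i = chi i b *: e i.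
Hypothesis D_ind : forall n (P : L -> Prop), P 0 ->
  (forall x y, P x -> P y -> P (x + y)) ->
  (forall l (i j : 'I_r) a, a \in G l -> (l + h i = h j + n.*2)%N -> P (e i * a * e j)) ->
  forall a, a \in D n -> P a.
Hypothesis de : forall j, e j *: d j = d j.
Hypothesis dP : forall j x, exists a, x = a *: d j.
Hypothesis d_free : forall j b, b \in D 0%N -> b *: d j = 0 -> b * e j = 0.
Hypothesis d_pos : forall j n a (x : Delta j), (0 < n)%N -> a \in D n -> a *: x = 0.
Hypothesis d_height : forall i j l (x : Delta j), e i *: x = x -> gm_pr l x = x -> x != 0 ->
  (h i)%:Z = (h j)%:Z - l.
Hypothesis L_bproj : bproj (D 0%N) L^o.
Hypothesis Hres : forall j, exists (Q : nat -> Gr G) (eta : hom (Delta j : Gr G) (Q 0%N))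
  (dd : forall u, hom (Q u) (Q u.+1)), [/\ coresolution eta dd,
    forall u, good D chi d (gm_mod (Q u))
  & forall u, socle_degree e h ((h j)%:Z - u.*2%:Z) (Q u)].

Let part0 a j (x : Delta j) : gcomp D 0 a *: x = a *: x.
Proof. exact: (d_part d_pos). Qed.

Let e0 i := pr0 D (e i).
Let e0sum : \sum_i e0 i = 1.
Proof. by rewrite -(pr0_monoid D).1 -esum (raddf_sum (pr0 D)). Qed.

(** Delta_j is Lambda_0 e_j, by x |-> x d_j: positive degrees act by zero on Delta_j, and [d_free]
    excludes further relations. *)
Lemma standard_sum : direct_sum (C := Mod L) (fun i => gm_mod (Delta i)) (gm_mod (degree0 D)).
Proof.
have exc j : exists c : Delta j -> L, forall x, x = c x *: d j.
  by have [c cP] := choice (@dP j); exists c.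
have [c cP] := dep_choice exc.
have cE j a a' : a *: d j = a' *: d j -> pr0 D (a * e j) = pr0 D (a' * e j).
  move=> aa; apply: gr0_val_inj; rewrite !pr0_val !gcompM0; apply/subr0_eq.
  rewrite -mulrBl (gcomp_id _ (eB j)) eqxx; apply: d_free.
    by rewrite memvB ?gcomp_mem.
  by rewrite scalerBl !part0 aa subrr.
have li j : linear (fun y : Delta j => pr0 D (c j y * e j) : degree0 D).
  move=> a x y; rewrite (cE j _ (a * c j x + c j y)).
    rewrite mulrDl rmorphD -mulrA rmorphM //.
  by rewrite scalerDl -scalerA -!cP.
have lp j : linear (fun x : degree0 D => gr0_val (x : gr0 D) *: d j).
  move=> a x y; pose z : degree0_mod D := a *: (x : degree0_mod D).
  transitivity ((gr0_val (z : gr0 D) + gr0_val (y : gr0 D)) *: d j).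
    by rewrite -(raddfD (@gr0_val _ _ D)).
  by rewrite scalerDl [gr0_val z]degree0Z -scalerA part0.
exists (fun j => mkhom (li j)), (fun j => mkhom (lp j)); split=> [i y|i j y nij|x] /=.
- by rewrite pr0_val part0 -scalerA de -cP.
- by rewrite pr0_val part0 -scalerA -(de i) (scalerA (e j)) eM eq_sym (negPf nij) scale0r scaler0.
have E j : pr0 D (c j (gr0_val (x : gr0 D) *: d j) * e j) = (x : gr0 D) * pr0 D (e j).
  by rewrite (cE j _ (gr0_val (x : gr0 D))) -?cP // rmorphM /= pr0K.
under eq_bigr do rewrite E.
rewrite -[LHS]/(\sum_j (x : gr0 D) * pr0 D (e j)) -mulr_sumr.
by rewrite e0sum mulr1.
Qed.

Lemma degree0_bproj : bproj (D 0%N) (degree0 D).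
Proof.
apply: (bproj_sum standard_sum) => j.
exact: (@bproj_standard _ _ _ _ _ _ _ _ eB de dP d_free d_pos j).
Qed.

Let e0_val i : gr0_val (e0 i) = e i.
Proof. by rewrite pr0_val (gcomp_id _ (eB i)) eqxx. Qed.
Let chi0 i (a : gr0 D) := chi i (gr0_val a).

Let e0M i j : e0 i * e0 j = if i == j then e0 i else 0.
Proof.
apply: gr0_val_inj; rewrite rmorphM /= !e0_val eM.
by case: eqP; rewrite ?e0_val ?rmorph0.
Qed.
Let e0_neq0 i : e0 i != 0.
Proof. by apply: contra_neq (e_neq0 i) => z; rewrite -e0_val z rmorph0. Qed.
Let tri0 (i j : 'I_r) a : (j < i)%N -> e0 i * a * e0 j = 0.
Proof.
move=> ji; apply: gr0_val_inj; rewrite !rmorphM /= !e0_val.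
exact: B_tri (gr0_mem _) ji.
Qed.
Let diag0 i a : e0 i * a * e0 i = chi0 i a *: e0 i.
Proof.
apply: gr0_val_inj; rewrite !rmorphM /= !e0_val B_diag ?gr0_mem //.
by rewrite -[RHS]/(chi0 i a *: gr0_val (e0 i)) e0_val.
Qed.

Lemma degree0_tilting : tilting (restrict (@gr0_val _ _ D) (degree0 D) : Mod (gr0 D)).
Proof.
pose N : lmodType (gr0 D) := restrict (@gr0_val _ _ D) (degree0 D).
apply: (@regular_tilting _ _ _ e0 chi0 e0M e0sum tri0 diag0 N (fun x => x : gr0 D) (fun x => x : N)) => //.
move=> a x y; rewrite -[a *: x + y]/(pr0 D (gr0_val a) * (x : gr0 D) + (y : gr0 D)).
by rewrite pr0K.
Qed.

Let reg c (M : gmod G) : gmod D := regrade eM esum He D_ind c M.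

(** The constant h(j) of the regrading is chosen for this: e_i Delta_j lives in old degree h(j) -
    h(i), which is the one attached to new degree 0. *)
Lemma standard_concentrated j : concentrated (reg (h j) (Delta j)) 0.
Proof.
rewrite /concentrated /in_degree; apply: (@gm_ind _ _ _ (Delta j)) => [|x y xE yE|l x xl].
- exact: (@gpr0 _ _ _ (reg (h j) (Delta j))).
- by apply: etrans (@gm_prD _ _ _ (reg (h j) (Delta j)) _ x y) _; rewrite xE yE.
rewrite -{2}[x]scale1r -esum scaler_suml /= /reg_pr; apply: eq_bigr => i _.
have [ex0|nex] := eqVneq (e i *: x) 0.
  by rewrite scalerDr -!gprZ0 // ex0 !gpr0 addr0.
have eex : e i *: (e i *: x) = e i *: x by rewrite scalerA eM eqxx.
have exl : gm_pr l (e i *: x) = e i *: x by rewrite gprZ0 // xl.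
have hE := d_height eex exl nex.
have -> : old_deg h (h j) i 0 = l by rewrite /old_deg; lia.
by rewrite xl (gpr_other xl) ?addr0 //; lia.
Qed.

(** A cocycle with values in Delta_j is read in the first term of the coresolution and bounded
    inside the kernel of the first differential, which is Delta_j. *)
Lemma ext_standard m (v : int) (P : nat -> Gr D) (eps : hom (P 0%N) (degree0 D : Gr D))
    (del : forall m, hom (P m.+1) (P m)) (j : 'I_r) (f : gm_mod (P m.+1) -> Delta j) :
  resolution eps del -> (forall m, projective (P m)) -> m.+1%:Z != v ->
  @graded_mor _ _ _ (P m.+1) (shift (reg (h j) (Delta j)) v) f ->
  (forall x, f (del m.+1 x) = 0) ->
  exists g : gm_mod (P m) -> Delta j,
    @graded_mor _ _ _ (P m) (shift (reg (h j) (Delta j)) v) g /\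
    forall x, g (del m x) = f x.
Proof.
move=> resP projP nv gf fd; have [Q [eta [dd [[ieta eta0 ddP] gQ sQ]]]] := Hres j.
have geta : @graded_mor _ _ _ (shift (reg (h j) (Delta j)) v) (shift (reg (h j) (Q 0%N)) v) eta.
  by apply: shift_mor; apply: regrade_mor; exact: (hom_mor eta).
have leta : linear eta := geta.1.
have [|||g [gg dg gE]] := ext_coresolution eB B_tri L_bproj degree0_bproj
  resP projP ddP (fun u => (gQ u).1) sQ (graded_mor_comp gf geta) (u := 0%N) (v := v).
- by move=> x; rewrite /= fd (lin0 leta).
- by move=> x; apply/eta0; exists (f x).
- by rewrite addn0.
have [c cP] := choice (fun x => (eta0 (g x)).1 (dg x)).
have lc : linear c by move=> a x y; apply: ieta; rewrite leta -!cP gg.1.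
exists c; split=> [|x]; last by apply: ieta; rewrite -cP -gE.
by split=> // i x; apply: ieta; rewrite -cP gg.2 geta.2 -cP.
Qed.

Lemma ext_degree0 n (v : int) : n%:Z != v ->
  @ext_vanish _ (Gr D) n (degree0 D) (shift (degree0 D) v).
Proof.
case: n => [|m] nv P eps del resP projP f fd.
  (* For n = 0: modulo the image of [del] every element has degree 0, whereas the target sits in
     degree v. *)
  move=> x; have [_ ee _] := resP; have [leps deps] := hom_mor eps.
  have [|y yE] := (ee (x - gm_pr 0 x)).1.
    by rewrite (linB leps) deps (degree0_concentrated (eps x)) subrr.
  have [lf df] := hom_mor f.
  have /subr0_eq -> : f x - f (gm_pr 0 x) = 0 by rewrite -(linB lf) yE fd.
  rewrite df; have := @gpr_other _ _ _ (degree0 D) 0 (0 - v) (f x) (degree0_concentrated _).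
  by apply; rewrite sub0r oppr_eq0 eq_sym.
have [inj [pr [K1 K2 K3]]] := standard_sum.
have cD := @degree0_concentrated _ _ D; have [lf df] := hom_mor f.
have ex j : exists g : gm_mod (P m) -> Delta j,
    @graded_mor _ _ _ (P m) (shift (reg (h j) (Delta j)) v) g /\
    forall x, g (del m x) = pr j (f x).
  apply: (ext_standard (f := pr j \o f) resP projP nv).
    apply: graded_mor_comp (hom_mor f) _; apply: shift_mor.
    by apply: concentrated_mor => //; [exact: standard_concentrated | exact: (hom_mor (pr j))].
  by move=> x; rewrite /= fd (lin0 (hom_mor (pr j))).
have [g gP] := dep_choice ex.
have gi j : @graded_mor _ _ _ (P m) (shift (degree0 D) v) (inj j \o g j).
  apply: graded_mor_comp (gP j).1 _; apply: shift_mor.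
  by apply: concentrated_mor => //; [exact: standard_concentrated | exact: (hom_mor (inj j))].
have gs : @graded_mor _ _ _ (P m) (shift (degree0 D) v) (fun x => \sum_j inj j (g j x)).
  split=> [a x y|i x].
    by rewrite scaler_sumr -big_split; apply: eq_bigr => j _; exact: (gi j).1.
  rewrite (gpr_sum (M := shift (degree0 D) v)); apply: eq_bigr => j _; exact: (gi j).2.
exists (@Hom _ (Gr D) (P m) (shift (degree0 D) v) _ gs) => x /=.
by rewrite -[LHS]K3; apply: eq_bigr => j _; rewrite (gP j).2.
Qed.

Lemma degree0_koszul : koszul (degree0 D).
Proof.
split; [exact: (directed_gldim e0M e0sum tri0 diag0) | exact: degree0_concentrated
  | exact: degree0_tilting | exact: ext_degree0].
Qed.

End DeltaKoszul.

(** * The degree 0 part of the Delta-grading *)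

Section DeltaBorel.

Variables (k : fieldType) (L : falgType k) (r : nat) (G : grading L).
Variables (e : 'I_r -> L) (h : 'I_r -> nat) (chi : 'I_r -> L -> k).
Hypothesis He : forall i, e i \in G 0%N.
Hypothesis eM : forall i j, e i * e j = if i == j then e i else 0.
Hypothesis esum : \sum_i e i = 1.
Hypothesis path : forall l (i j : 'I_r) a, a \in G l -> e i * a * e j != 0 ->
  exists n, (l + h i = h j + n.*2)%N.
Hypothesis path0 : forall l (i j : 'I_r) a, a \in G l -> e i * a * e j != 0 ->
  (l + h i = h j)%N -> (i <= j)%N.
Hypothesis chi_lin : forall i c a b, chi i (c *: a + b) = c * chi i a + chi i b.
Hypothesis chiM : forall i a b, chi i (a * b) = chi i a * chi i b.
Hypothesis chie : forall i j, chi i (e j) = (i == j)%:R.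
Hypothesis chi_0 : forall i a, a \in G 0%N -> e i * a = chi i a *: e i.
Hypothesis chi_pos : forall i l a, (0 < l)%N -> a \in G l -> chi i a = 0.

Let D := delta_grading He eM esum path.

Let eZ i : e i * e i = e i. Proof. by rewrite eM eqxx. Qed.
Let chiD i a b : chi i (a + b) = chi i a + chi i b.
Proof. by have := chi_lin i 1 a b; rewrite scale1r mul1r. Qed.
Let chi0 i : chi i 0 = 0.
Proof. by apply: (@addrI _ (chi i 0)); rewrite -chiD !addr0. Qed.

Lemma delta_e i : e i \in D 0%N.
Proof.
have -> : e i = e i * 1 * e i by rewrite mulr1 eZ.
by apply: delta_mem; [exact: gr_one | rewrite add0n addn0].
Qed.

Lemma delta_homog l b : b \in D 0%N -> gcomp G l b \in D 0%N.
Proof.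
move: b; apply: delta_ind => [|x y Dx Dy|m i j a Ga mE].
- by rewrite gcomp0 mem0v.
- by rewrite gcompD memvD.
have Gb : e i * a * e j \in G m by have := grM (grM (He i) Ga) (He j); rewrite add0n addn0.
rewrite (gcomp_id _ Gb); case: eqP => _; last exact: mem0v.
exact: delta_mem Ga mE.
Qed.

Lemma delta_tri (i j : 'I_r) b : b \in D 0%N -> (j < i)%N -> e i * b * e j = 0.
Proof.
move=> + ji; move: b; apply: delta_ind => [|x y x0 y0|l p q a Ga lE].
- by rewrite mulr0 mul0r.
- by rewrite mulrDr mulrDl x0 y0 addr0.
rewrite !mulrA eM; have [ip|_] := eqVneq i p; last by rewrite !mul0r.
rewrite -mulrA eM; have [qj|_] := eqVneq q j; last by rewrite mulr0.
apply/eqP/negPn/negP => nz; move: lE; rewrite -ip qj addn0 => lE.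
by rewrite qj in nz; have := path0 Ga nz lE; rewrite leqNgt ji.
Qed.

Lemma chi_sandwich i p q a : chi i (e p * a * e q) = if (i == p) && (i == q) then chi i a else 0.
Proof.
rewrite !chiM !chie; case: eqP => _; last by rewrite !mul0r.
by case: eqP => _; rewrite ?mulr1 ?mul1r ?mulr0.
Qed.

Lemma delta_diag i b : b \in D 0%N -> e i * b * e i = chi i b *: e i.
Proof.
move: b; apply: delta_ind => [|x y xE yE|l p q a Ga lE].
- by rewrite mulr0 mul0r chi0 scale0r.
- by rewrite mulrDr mulrDl xE yE chiD scalerDl.
rewrite chi_sandwich !mulrA eM; have [ip|_] := eqVneq i p; last by rewrite !mul0r scale0r.
rewrite -mulrA eM [q == i]eq_sym; have [iq|_] := eqVneq i q; last by rewrite mulr0 scale0r.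
have l0 : l = 0%N by move: lE; rewrite -ip -iq; lia.
by rewrite l0 in Ga; rewrite -iq chi_0 // -scalerAl eZ.
Qed.

(** A piece e_i L_(l) e_i of Delta-degree n has l = 2n, so chi_i vanishes on it for n > 0. *)
Lemma chi_delta i a : chi i (gcomp D 0 a) = chi i a.
Proof.
rewrite [in RHS](gcomp_sum D a) (big_morph (chi i) (chiD i) (chi0 i)) big_ord_recl big1 ?addr0 //.
move=> n _; have := gcomp_mem D (lift ord0 n) a; move: (gcomp D _ a).
apply: delta_ind => [|x y x0 y0|l p q b Gb lE]; first exact: chi0.
  by rewrite chiD x0 y0 addr0.
rewrite chi_sandwich; case: andP => // -[/eqP ip /eqP iq].
apply: chi_pos Gb; move: lE; rewrite -ip -iq /= /bump; lia.
Qed.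

Variables (Delta : 'I_r -> gmod G) (d : forall j, Delta j).
Hypothesis d_ann : forall j a, a *: d j = 0 -> a * e j \in ideal_above e j.
Hypothesis d_height : forall i j l (x : Delta j), e i *: x = x -> gm_pr l x = x -> x != 0 ->
  (h i)%:Z = (h j)%:Z - l.

(** In Delta_j the height drops by exactly the original degree; an element of e_p L_(l) e_q acting
    non-trivially thus has l = h(q) - h(p), which is Delta-degree 0. *)
Lemma delta_pos j n a (x : Delta j) : (0 < n)%N -> a \in D n -> a *: x = 0.
Proof.
move=> n_gt0 Da; move: a Da x; apply: delta_ind => [x|a b a0 b0 x|l p q a Ga lE x].
- by rewrite scale0r.
- by rewrite scalerDl a0 b0 addr0.
move: x; apply: gm_ind => [|x y x0 y0|w x xw]; first by rewrite scaler0.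
  by rewrite scalerDr x0 y0 addr0.
set z := (e p * a * e q) *: x.
have [y0|ny] := eqVneq (e q *: x) 0; first by rewrite /z -scalerA y0 scaler0.
have [//|nz] := eqVneq z 0.
have Gb : e p * a * e q \in G l by have := grM (grM (He p) Ga) (He q); rewrite add0n addn0.
have E1 : (h q)%:Z = (h j)%:Z - w.
  by apply: d_height ny; [rewrite scalerA eZ | rewrite gprZ0 // xw].
have E2 : (h p)%:Z = (h j)%:Z - (l%:Z + w).
  by apply: d_height nz; [rewrite /z scalerA !mulrA eZ | exact: in_degreeZ Gb xw].
by lia.
Qed.

(** The Delta-degree 0 part of an element of the ideal, multiplied by e_j, factors through spaces
    e_m B e_j with m > j, and these are zero. *)
Lemma delta_free j b : b \in D 0%N -> b *: d j = 0 -> b * e j = 0.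
Proof.
move=> Db /d_ann bI.
have ideal0 c : c \in ideal_above e j -> gcomp D 0 (c * e j) = 0.
  move: c; apply: ideal_above_ind => [|x y x0 y0|m x y jm].
  - by rewrite mul0r gcomp0.
  - by rewrite mulrDl gcompD x0 y0 addr0.
  rewrite !gcompM0 !(gcomp_id _ (delta_e _)) eqxx -!mulrA (mulrA (e m)).
  by rewrite delta_tri ?mulr0 ?gcomp_mem.
have := ideal0 _ bI; rewrite -mulrA eZ gcompM0 (gcomp_id _ Db) (gcomp_id _ (delta_e j)) eqxx.
by [].
Qed.

End DeltaBorel.

Theorem theorem5p3p1 (k : fieldType) (L : falgType k) (r : nat)
    (G : grading L)
    (HG0 : degree0_iso_power G r)
    (HG1 : generated_in_degree1 G)
    (e : 'I_r -> L) (S Delta Nabla T : 'I_r -> gmod G) (Tc : lmodType L)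
    (HS : ordered_simples e (fun i => gm_mod (S i)))
    (He : forall i, e i \in G 0%N)
    (HDelta : forall i, standard e (fun i => gm_mod (S i)) i (gm_mod (Delta i)))
    (HNabla : forall i, costandard (fun i => gm_mod (S i)) i (gm_mod (Nabla i)))
    (Hqh : quasi_hereditary (fun i => gm_mod (Delta i)))
    (HT : characteristic_tilting (fun i => gm_mod (Delta i))
            (fun i => gm_mod (Nabla i)) (fun i => gm_mod (T i)) Tc)
    (Hlift : normalized_lifts S Delta Nabla T)
    (D : duality (fin_cat (Mod L))) (Dgr : duality (fin_cat (Gr G)))
    (HDgr : duality_lift D Dgr)
    (HDS : forall i, dual_to D (gm_mod (S i)) (gm_mod (S i)))
    (HDgrS : forall i (l : int),
       dual_to Dgr (shift (S i) l) (shift (S i) (- l)))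
    (h : 'I_r -> nat)
    (Hh1 : H1 h S Delta)
    (Hh2 : H2 h Delta T Tc) :
  exists G' : grading L,
    (forall d, G' d = delta_comp G e h d) /\
    exists Delta0 : gmod G',
      [/\ direct_sum (C := Mod L) (fun i => gm_mod (Delta i)) (gm_mod Delta0),
          is_degree0_part Delta0
        & koszul Delta0].
Proof.
case: Hlift => HSc Htop Tlift; case: Hqh => Lfilt Hdiv.
case: HT => Tind Tsum [[Tfg _ _ _ _] _] TD TN.
have [tau [tau' [tauP tauP' [tauK tauK'] [tauG _] taue_]]] := anti_graded HG0 He HG1 HS HSc HDS.
have taue i : tau (e i) = e i by case: (taue_ i).
have taue' i : tau' (e i) = e i by case: (taue_ i).
have eM := e_mul HS; have esum := e_sum HS.
have path2 := path_height HG0 He HG1 HS HSc HDelta Hdiv Htop Hh1 tauP (can_inj tauK) tauG taue.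
have path l (i j : 'I_r) a : a \in G l -> e i * a * e j != 0 ->
    exists n, (l + h i = h j + n.*2)%N.
  by move=> Ga nz; have [n [lE _]] := path2 l i j a Ga nz; exists n.
have path0 l (i j : 'I_r) a : a \in G l -> e i * a * e j != 0 ->
    (l + h i = h j)%N -> (i <= j)%N.
  move=> Ga nz lE; have [n [nE n0]] := path2 l i j a Ga nz.
  have [|/ltnW //|[-> _] //] := n0; lia.
pose ch := chi HG0 He HS; pose d := dgen HG0 He HS HSc HDelta.
have chi_lin := chi_linear HG0 He HS : forall i c a b, ch i (c *: a + b) = c * ch i a + ch i b.
have chiM := chi_mul HG0 He HS : forall i a b, ch i (a * b) = ch i a * ch i b.
have chie := chi_e HG0 He HS : forall i j, ch i (e j) = (i == j)%:R.
have chi_pos i l a : (0 < l)%N -> a \in G l -> ch i a = 0 := @chi_pos _ _ _ _ _ _ HG0 He HS i l a.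
have chi_E i a : a \in G 0%N -> e i * a = ch i a *: e i.
  by move=> Ga; rewrite -(chiE HG0 He HS) (gcomp_id _ Ga) eqxx.
have chi_0 i a : ch i (gcomp G 0 a) = ch i a.
  by apply: (e_scale_inj HS (i := i)); rewrite -chi_E ?gcomp_mem // (chiE HG0 He HS).
pose D0 := delta_grading He eM esum path.
have eB := delta_e He eM esum path : forall i, e i \in D0 0%N.
have B_tri : forall (i j : 'I_r) b, b \in D0 0%N -> (j < i)%N -> e i * b * e j = 0.
  by move=> i j b; exact: (delta_tri (eM := eM) (esum := esum) path0).
have B_diag : forall i b, b \in D0 0%N -> e i * b * e i = ch i b *: e i.
  by move=> i b; exact: delta_diag chi_lin chiM chie chi_E i b.
have chi_part : forall i a, ch i (gcomp D0 0 a) = ch i a.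
  exact: (chi_delta He eM esum path chi_lin chiM chie chi_pos).
have de j : e j *: d j = d j := dgen_e HG0 He HS HSc HDelta j.
have dP j (x : Delta j) : exists a, x = a *: d j := dgenP HG0 He HS HSc HDelta x.
have d_above (j m : 'I_r) (x : Delta j) : (j < m)%N -> e m *: x = 0.
  exact: (dgen_above HG0 He HS HSc HDelta).
have d_ann j a : a *: d j = 0 -> a * e j \in ideal_above e j by exact: dgen_ann.
have d_height i j l (x : Delta j) : e i *: x = x -> gm_pr l x = x -> x != 0 ->
    (h i)%:Z = (h j)%:Z - l.
  exact: (standard_degree HG0 He HS HSc Hh1).
have d_pos : forall j n a (x : Delta j), (0 < n)%N -> a \in D0 n -> a *: x = 0.
  by move=> j n a x; exact: (delta_pos d_height).
have d_free : forall j b, b \in D0 0%N -> b *: d j = 0 -> b * e j = 0.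
  by move=> j b; exact: (delta_free path0 d_ann).
have B_homog : forall l b, b \in D0 0%N -> gcomp G l b \in D0 0%N by move=> l b; exact: delta_homog.
have Nc i : costd D0 ch i (Nabla i).
  exact: (costandard_costd eM esum eB chiM chie chi_part B_tri B_diag de dP d_above d_ann
    d_pos Lfilt tauP tauP' tauK tauK' taue taue' (sgen_neq0 HG0 He HS HSc)
    (sgenZ HG0 He HS HSc) (sgenP HG0 He HS HSc) (no_factor_aboveP HG0 He HS HSc) (HNabla i)).
have res := tilting_coresolution eM esum eB chiM chie chi_part B_tri B_diag de dP d_above d_ann
  d_free d_pos (standard_map HG0 He HS HSc HDelta) Lfilt B_homog chi_0 chi_pos
  (dgen_degree HG0 He HS HSc HDelta Hdiv Htop) tauP tauP' tauK tauK' taue taue' tauG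
  Tind Tsum Tfg TD TN Nc Tlift Hh2.
have LB : bproj (D0 0%N) L^o := @bproj_regular _ _ _ _ _ _ _ _ eB de dP d_free d_pos Lfilt.
exists D0; split=> //; exists (degree0 D0); split.
- exact: (standard_sum eM esum eB de dP d_free d_pos).
- exact: degree0_part.
apply: (degree0_koszul eM esum (e_neq0 HS) He eB B_tri B_diag _ de dP d_free d_pos d_height LB res).
by move=> n P P0 PD Pg a; exact: delta_ind.
Qed.
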